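(* Let $M=\mathbb{R}^n$ with the standard metric, $p\ge q>1$, $s>\max\{p-1,1\}$, and assume $$s\le \frac{n+1}{n}\,q-1 .$$ Let $u_0\in L^1(\mathbb{R}^n)$ with $u_0\ge0$ a.e. Then any nonnegative weak solution $u\in W^{1,p}_{loc}(\mathbb{R}^n\times[0,\infty))\cap L^s_{loc}(\mathbb{R}^n\times[0,\infty))$ of $$\partial_t u-\Delta_p u-\Delta_q u\ge u^s\ \text{ in } \mathbb{R}^n\times(0,\infty),\qquad u=u_0\ \text{ in } \mathbb{R}^n\times\{0\},$$ is equal to $0$ a.e. on $\mathbb{R}^n\times[0,\infty)$.
   Context: $\nabla$ and $\mathrm{div}$ are taken in the space variable, and $\Delta_z u=\mathrm{div}(|\nabla u|^{z-2}\nabla u)$ for $z\in\{p,q\}$. Weak solution: $u\in W^{1,p}_{loc}(\mathbb{R}^n\times[0,\infty))\cap L^s_{loc}(\mathbb{R}^n\times[0,\infty))$ is a nonnegative weak solution of the problem $$\partial_t u-\Delta_p u-\Delta_q u\ge u^s\ \text{ in } \mathbb{R}^n\times(0,\infty),\qquad u=u_0\ \text{ in } \mathbb{R}^n\times\{0\},$$ if $u\ge0$ a.e. and for every $\psi\in W^{1,p}(\mathbb{R}^n\times[0,\infty))\cap L^\infty(\mathbb{R}^n\times[0,\infty))$ with $\psi\ge0$ and compact support in $\mathbb{R}^n\times[0,\infty)$, $$\int_0^\infty\!\!\int_{\mathbb{R}^n} u\,\partial_t\psi\,dx dt+\int_{\mathbb{R}^n} u_0\,\psi(x,0)\,dx+\int_0^\infty\!\!\int_{\mathbb{R}^n}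 u^s\psi\,dx dt\le \int_0^\infty\!\!\int_{\mathbb{R}^n}|\nabla u|^{p-2}\langle\nabla u,\nabla\psi\rangle\,dx dt+\int_0^\infty\!\!\int_{\mathbb{R}^n}|\nabla u|^{q-2}\langle\nabla u,\nabla\psi\rangle\,dx dt .$$ *)

(* Defs.v *)
From HB Require Import structures.
From mathcomp Require Import all_boot all_order all_algebra.
From mathcomp Require Import all_classical all_reals all_analysis.

Set Implicit Arguments.
Unset Strict Implicit.
Unset Printing Implicit Defensive.

Import Order.TTheory GRing.Theory Num.Theory.
Import numFieldNormedType.Exports.

Local Open Scope classical_set_scope.
Local Open Scope ring_scope.

Section measurable_rV.
Context {R : realType} (n : nat).

(* The sigma-algebra generated by the coordinates, i.e. the Borel one. *)
Let coord : 'I_n -> 'rV[R]_n -> R := fun i x => x ord0 i.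

Let rV_set0 : g_sigma_preimage coord set0.
Proof. exact: sigma_algebra0. Qed.

Let rV_setC A : g_sigma_preimage coord A -> g_sigma_preimage coord (~` A).
Proof. exact: sigma_algebraC. Qed.

Let rV_bigcup (F : (set 'rV[R]_n)^nat) :
  (forall i, g_sigma_preimage coord (F i)) ->
  g_sigma_preimage coord (\bigcup_i (F i)).
Proof. exact: sigma_algebra_bigcup. Qed.

HB.instance Definition _ := @isMeasurable.Build
  (measure_tuple_display default_measure_display)
  'rV[R]_n (g_sigma_preimage coord) rV_set0 rV_setC rV_bigcup.

Lemma measurable_coord (i : 'I_n) :
  measurable_fun [set: 'rV[R]_n] (fun x : 'rV[R]_n => x ord0 i).
Proof.
move=> _ Y mY; rewrite setTI; apply: sub_sigma_algebra => /=.
rewrite -bigcup_seq/=; exists i => /=; first by rewrite mem_index_enum.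
by exists Y => //; rewrite setTI.
Qed.

Lemma measurable_fun_rV d (T : measurableType d) (f : T -> 'rV[R]_n) :
  (forall i, measurable_fun [set: T] (fun x => f x ord0 i)) ->
  measurable_fun [set: T] f.
Proof.
move=> mf.
have : g_sigma_preimage (fun i x => f x ord0 i) `<=` measurable.
  apply: smallest_sub; first exact: sigma_algebra_measurable.
  case: n f mf => [|m] f mf; first by rewrite big_ord0.
  rewrite -bigcup_mkord_ord; apply: bigcup_sub => i Ii.
  by move=> A [B mB <-]; exact: mf.
rewrite (g_sigma_preimage_comp coord f) => H _ A mA; apply: H.
by exists A.
Qed.

End measurable_rV.

(* Restated because the canonical sigma-finite structure on product measures is
   shadowed in the library by the one on products of subprobabilities. *)
Lemma sigma_finite_product d1 d2 (T1 : measurableType d1)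
    (T2 : measurableType d2) (R : realType)
    (m1 : {sigma_finite_measure set T1 -> \bar R})
    (m2 : {sigma_finite_measure set T2 -> \bar R}) :
  sigma_finite setT (m1 \x m2)%E.
Proof.
have /sigma_finiteP[F [TF ndF Foo]] := sigma_finiteT m1.
have /sigma_finiteP[G [TG ndG Goo]] := sigma_finiteT m2.
exists (fun n => F n `*` G n).
  rewrite -setXTT TF TG predeqE => -[x y]; split.
    move=> [/= [n _ Fnx] [k _ Gky]]; exists (maxn n k) => //; split.
    - by move: x Fnx; exact/subsetPset/ndF/leq_maxl.
    - by move: y Gky; exact/subsetPset/ndG/leq_maxr.
  by move=> [n _ []/= ? ?]; split; exists n.
move=> k; have [? ?] := Foo k; have [? ?] := Goo k.
split; first exact: measurableX.
by rewrite product_measure1E// lte_mul_pinfty// ge0_fin_numE.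
Qed.

Section lebesgue_rV.
Context {R : realType}.

Definition rV_cons n (z : measurableTypeR R * 'rV[R]_n) : 'rV[R]_n.+1 :=
  \row_i oapp (fun j => z.2 ord0 j) z.1 (unlift ord0 i).

Definition rV_uncons n (x : 'rV[R]_n.+1) : measurableTypeR R * 'rV[R]_n :=
  (x ord0 ord0, \row_j x ord0 (lift ord0 j)).

Lemma rV_consK n : cancel (@rV_cons n) (@rV_uncons n).
Proof.
move=> [a y]; rewrite /rV_uncons mxE unlift_none /=; congr pair.
by apply/rowP => j; rewrite !mxE liftK.
Qed.

Lemma measurable_rV_cons n : measurable_fun setT (@rV_cons n).
Proof.
apply: measurable_fun_rV => i.
case: (unliftP ord0 i) => [j|] ->.
- under eq_fun do rewrite mxE liftK /=.
  exact: measurableT_comp (@measurable_coord _ _ j) measurable_snd.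
- under eq_fun do rewrite mxE unlift_none /=.
  exact: measurable_fst.
Qed.

Lemma measurable_rV_uncons n : measurable_fun setT (@rV_uncons n).
Proof.
apply: measurable_fun_pair; first exact: measurable_coord.
apply: measurable_fun_rV => j; under eq_fun do rewrite mxE.
exact: measurable_coord.
Qed.

Section step.
Variables (n : nat) (m : {sigma_finite_measure set 'rV[R]_n -> \bar R}).

Definition lebesgue_step : set 'rV[R]_n.+1 -> \bar R :=
  pushforward (lebesgue_measure \x m)%E (@rV_cons n).

Let step0 : lebesgue_step set0 = 0%E.
Proof. by rewrite /lebesgue_step /pushforward preimage_set0 measure0. Qed.

Let step_ge0 A : (0 <= lebesgue_step A)%E.
Proof. by rewrite /lebesgue_step /pushforward measure_ge0. Qed.

Let step_sigma_additive : semi_sigma_additive lebesgue_step.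
Proof.
move=> F mF tF mUF; rewrite /lebesgue_step /pushforward preimage_bigcup.
apply: measure_semi_sigma_additive.
- by move=> k; rewrite -[X in measurable X]setTI; exact: measurable_rV_cons.
- apply/trivIsetP => /= i j _ _ ij; rewrite -preimage_setI.
  by move/trivIsetP : tF => /(_ _ _ _ _ ij) ->//; rewrite preimage_set0.
- rewrite -preimage_bigcup -[X in measurable X]setTI.
  exact: measurable_rV_cons.
Qed.

HB.instance Definition _ := isMeasure.Build _ _ _ lebesgue_step
  step0 step_ge0 step_sigma_additive.

Let step_sigma_finite : sigma_finite setT lebesgue_step.
Proof.
have [F TF Foo] := sigma_finite_product lebesgue_measure m.
exists (fun k => @rV_uncons n @^-1` F k).
  by rewrite -preimage_bigcup -TF preimage_setT.
move=> k; have [mF Fk] := Foo k; split.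
  by rewrite -[X in measurable X]setTI; exact: measurable_rV_uncons.
rewrite /lebesgue_step /pushforward -comp_preimage.
by rewrite (_ : _ \o _ = id) ?preimage_id//; apply/funext/rV_consK.
Qed.

HB.instance Definition _ := Measure_isSigmaFinite.Build _ _ _ lebesgue_step
  step_sigma_finite.

End step.

(* Lebesgue measure on R^n: under R^n.+1 = R * R^n it is the product measure. *)
Fixpoint lebesgue_rV n : {sigma_finite_measure set 'rV[R]_n -> \bar R} :=
  match n with
  | 0 => [the {sigma_finite_measure set 'rV[R]_0 -> \bar R} of
            dirac (0 : 'rV[R]_0)]
  | n'.+1 => [the {sigma_finite_measure set 'rV[R]_n'.+1 -> \bar R} of
            lebesgue_step (lebesgue_rV n')]
  end.

Lemma lebesgue_rV_box n (A : 'I_n -> set R) : (forall i, measurable (A i)) ->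
  lebesgue_rV n [set x | forall i, A i (x ord0 i)] =
  (\prod_(i < n) lebesgue_measure (A i))%E.
Proof.
elim: n A => [|n IHn] A mA.
  by rewrite big_ord0 /= diracE mem_set// => -[].
rewrite big_ord_recl /= /lebesgue_step /pushforward.
rewrite (_ : _ @^-1` _ = A ord0 `*`
    [set y : 'rV[R]_n | forall j, A (lift ord0 j) (y ord0 j)]); last first.
  apply/seteqP; split => -[a y] /=.
    move=> H; split; first by have := H ord0; rewrite mxE unlift_none.
    by move=> j; have := H (lift ord0 j); rewrite mxE liftK.
  move=> [Aa Ay] i; rewrite mxE.
  by case: (unliftP ord0 i) => [j|] -> /=.
rewrite product_measure1E; first by rewrite (IHn (fun j => A (lift ord0 j))).
- exact: mA.
- rewrite (_ : mkset _ = \bigcap_(j in [set: 'I_n])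
    ((fun y : 'rV[R]_n => y ord0 j) @^-1` A (lift ord0 j))); last first.
    by apply/seteqP; split => [y H j _|y H j]; apply: H.
  apply: fin_bigcap_measurable => [|j _]; first exact: finite_finset.
  by rewrite -[X in measurable X]setTI; exact: measurable_coord.
Qed.

End lebesgue_rV.

Section smooth.
Context {R : realType} {V : normedModType R}.

Fixpoint Ck (k : nat) (f : V -> R) : Prop :=
  if k is k'.+1 then
    (forall z v, derivable f z v) /\
    (forall v, Ck k' (fun z => 'D_v f z))
  else continuous f.

(* phi belongs to C_c^oo(U). *)
Definition test_function (U : set V) (phi : V -> R) : Prop :=
  (forall k, Ck k phi) /\
  exists K : set V, [/\ compact K, K `<=` U & forall z, ~ K z -> phi z = 0].

End smooth.

Section spacetime.
Context {R : realType} (n : nat).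

(* points (x, t) *)
Local Notation E := ('rV[R]_n * R)%type.

Definition lebesgue_st : set ('rV[R]_n * measurableTypeR R) -> \bar R :=
  (lebesgue_rV n \x lebesgue_measure)%E.

HB.instance Definition _ := Measure.on lebesgue_st.
HB.instance Definition _ := Measure_isSigmaFinite.Build _ _ _ lebesgue_st
  (sigma_finite_product (lebesgue_rV n) lebesgue_measure).

Definition half_space : set E := [set z | 0 <= z.2].
Definition open_half_space : set E := [set z | 0 < z.2].

Definition dir_x (i : 'I_n) : E := (delta_mx ord0 i, 0).
Definition dir_t : E := (0, 1).

Definition inner (v w : 'rV[R]_n) : R := \sum_(i < n) v ord0 i * w ord0 i.

(* The norm of the normedModType 'rV[R]_n is the max norm. *)
Definition enorm (v : 'rV[R]_n) : R := Num.sqrt (inner v v).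

Definition Lp (p : \bar R) (D : set E) (f : E -> R) : Prop :=
  (f \_ D) \in Lfun lebesgue_st p.

(* L^p_loc(R^n x [0,oo)): compact sets may touch {t = 0}. *)
Definition Lp_loc (p : \bar R) (f : E -> R) : Prop :=
  forall K : set E, compact K -> K `<=` half_space -> Lp p K f.

Definition weak_derivative (v : E) (f g : E -> R) : Prop :=
  forall phi : E -> R, test_function open_half_space phi ->
    \int[lebesgue_st]_(z in open_half_space) (f z * 'D_v phi z) =
    - \int[lebesgue_st]_(z in open_half_space) (g z * phi z).

(* f, its weak spatial gradient Df and its weak time derivative ft all lie in
   the function space X. *)
Definition sobolev (X : (E -> R) -> Prop)
    (f : E -> R) (Df : E -> 'rV[R]_n) (ft : E -> R) : Prop :=
  [/\ X f,
      forall i, X (fun z => Df z ord0 i) /\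
        weak_derivative (dir_x i) f (fun z => Df z ord0 i) &
      X ft /\ weak_derivative dir_t f ft].

Definition W1p (p : R) := sobolev (Lp p%:E half_space).
Definition W1p_loc (p : R) := sobolev (Lp_loc p%:E).

Definition Lp_cvg (p : R) (fk : nat -> E -> R) (f : E -> R) : Prop :=
  Lnorm lebesgue_st p%:E (EFin \o ((fk k \- f) \_ half_space)) @[k --> \oo]
    --> 0%E.

(* g is the trace psi(., 0) in L^p(R^n) of psi in W^{1,p}(R^n x [0,oo)): the
   trace operator is the continuous extension of phi |-> phi(., 0) from the
   restrictions of functions in C_c^oo(R^{n+1}), which are dense. *)
Definition trace0 (p : R) (psi : E -> R) (Dpsi : E -> 'rV[R]_n)
    (psit : E -> R) (g : 'rV[R]_n -> R) : Prop :=
  g \in Lfun (lebesgue_rV n) p%:E /\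
  exists phi : nat -> E -> R,
    [/\ forall k, test_function setT (phi k),
        Lp_cvg p phi psi,
        forall i, Lp_cvg p (fun k z => 'D_(dir_x i) (phi k) z)
                           (fun z => Dpsi z ord0 i),
        Lp_cvg p (fun k z => 'D_dir_t (phi k) z) psit &
        Lnorm (lebesgue_rV n) p%:E (EFin \o (fun x => phi k (x, 0) - g x))
          @[k --> \oo] --> 0%E].

Definition nonneg_ae (f : E -> R) : Prop :=
  {ae lebesgue_st, forall z, half_space z -> 0 <= f z}.

Definition compact_support (f : E -> R) : Prop :=
  exists K : set E, [/\ compact K, K `<=` half_space &
    {ae lebesgue_st, forall z, half_space z -> ~ K z -> f z = 0}].

(* |v|^(r-2) <v, w>, equal to 0 when v = 0. *)
Definition flux (r : R) (v w : 'rV[R]_n) : R :=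
  enorm v `^ (r - 2) * inner v w.

(* Integrals are extended-real valued. All of them are finite, except possibly
   the first one when p < 2 (then u * psit need not be integrable); when neither
   its positive nor its negative part is integrable, that integral is undefined,
   has value -oo by convention, and psi imposes no condition. *)
Definition weak_inequality (p q s : R) (u0 : 'rV[R]_n -> R)
    (u : E -> R) (Du : E -> 'rV[R]_n)
    (psi : E -> R) (Dpsi : E -> 'rV[R]_n) (psit : E -> R)
    (psi0 : 'rV[R]_n -> R) : Prop :=
  (\int[lebesgue_st]_(z in half_space) (u z * psit z)%:E
   + \int[lebesgue_rV n]_x (u0 x * psi0 x)%:E
   + \int[lebesgue_st]_(z in half_space) (u z `^ s * psi z)%:E
   <= \int[lebesgue_st]_(z in half_space) (flux p (Du z) (Dpsi z))%:E
      + \int[lebesgue_st]_(z in half_space) (flux q (Du z) (Dpsi z))%:E)%E.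

Definition weak_solution (p q s : R) (u0 : 'rV[R]_n -> R) (u : E -> R) : Prop :=
  Lp_loc s%:E u /\ nonneg_ae u /\
  exists (Du : E -> 'rV[R]_n) (ut : E -> R), W1p_loc p u Du ut /\
    forall psi Dpsi psit psi0,
      W1p p psi Dpsi psit -> Lp +oo%E half_space psi ->
      nonneg_ae psi -> compact_support psi -> trace0 p psi Dpsi psit psi0 ->
      weak_inequality p q s u0 u Du psi Dpsi psit psi0.

End spacetime.

(* Main.v *)
(* Test functions supported in the open half-space avoid the initial datum, so
   only [u >= 0] and the differential inequality matter.  Write [d > 0] for a
   small constant and [v = u + d].  Testing with [(1 + La v^-al) phi] (justified
   by mollifying [u], where the derivatives of [v] are controlled) gives
     [int H(v) phi_t + u^s F(v) phi - F'(v) (|Du|^p + |Du|^q) phi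
        <= int F(v) (|Du|^(p-2) Du + |Du|^(q-2) Du) . Dphi]
   with [F = 1 + La v^-al] and [H' = F]; the term [- F'(v) |Du|^r phi] absorbs
   the gradient on the right by Young's inequality.
   Take [phi] to be a high power of a plateau of size [K] in space and [K^be] in
   time, times an increasing function of time, whose derivative has a good sign.
   With [ga = q / (s - q + 1)], [be = ga (s - 1)], [rho = K^-ga], [La = rho^al]
   and [d = om rho], every error term is at most
     [C rho^s (ka + C_ka (v / rho)^s phi)], supported where [phi] varies, and
   [rho^s] times the volume of the support is [O(K^(n - ga)) = O(1)], since the
   hypothesis on [s] says [n <= ga].  A large [ka] bounds [int u^s phi] uniformly
   in [K], so [u^s] is integrable; then the integral of [u^s] over the transition
   region tends to [0], and letting [K -> oo], [om -> 0], [ka -> 0] in this order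
   gives [int u^s = 0]. *)
Require Import Defs.
From mathcomp Require Import all_boot all_order all_algebra.
From mathcomp Require Import all_classical all_reals all_analysis.
From mathcomp Require Import measurable_realfun ring lra.
Set Implicit Arguments.
Unset Strict Implicit.
Unset Printing Implicit Defensive.
Import Order.TTheory GRing.Theory Num.Theory.
Import numFieldNormedType.Exports.
Local Open Scope classical_set_scope.
Local Open Scope ring_scope.

(** * Lebesgue measure on space-time *)

Section measure.
Context {R : realType}.
Implicit Types (n : nat) (a sg : R).

(** The summand [1] of the weight keeps the full power [u^s] in the source term; with [v^-al] alone
    it would become [u^(s-al)], and a second round of testing with [phi] itself would be needed.
    With [La = rho^al] the weight is [1 + w^-al] in the variable [w = v / rho], so the constants of
    all estimates are free of [K]. The shift [d] has to be positive at fixed [K] for the powers of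
    [v] to be smooth and bounded; tying it to [rho] makes its cost a multiple of [om^s] uniformly in
    [K]. Among exponents [r] between [q] and [p], the flux with [r = q] is the worst one at scales
    [K >= 1], so the [p]-Laplacian adds no condition on [s]. Before any nonlinear test function is
    used, the weak time derivative moves [psi_t] onto [u]: otherwise products [u * u_t] would occur,
    which need not be integrable. Mollification then enters only the test function. In the fluxes
    the true gradient keeps the nonlinear slot and the mollified gradient fills the linear one, so
    passing to the limit requires no continuity of the flux in its nonlinear argument. *)

Lemma lebesgue_measure_affine (a sg : R) (A : set R) : sg = 1 \/ sg = -1 ->
  measurable A ->
  lebesgue_measure ((fun x : R => a + sg * x) @^-1` A) = lebesgue_measure A.
Proof.
move=> sgE mA.
have mf : measurable_fun setT (fun x : measurableTypeR R => a + sg * x : measurableTypeR R).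
  apply: measurable_funD => //; exact: measurable_funM.
apply/esym; rewrite -[RHS]/(pushforward lebesgue_measure (fun x : measurableTypeR R => a + sg * x : measurableTypeR R) A).
apply: lebesgue_measure_unique => //= _ [[c d]] _ <-.
rewrite /pushforward.
have [->|->] := sgE.
  rewrite (_ : _ @^-1` _ = `]c - a, d - a]%classic); last first.
    by apply/seteqP; split => x /=; rewrite !in_itv/= => /andP[? ?]; apply/andP; split; lra.
  rewrite !lebesgue_measure_itv/= !lte_fin ltrD2r; case: ifP => // _.
  by congr EFin; lra.
rewrite (_ : _ @^-1` _ = `[a - d, a - c[%classic); last first.
  by apply/seteqP; split => x /=; rewrite !in_itv/= => /andP[? ?]; apply/andP; split; lra.
rewrite !lebesgue_measure_itv/= !lte_fin ltrD2l ltrN2; case: ifP => // _.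
by congr EFin; lra.
Qed.

(** The sign [1] gives the translations and the sign [-1] the reflections [w |-> z - w] of
    convolutions. *)
Lemma ge0_integral_affine1 (a sg : R) (f : measurableTypeR R -> \bar R) : sg = 1 \/ sg = -1 ->
  measurable_fun setT f -> (forall x, 0 <= f x)%E ->
  (\int[lebesgue_measure]_x f (a + sg * x)%R = \int[lebesgue_measure]_x f x)%E.
Proof.
move=> sgE mf f0.
have mh : measurable_fun setT (fun x : measurableTypeR R => a + sg * x : measurableTypeR R).
  apply: measurable_funD => //; exact: measurable_funM.
have := @ge0_integral_pushforward _ _ _ _ R _ mh lebesgue_measure setT f measurableT mf (fun x _ => f0 x).
rewrite preimage_setT /comp => <-.
apply: eq_measure_integral => A mA _ /=.
exact: lebesgue_measure_affine.
Qed.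

Lemma ge0_integral_rVS n (f : 'rV[R]_n.+1 -> \bar R) :
  measurable_fun setT f -> (forall x, 0 <= f x)%E ->
  (\int[lebesgue_rV n.+1]_x f x =
   \int[lebesgue_measure]_s \int[lebesgue_rV n]_y f (rV_cons (s, y)))%E.
Proof.
move=> mf f0.
rewrite -(@fubini_tonelli1 _ _ _ _ R lebesgue_measure (lebesgue_rV n) (f \o @rV_cons R n)).
- have := @ge0_integral_pushforward _ _ _ _ R _ (@measurable_rV_cons R n) (lebesgue_measure \x lebesgue_rV n)%E setT f measurableT mf (fun x _ => f0 x).
  by rewrite preimage_setT.
- exact: measurableT_comp mf (@measurable_rV_cons R n).
- by move=> x; exact: f0.
Qed.

Lemma measurable_rV_affine n (a : 'rV[R]_n) (sg : R) :
  measurable_fun setT (fun x : 'rV[R]_n => a + sg *: x).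
Proof.
apply: measurable_fun_rV => i; under eq_fun do rewrite !mxE.
apply: measurable_funD => //; apply: measurable_funM => //; exact: measurable_coord.
Qed.

(** The map acts on each coordinate separately, so Tonelli splits off the first coordinate and
    induction treats the others. *)
Lemma ge0_integral_rV_affine n (a : 'rV[R]_n) (sg : R) (f : 'rV[R]_n -> \bar R) :
  sg = 1 \/ sg = -1 ->
  measurable_fun setT f -> (forall x, 0 <= f x)%E ->
  (\int[lebesgue_rV n]_x f (a + sg *: x)%R = \int[lebesgue_rV n]_x f x)%E.
Proof.
move=> sgE; elim: n a f => [|n IHn] a f mf f0.
  by apply: eq_integral => x _; congr f; apply/rowP => -[].
have mfa : measurable_fun setT (fun x : 'rV[R]_n.+1 => f (a + sg *: x)).
  exact: measurableT_comp mf (measurable_rV_affine _ _).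
rewrite (ge0_integral_rVS mf f0) (ge0_integral_rVS mfa (fun x => f0 _)).
pose a0 := a ord0 ord0; pose a' : 'rV[R]_n := \row_j a ord0 (lift ord0 j).
have consE s y : a + sg *: rV_cons (s, y) = rV_cons (a0 + sg * s, a' + sg *: y).
  by apply/rowP => i; rewrite !mxE; case: unliftP => [j|] ->; rewrite /= ?mxE.
under eq_integral => s _ do under eq_integral => y _ do rewrite consE.
have mfs s : measurable_fun setT (fun y => f (rV_cons (s, y))).
  apply: (measurableT_comp mf); apply: (measurableT_comp (@measurable_rV_cons R n)).
  exact: measurable_pair1.
under eq_integral => s _ do rewrite (IHn a' (fun y => f (rV_cons (a0 + sg * s, y))))//.
rewrite (@ge0_integral_affine1 a0 sg (fun s => \int[lebesgue_rV n]_y f (rV_cons (s, y)))%E)//.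
  have := @measurable_fun_fubini_tonelli_F _ _ _ _ R (lebesgue_rV n) (f \o @rV_cons R n).
  apply; last by move=> x; exact: f0.
  exact: measurableT_comp mf (@measurable_rV_cons R n).
by move=> s; exact: integral_ge0.
Qed.

End measure.

Section spacetime_measure.
Context {R : realType} {n : nat}.
Local Notation E := ('rV[R]_n * R)%type.
Local Notation mE := ('rV[R]_n * measurableTypeR R)%type.
Local Notation mu := (@lebesgue_st R n).

(* Coordinates of (x, t): [Some i] is x_i and [None] is t. *)
Definition co (c : option 'I_n) (z : E) : R := oapp (fun i => z.1 ord0 i) z.2 c.

Lemma coD c (z w : E) : co c (z + w) = co c z + co c w.
Proof. by case: c => [i|] //=; rewrite mxE. Qed.

Lemma coZ c k (z : E) : co c (k *: z) = k * co c z.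
Proof. by case: c => [i|] //=; rewrite mxE. Qed.

Lemma coN c (z : E) : co c (- z) = - co c z.
Proof. by case: c => [i|] //=; rewrite mxE. Qed.

Lemma coB c (z w : E) : co c (z - w) = co c z - co c w.
Proof. by rewrite coD coN. Qed.

Lemma measurable_co c : measurable_fun setT (co c : mE -> measurableTypeR R).
Proof.
case: c => [i|] /=; last exact: measurable_snd.
exact: measurableT_comp (@measurable_coord _ _ i) measurable_fst.
Qed.

Lemma measurable_fun_co d (T : measurableType d) (f : T -> mE) :
  (forall c, measurable_fun setT (fun x => co c (f x) : measurableTypeR R)) -> measurable_fun setT f.
Proof.
move=> mf.
rewrite (_ : f = fun x => ((f x).1, (f x).2)); last by apply/funext => x; case: (f x).
apply: measurable_fun_pair; last exact: (mf None).
by apply: measurable_fun_rV => i; exact: (mf (Some i)).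
Qed.

Lemma measurable_affine (a : E) (sg : R) :
  measurable_fun setT (fun z : mE => a + sg *: z : mE).
Proof.
apply: measurable_fun_co => c; under eq_fun do rewrite coD coZ.
apply: measurable_funD => //; apply: measurable_funM => //; exact: measurable_co.
Qed.

Lemma ge0_integral_affine (a : E) (sg : R) (f : mE -> \bar R) :
  sg = 1 \/ sg = -1 ->
  measurable_fun setT f -> (forall x, 0 <= f x)%E ->
  (\int[mu]_x f (a + sg *: x)%R = \int[mu]_x f x)%E.
Proof.
move=> sgE mf f0.
have mfa : measurable_fun setT (fun x : mE => f (a + sg *: x)).
  exact: measurableT_comp mf (measurable_affine _ _).
rewrite [RHS](fubini_tonelli1 f mf f0).
rewrite [LHS](fubini_tonelli1 (fun x : mE => f (a + sg *: x)) mfa (fun x => f0 _)).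
rewrite /fubini_F.
transitivity (\int[lebesgue_rV n]_x (fun x => \int[lebesgue_measure]_t f (x, t)) (a.1 + sg *: x)%R)%E.
  apply: eq_integral => x _.
  rewrite -(@ge0_integral_affine1 _ a.2 sg (fun t => f (a.1 + sg *: x, t)))//.
  exact: measurableT_comp mf (measurable_pair1 _).
rewrite (@ge0_integral_rV_affine _ _ _ _ (fun x => \int[lebesgue_measure]_t f (x, t))%E)//.
  exact: measurable_fun_fubini_tonelli_F.
by move=> x; exact: integral_ge0.
Qed.

Lemma lebesgue_st_box (A : option 'I_n -> set R) : (forall c, measurable (A c)) ->
  mu [set z | forall c, A c (co c z)] =
  ((\prod_(i < n) lebesgue_measure (A (Some i))) * lebesgue_measure (A None))%E.
Proof.
move=> mA; rewrite (_ : mkset _ = [set x : 'rV[R]_n | forall i, A (Some i) (x ord0 i)] `*` A None); last first.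
  apply/seteqP; split => -[x t] /=.
    by move=> H; split => [i|]; [exact: (H (Some i))|exact: (H None)].
  by move=> [H1 H2] [i|]; [exact: H1|exact: H2].
have mB : measurable [set x : 'rV[R]_n | forall i, A (Some i) (x ord0 i)].
  rewrite (_ : mkset _ = \bigcap_(j in [set: 'I_n])
      ((fun y : 'rV[R]_n => y ord0 j) @^-1` A (Some j))); last first.
    by apply/seteqP; split => [y H j _|y H j]; apply: H.
  apply: fin_bigcap_measurable => [|j _]; first exact: finite_finset.
  by rewrite -[X in measurable X]setTI; exact: measurable_coord.
rewrite [LHS]product_measure1E//; last exact: mA.
by congr (_ * _)%E; exact: lebesgue_rV_box (fun i => mA (Some i)).
Qed.

Lemma measurable_box (A : option 'I_n -> set R) : (forall c, measurable (A c)) ->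
  measurable ([set z | forall c, A c (co c z)] : set mE).
Proof.
move=> mA; rewrite (_ : mkset _ = \bigcap_(c in [set: option 'I_n])
    ((co c : mE -> measurableTypeR R) @^-1` A c)); last first.
  by apply/seteqP; split => [y H j _|y H j]; apply: H.
apply: fin_bigcap_measurable => [|j _]; first exact: finite_finset.
by have := measurable_co j measurableT (mA j); rewrite setTI.
Qed.

End spacetime_measure.

(** * Coordinatewise topology and measurability of continuous functions *)

Section topology_st.
Context {R : realType} {n : nat}.
Local Notation E := ('rV[R]_n * R)%type.
Local Notation mE := ('rV[R]_n * measurableTypeR R)%type.

Definition of_co (f : option 'I_n -> R) : E := (\row_i f (Some i), f None).

Lemma co_of_co f c : co c (of_co f) = f c.
Proof. by case: c => [i|] //=; rewrite mxE. Qed.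

Lemma norm_st_lt (z : E) e : 0 < e -> (forall c, `|co c z| < e) -> `|z| < e.
Proof.
move=> e0 H; rewrite prod_normE gt_max (H None) andbT.
rewrite [X in X < _]/Num.norm/= mx_normrE; apply/bigmax_ltP; split => // -[i j] _ /=.
by rewrite ord1; exact: (H (Some j)).
Qed.

Lemma norm_co_le c (z : E) : `|co c z| <= `|z|.
Proof.
rewrite prod_normE le_max; case: c => [i|] /=; last by rewrite lexx orbT.
apply/orP; left; rewrite [leRHS]/Num.norm/= mx_normrE.
by apply/bigmax_geP; right; exists (ord0, i).
Qed.

Lemma continuous_co c : continuous (co c : E -> R).
Proof.
move=> z; apply/cvgrPdist_lt => e e0; near=> w.
rewrite -coB; apply: le_lt_trans (norm_co_le _ _) _; near: w.
by move: e e0; apply/cvgrPdist_lt; exact: cvg_id.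
Unshelve. end_near. Qed.

Lemma cvg_co {T} {F : set_system T} {FF : Filter F} (f : T -> E) (z : E) :
  (forall c, co c (f x) @[x --> F] --> co c z) -> f x @[x --> F] --> z.
Proof.
move=> H; apply/cvgrPdist_lt => e e0.
have : \forall x \near F, forall c : option 'I_n, `|co c z - co c (f x)| < e.
  by apply: filter_forall => c; move/cvgrPdist_lt : (H c); exact.
by apply: filterS => x Hx; apply: norm_st_lt => // c; rewrite coB.
Qed.

(** The sigma-algebra of space-time comes from the coordinates, not from the open sets. Rounding
    every coordinate down to a multiple of [1/(k+1)] turns [f] into a function constant on each of
    countably many half-open boxes, hence measurable, and by continuity these functions converge to
    [f] pointwise. *)
Lemma continuous_measurable_st (f : E -> R) : continuous f ->
  measurable_fun setT (f : mE -> measurableTypeR R).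
Proof.
move=> cf.
pose rnd (k : nat) (z : E) : {ffun option 'I_n -> int} :=
  [ffun c => Num.floor (co c z * k.+1%:R)].
pose pt (k : nat) (g : {ffun option 'I_n -> int}) : E :=
  of_co (fun c => (g c)%:~R / k.+1%:R).
apply: (@measurable_fun_cvg _ _ _ setT (fun k z => f (pt k (rnd k z)))) => //.
- move=> k _ Y mY; rewrite setTI.
  rewrite (_ : _ @^-1` Y = \bigcup_(g : {ffun option 'I_n -> int})
    (if f (pt k g) \in Y then [set z : E | forall c, [set x : R | Num.floor (x * k.+1%:R) = g c] (co c z)] else set0)).
  apply: countable_bigcupT_measurable => // g; case: ifP => // _.
    apply: (@measurable_box _ _ (fun c => [set x : R | Num.floor (x * k.+1%:R) = g c])) => c.
    rewrite (_ : mkset _ = `[(g c)%:~R / k.+1%:R, (g c + 1)%:~R / k.+1%:R[%classic)//.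
    apply/seteqP; split => x /=; rewrite in_itv/= ler_pdivrMr// ltr_pdivlMr//.
      by move=> <-; rewrite Num.Theory.floor_le Num.Theory.floorD1_gt.
    by move=> H; exact: Num.Theory.floor_def.
  apply/seteqP; split => [z /= Yz|z [g _]].
    exists (rnd k z) => //; rewrite mem_set//= => c.
    by rewrite ffunE.
  case: ifP => //= /set_mem Yg H.
  by rewrite (_ : rnd k z = g)//; apply/ffunP => c; rewrite ffunE.
- move=> z _; apply: (continuous_cvg _ (cf z)); apply: cvg_co => c.
  under eq_fun do rewrite co_of_co ffunE.
  have h0 : (@GRing.inv R k.+1%:R) @[k --> \oo] --> 0 by exact: cvg_harmonic.
  apply: (@squeeze_cvgr _ _ _ _ (fun k => co c z - k.+1%:R^-1) (fun=> co c z)); last 2 first.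
  + by rewrite -[X in _ --> X]subr0; apply: cvgB => //; exact: cvg_cst.
  + exact: cvg_cst.
  apply: nearW => k; rewrite ler_pdivrMr// Num.Theory.floor_le andbT.
  rewrite ler_pdivlMr// mulrBl mulVf ?pnatr_eq0//.
  rewrite lerBlDr -[X in _ + X]/(1%:~R) -intrD; apply: ltW.
  exact: Num.Theory.floorD1_gt.
Qed.

End topology_st.

(** * Smooth functions *)

Section Ck_calculus.
Context {R : realType} {V : normedModType R}.
Implicit Types (f g : V -> R) (h : R -> R).

Definition smooth f := forall k, Ck k f.

(** [Ck k] asks continuity of the derivatives of order [k] only, and directional derivatives alone
    do not make the lower orders continuous. Recording continuity at every order makes the notion
    decreasing in [k], which the inductions for products and compositions need; for all [k] together
    the two notions agree. *)
Fixpoint Ck_le (k : nat) f : Prop := continuous f /\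
  if k is k'.+1 then
    (forall z v, derivable f z v) /\ (forall v, Ck_le k' (fun z => 'D_v f z))
  else True.

Lemma smoothP f : smooth f <-> forall k, Ck_le k f.
Proof.
split=> [sf k|H k].
  elim: k f sf => [|k IH] f sf; first by split => //; exact: (sf 0%N).
  split; first exact: (sf 0%N).
  split; first by have [] := sf 1%N.
  by move=> v; apply: IH => j; have [_] := sf j.+1; apply.
have {H} := H k; elim: k f => [|k IH] f /=; first by case.
by move=> [_ [d H]]; split => // v; exact: IH.
Qed.

Lemma Ck_le_cont k f : Ck_le k f -> continuous f.
Proof. by case: k => [|k] []. Qed.

Lemma Ck_leW k f : Ck_le k.+1 f -> Ck_le k f.
Proof.
elim: k f => [|k IH] f; first by move=> [].
move=> [cf [df H]]; split=> //; split=> // v; exact: IH.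
Qed.

Lemma Ck_le_ext k f g : f =1 g -> Ck_le k g -> Ck_le k f.
Proof. by move=> /funext ->. Qed.

Lemma Ck_le_cst k (a : R) : Ck_le k (fun=> a).
Proof.
elim: k a => [|k IH] a; split => //; try exact: cst_continuous.
split=> [z v|v]; first exact: derivable_cst.
by apply: Ck_le_ext (IH 0) => z; rewrite derive_cst.
Qed.

Lemma Ck_leD k f g : Ck_le k f -> Ck_le k g -> Ck_le k (fun z => f z + g z).
Proof.
elim: k f g => [|k IH] f g.
  by move=> [cf _] [cg _]; split => // z; apply: cvgD; [exact: cf|exact: cg].
move=> [cf [df Hf]] [cg [dg Hg]]; split.
  by move=> z; apply: cvgD; [exact: cf|exact: cg].
split=> [z v|v]; first exact: derivableD.
apply: Ck_le_ext (IH _ _ (Hf v) (Hg v)) => z; exact: deriveD.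
Qed.

Lemma Ck_leM k f g : Ck_le k f -> Ck_le k g -> Ck_le k (fun z => f z * g z).
Proof.
elim: k f g => [|k IH] f g.
  by move=> [cf _] [cg _]; split => // z; apply: cvgM; [exact: cf|exact: cg].
move=> Sf Sg; have [cf [df Hf]] := Sf; have [cg [dg Hg]] := Sg; split.
  by move=> z; apply: cvgM; [exact: cf|exact: cg].
split=> [z v|v]; first exact: derivableM.
apply: (@Ck_le_ext _ _ (fun z => f z * 'D_v g z + g z * 'D_v f z)) => [z|].
  exact: deriveM.
apply: Ck_leD; first exact: IH (Ck_leW Sf) (Hg v).
exact: IH (Ck_leW Sg) (Hf v).
Qed.

Lemma derive_line f z v : 'D_v f z = derive1 (fun t : R => f (t *: v + z)) 0.
Proof.
rewrite derive1E /derive; set g1 := fun h : R => h^-1 *: _; set g2 := fun h : R => h^-1 *: _.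
suff -> : g1 = g2 by [].
by rewrite funeqE /g1 /g2 => t /=; rewrite addr0 scale0r add0r [_%:A]mulr1.
Qed.

(** Only a directional derivative of [f] is given, not a differential, so the chain rule is applied
    to the restriction of [f] to the line through [z] along [v]. *)
Lemma is_derive_comp1 f h z v (df dh : R) :
  is_derive z v f df -> is_derive (f z) 1 h dh ->
  is_derive z v (fun w => h (f w)) (dh * df).
Proof.
move=> [d1 e1] [d2 e2].
pose l := fun t : R => f (t *: v + z).
have dl : derivable l 0 1 by have /derivable1P := d1.
have l0 : l 0 = f z by rewrite /l scale0r add0r.
have dl' : derive1 l 0 = df.
  by rewrite -e1 derive_line.
have dc : derivable (h \o l) 0 1.
  apply/derivable1_diffP; apply: differentiable_comp; first exact/derivable1_diffP.
  by rewrite l0; move/derivable1_diffP : d2.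
apply: DeriveDef; first by apply/derivable1P.
have := @derive1_comp R l h 0 dl; rewrite l0 => /(_ d2); rewrite dl' (derive1E h) e2 => <-.
exact: derive_line.
Qed.

(** Stating the result for a class [C] closed under differentiation lets one induction on [k] handle
    both the powers on the positive half-line and the flat functions on the whole line. *)
Lemma Ck_le_comp (D : set R) (C : set (R -> R)) k f h :
  (forall h x, C h -> D x -> {for x, continuous h}) ->
  (forall h, C h -> exists2 h', C h' & forall x, D x -> is_derive x 1 h (h' x)) ->
  C h -> (forall z, D (f z)) -> Ck_le k f -> Ck_le k (fun z => h (f z)).
Proof.
move=> Cc Cd; elim: k f h => [|k IH] f h Ch Df.
  by move=> [cf _]; split => // z; apply: continuous_comp; [exact: cf|exact: Cc].
move=> Sf; have [cf [df Hf]] := Sf.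
have [h' Ch' hh'] := Cd h Ch.
have dhf z v : is_derive z v (fun w => h (f w)) (h' (f z) * 'D_v f z).
  by apply: is_derive_comp1; [exact: derivableP|exact: hh'].
split; first by move=> z; apply: continuous_comp; [exact: cf|exact: Cc].
split=> [z v|v]; first by have [] := dhf z v.
apply: (@Ck_le_ext _ _ (fun z => h' (f z) * 'D_v f z)) => [z|].
  by have [] := dhf z v.
by apply: Ck_leM (Hf v); apply: IH => //; exact: Ck_leW Sf.
Qed.

Lemma smooth_cont f : smooth f -> continuous f.
Proof. by move=> /(_ 0%N). Qed.

Lemma smooth_derivable f z v : smooth f -> derivable f z v.
Proof. by move=> /(_ 1%N)[]. Qed.

Lemma smooth_is_derive f z v : smooth f -> is_derive z v f ('D_v f z).
Proof. by move=> sf; exact/derivableP/smooth_derivable. Qed.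

Lemma smooth_derive f v : smooth f -> smooth (fun z => 'D_v f z).
Proof. by move=> sf k; have [_] := sf k.+1; apply. Qed.

Lemma smooth_cst (a : R) : smooth (fun=> a).
Proof. by apply/smoothP => k; exact: Ck_le_cst. Qed.

Lemma smoothD f g : smooth f -> smooth g -> smooth (fun z => f z + g z).
Proof. by move=> /smoothP sf /smoothP sg; apply/smoothP => k; exact: Ck_leD. Qed.

Lemma smoothM f g : smooth f -> smooth g -> smooth (fun z => f z * g z).
Proof. by move=> /smoothP sf /smoothP sg; apply/smoothP => k; exact: Ck_leM. Qed.

Lemma smoothX f m : smooth f -> smooth (fun z => f z ^+ m).
Proof.
move=> sf; elim: m => [|m IH].
  by under eq_fun do rewrite expr0; exact: smooth_cst.
by under eq_fun do rewrite exprS; exact: smoothM.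
Qed.

Lemma smooth_prod (I : Type) (r : seq I) (F : I -> V -> R) :
  (forall i, smooth (F i)) -> smooth (fun z => \prod_(i <- r) F i z).
Proof.
move=> sF; elim: r => [|i r IH].
  by under eq_fun do rewrite big_nil; exact: smooth_cst.
by under eq_fun do rewrite big_cons; exact: smoothM.
Qed.

Lemma smooth_linear f : continuous f ->
  (forall z v, is_derive z v f (f v)) -> smooth f.
Proof.
move=> cf H; apply/smoothP => -[|k]; split => //; split=> [z v|v].
  by have [] := H z v.
by apply: Ck_le_ext (Ck_le_cst _ (f v)) => z; have [] := H z v.
Qed.

Lemma smooth_powR f (a : R) : (forall z, 0 < f z) -> smooth f ->
  smooth (fun z => f z `^ a).
Proof.
move=> f0 /smoothP sf; apply/smoothP => k.
pose C := [set h : R -> R | exists c b, h = fun x => c * x `^ b].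
apply: (@Ck_le_comp [set x | 0 < x] C k f (fun x => x `^ a)) => //.
- move=> _ x [c [b ->]] /= x0; apply: cvgM; first exact: cvg_cst.
  have [+ _] := is_derive1_powR b x0.
  by move=> /derivable1_diffP/differentiable_continuous; exact.
- move=> _ [c [b ->]]; exists (fun x => (c * b) * x `^ (b - 1)); first by do 2 eexists.
  move=> x /= x0; rewrite -mulrA.
  exact: (@is_deriveZ R _ _ (fun x : R => x `^ b) c x 1 _ (is_derive1_powR b x0)).
- by exists 1, a; apply/funext => x; rewrite mul1r.
Qed.

Lemma derive_out (K : set V) f v : (forall z, ~ K z -> f z = 0) -> closed K ->
  forall z, ~ K z -> 'D_v f z = 0.
Proof.
move=> f0 cK z Kz.
rewrite (@near_eq_derive _ _ _ _ (cst 0)) ?derive_cst//.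
have := open_nbhs_nbhs (conj (closed_openC cK) Kz).
by apply: filterS => w; exact: f0.
Qed.

End Ck_calculus.

Section smooth_co.
Context {R : realType} {n : nat}.
Local Notation E := ('rV[R]_n * R)%type.

Lemma is_derive_co c (z v : E) : is_derive z v (co c : E -> R) (co c v).
Proof.
have H : (fun h : R => h^-1 *: ((co c \o shift z) (h *: v) - co c z)) @ 0^' --> co c v.
  apply: (@cvg_trans _ (cst (co c v) @ 0^')); last exact: cvg_cst.
  apply: near_eq_cvg; near=> h.
  rewrite /= coD coZ addrK /GRing.scale/= mulrA mulVf ?mul1r//.
  by near: h; exact: nbhs_dnbhs_neq.
apply: DeriveDef; first by apply/cvg_ex; exists (co c v).
exact/cvg_lim.
Unshelve. end_near. Qed.

Lemma smooth_co c : smooth (co c : E -> R).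
Proof.
by apply: smooth_linear; [exact: continuous_co|exact: is_derive_co].
Qed.

End smooth_co.

(** * Plateau functions *)

Section flat.
Context {R : realType}.
Implicit Types (x : R) (k : nat).

(** The case [k = 0] is the classical flat function [exp(-1/x)]. The factors [x^-k] make the family
    closed under differentiation up to linear combinations. *)
Definition flat k x : R := if 0 < x then x^-1 ^+ k * expR (- x^-1) else 0.

Lemma flat_ge0 k x : 0 <= flat k x.
Proof.
rewrite /flat; case: ifPn => // x0.
by rewrite mulr_ge0 ?expR_ge0// exprn_ge0// invr_ge0 ltW.
Qed.

Lemma flat_gt0 k x : 0 < x -> 0 < flat k x.
Proof. by move=> x0; rewrite /flat x0 mulr_gt0 ?expR_gt0// exprn_gt0// invr_gt0. Qed.

Lemma flat_le0 k x : x <= 0 -> flat k x = 0.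
Proof. by move=> x0; rewrite /flat ltNge x0. Qed.

Lemma flatS k x : flat k.+1 x = x^-1 * flat k x.
Proof. by rewrite /flat; case: ifP => _; rewrite ?mulr0// exprS mulrA. Qed.

(** With [y = 1/x] this is [y^(k+1) / (k+1)! <= exp y]. It yields the limit [0] at the origin for
    every [k]. *)
Lemma flat_le k x : flat k x <= k.+1`!%:R * `|x|.
Proof.
rewrite /flat; case: ifPn => [x0|_]; last by rewrite mulr_ge0.
have y0 : 0 < x^-1 by rewrite invr_gt0.
rewrite expRN -ler_pdivlMr ?invr_gt0 ?expR_gt0// invrK gtr0_norm//.
have := expR_ge1Dxn k (ltW y0) => /(le_trans _) /= H.
have {H} : x^-1 ^+ k.+1 / k.+1`!%:R <= expR x^-1 by apply: H; lra.
rewrite ler_pdivrMr ?ltr0n ?fact_gt0// exprSr => H.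
rewrite -(ler_pM2r y0) (le_trans H)// [leRHS](_ : _ = expR x^-1 * k.+1`!%:R)//.
by field; rewrite gt_eqF.
Qed.

Lemma is_derive_flat k x : is_derive x 1 (flat k) (flat k.+2 x - k%:R * flat k.+1 x).
Proof.
have [x0|x0|->] := ltgtP x 0.
- rewrite !flat_le0 ?(ltW x0)// mulr0 subr0.
  apply: (near_eq_is_derive _ (is_derive_cst 0 x 1)).
  near=> y; rewrite flat_le0//; apply: ltW; near: y; exact: lt_nbhsl.
- apply: (@near_eq_is_derive _ _ _ (fun y : R => y^-1 ^+ k * expR (- y^-1))).
    near=> y; rewrite /flat ifT//; near: y; exact: lt_nbhsr.
  have dV : is_derive x 1 (fun y : R => y^-1) (- x ^- 2).
    have := @is_deriveV _ id x 1 1 (lt0r_neq0 x0) (is_derive_id _ _).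
    by rewrite /GRing.scale/= mulr1.
  have dE : is_derive x 1 (fun y : R => expR (- y^-1)) (expR (- x^-1) * x ^- 2).
    have dN : is_derive x 1 (fun y : R => - y^-1) (x ^- 2).
      by have := @is_deriveN _ _ _ (fun y : R => y^-1) x 1 _ dV; rewrite opprK.
    exact: is_derive_comp1 dN (is_derive_expR _).
  have dX : is_derive x 1 (fun y : R => y^-1 ^+ k) (- (k%:R * x^-1 ^+ k.+1)).
    elim: k => [|k IH].
      by rewrite mul0r oppr0; under eq_fun do rewrite expr0; exact: is_derive_cst.
    under eq_fun do rewrite exprS.
    apply: is_derive_eq (is_deriveM dV IH) _.
    by rewrite /GRing.scale/= -exprVn !exprS expr0 -natr1; ring.
  apply: is_derive_eq (is_deriveM dX dE) _.
  by rewrite /GRing.scale/= /flat x0 -exprVn !exprS expr0; ring.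
- rewrite !flat_le0// mulr0 subr0.
  (* The difference quotient of [flat k] at the origin is [flat k.+1], which tends to [0] by
     [flat_le]. *)
  have H : (fun h : R => h^-1 *: ((flat k \o shift 0) (h *: 1) - flat k 0)) @ 0^' --> 0.
    apply: (@cvg_trans _ (flat k.+1 @ 0^')).
      apply: near_eq_cvg; near=> h.
      by rewrite /= addr0 (flat_le0 k (lexx 0)) subr0 /GRing.scale/= mulr1 flatS.
    apply/cvgrPdist_le => e e0; near=> h.
    rewrite sub0r normrN ger0_norm ?flat_ge0// (le_trans (flat_le _ _))//.
    rewrite -ler_pdivlMl ?ltr0n ?fact_gt0//.
    near: h; apply: dnbhs0_le.
    by rewrite mulr_gt0// invr_gt0 ltr0n fact_gt0.
  apply: DeriveDef; first by apply/cvg_ex; exists 0.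
  exact/cvg_lim.
Unshelve. all: by end_near. Qed.

(** The linear span of the flat functions, as a class to which [Ck_le_comp] applies. *)
Inductive flat_class : (R -> R) -> Prop :=
| flat_class_flat k : flat_class (flat k)
| flat_class_add f g : flat_class f -> flat_class g -> flat_class (fun x => f x + g x)
| flat_class_scale (a : R) f : flat_class f -> flat_class (fun x => a * f x).

Lemma flat_class_derive h : flat_class h ->
  exists2 h', flat_class h' & forall x, is_derive x 1 h (h' x).
Proof.
elim=> [k|f g _ [f' Cf' df] _ [g' Cg' dg]|a f _ [f' Cf' df]].
- exists (fun x => flat k.+2 x + (- k%:R) * flat k.+1 x).
    by do ?constructor.
  by move=> x; rewrite mulNr; exact: is_derive_flat.
- exists (fun x => f' x + g' x); first by constructor.
  by move=> x; exact: is_deriveD.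
- exists (fun x => a * f' x); first by constructor.
  by move=> x; exact: (@is_deriveZ R _ _ f a x 1 _ (df x)).
Qed.

Lemma smooth_flat (V : normedModType R) (f : V -> R) k : smooth f -> smooth (fun z => flat k (f z)).
Proof.
move=> /smoothP sf; apply/smoothP => j.
apply: (@Ck_le_comp _ _ setT flat_class) => //.
- move=> h x /flat_class_derive[h' _ /(_ x) [+ _]] _.
  by move=> /derivable1_diffP/differentiable_continuous; exact.
- by move=> h /flat_class_derive[h' Ch' H]; exists h' => // x _; exact: H.
- by constructor.
Qed.

End flat.

Section step.
Context {R : realType}.
Implicit Types (x : R).

(** The usual quotient, with the denominator as a power [-1] so that [smooth_powR] gives its
    smoothness. *)
Definition stepf x : R := flat 0 x * (flat 0 x + flat 0 (1 - x)) `^ (-1).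

Lemma stepf_den_gt0 x : 0 < flat 0 x + flat 0 (1 - x).
Proof.
have [x0|x0] := ltP 0 x; first by rewrite ltr_wpDr ?flat_ge0 ?flat_gt0.
by rewrite ltr_wpDl ?flat_ge0 ?flat_gt0//; lra.
Qed.

Lemma stepfE x : stepf x = flat 0 x / (flat 0 x + flat 0 (1 - x)).
Proof. by rewrite /stepf powRN powRr1// ltW// stepf_den_gt0. Qed.

Lemma stepf_le0 x : x <= 0 -> stepf x = 0.
Proof. by move=> x0; rewrite stepfE flat_le0// mul0r. Qed.

Lemma stepf_ge1 x : 1 <= x -> stepf x = 1.
Proof.
move=> x1; rewrite stepfE (@flat_le0 _ 0 (1 - x)) ?addr0 ?divff ?gt_eqF//; last by lra.
by rewrite flat_gt0//; lra.
Qed.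

Lemma stepf_ge0 x : 0 <= stepf x.
Proof. by rewrite stepfE divr_ge0 ?flat_ge0// ltW// stepf_den_gt0. Qed.

Lemma stepf_le1 x : stepf x <= 1.
Proof.
by rewrite stepfE ler_pdivrMr ?stepf_den_gt0// mul1r lerDl flat_ge0.
Qed.

Lemma smooth_stepf (V : normedModType R) (f : V -> R) : smooth f -> smooth (fun z => stepf (f z)).
Proof.
move=> sf; apply: smoothM; first exact: smooth_flat.
apply: smooth_powR => [z|]; first exact: stepf_den_gt0.
apply: smoothD; first exact: smooth_flat.
apply: smooth_flat; apply: (@smoothD _ _ (fun=> 1) (fun z => - f z)); first exact: smooth_cst.
under eq_fun do rewrite -mulN1r.
by apply: (@smoothM _ _ (fun=> -1)); first exact: smooth_cst.
Qed.

Lemma smooth_id : smooth (id : R -> R).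
Proof.
by apply: smooth_linear => z; exact: cvg_id.
Qed.

(** [stepf] has the form [a / (a + b)] with [a] nondecreasing and [b] nonincreasing, so it is
    nondecreasing. This sign is what makes the cutoff near the initial time free of charge. *)
Lemma derive_stepf_ge0 x : 0 <= 'D_1 stepf x.
Proof.
have H : {homo stepf : x y / x <= y}.
  move=> y z yz; rewrite !stepfE ler_pdivrMr ?stepf_den_gt0// mulrAC ler_pdivlMr ?stepf_den_gt0//.
  have fm : {homo flat 0 : x y / (x : R) <= y}.
    move=> a b ab; have [a0|a0] := leP a 0; first by rewrite (flat_le0 _ a0) flat_ge0.
    rewrite /flat a0 (lt_le_trans a0 ab) !expr0 !mul1r ler_expR lerN2 lef_pV2// posrE//.
    exact: lt_le_trans ab.
  have := fm _ _ yz; have := fm (1 - z) (1 - y); rewrite lerD2l lerN2 => /(_ yz).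
  have := @flat_ge0 R 0 y; have := @flat_ge0 R 0 z.
  by have := @flat_ge0 R 0 (1 - y); have := @flat_ge0 R 0 (1 - z); nra.
have d : derivable stepf x 1 by apply: smooth_derivable; exact: smooth_stepf smooth_id.
apply: limr_ge; first exact: d.
near=> h; rewrite /GRing.scale/= mulr1.
have [h0|h0] := leP 0 h.
  by rewrite mulr_ge0 ?invr_ge0// subr_ge0; apply: H; rewrite lerDr.
rewrite -mulrNN mulr_ge0//; first by rewrite oppr_ge0 invr_le0 ltW.
by rewrite oppr_ge0 subr_le0; apply: H; rewrite gerDr ltW.
Unshelve. all: by end_near. Qed.

Lemma smooth_bounded_derive (f : R -> R) (a b : R) : smooth f -> a <= b ->
  (forall x, x < a -> f x = f a) -> (forall x, b < x -> f x = f b) ->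
  exists2 M, 0 <= M & forall x, `|'D_1 f x| <= M.
Proof.
move=> sf ab fa fb.
have cd : continuous (fun x => `|'D_1 f x|).
  have H := smooth_cont (@smooth_derive _ _ f (1 : R) sf).
  by move=> x; apply: cvg_norm; exact: H.
have [c _ Hc] := @EVT_max R _ a b ab (continuous_subspaceT cd).
exists `|'D_1 f c| => // x.
have [xa|xa] := ltP x a.
  rewrite (@near_eq_derive _ _ _ _ (cst (f a))) ?derive_cst ?normr0//.
  by near=> y; apply: fa; near: y; exact: lt_nbhsl.
have [xb|xb] := ltP b x.
  rewrite (@near_eq_derive _ _ _ _ (cst (f b))) ?derive_cst ?normr0//.
  by near=> y; apply: fb; near: y; exact: lt_nbhsr.
by apply: Hc; rewrite in_itv/= xa.
Unshelve. all: by end_near. Qed.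

Definition plateau x : R := stepf (2 - x) * stepf (2 + x).

Lemma plateau_ge0 x : 0 <= plateau x.
Proof. by rewrite mulr_ge0 ?stepf_ge0. Qed.

Lemma plateau_le1 x : plateau x <= 1.
Proof. by rewrite mulr_ile1 ?stepf_ge0 ?stepf_le1. Qed.

Lemma plateau_in x : `|x| <= 1 -> plateau x = 1.
Proof. by rewrite ler_norml => /andP[? ?]; rewrite /plateau !stepf_ge1 ?mulr1//; lra. Qed.

Lemma plateau_out x : 2 <= `|x| -> plateau x = 0.
Proof.
rewrite ler_normr => /orP[?|?]; rewrite /plateau; first by rewrite stepf_le0 ?mul0r//; lra.
by rewrite [X in _ * X]stepf_le0 ?mulr0//; lra.
Qed.

Lemma smooth_plateau (V : normedModType R) (f : V -> R) : smooth f -> smooth (fun z => plateau (f z)).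
Proof.
move=> sf; apply: smoothM; apply: smooth_stepf.
  apply: (@smoothD _ _ (fun=> 2) (fun z => - f z)); first exact: smooth_cst.
  under eq_fun do rewrite -mulN1r.
  by apply: (@smoothM _ _ (fun=> -1)); first exact: smooth_cst.
by apply: (@smoothD _ _ (fun=> 2)); first exact: smooth_cst.
Qed.

Lemma derive_plateau_bounded : exists2 M : R, 0 <= M & forall x, `|'D_1 plateau x| <= M.
Proof.
apply: (@smooth_bounded_derive _ (-2) 2).
- exact: smooth_plateau smooth_id.
- by lra.
- by move=> x x2; rewrite !plateau_out// ler_normr; apply/orP; right; lra.
- by move=> x x2; rewrite !plateau_out// ler_normr; apply/orP; left; lra.
Qed.

Lemma derive_plateau_in x : `|x| < 1 -> 'D_1 plateau x = 0.
Proof.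
move=> x1; rewrite (@near_eq_derive _ _ _ _ (cst (1 : R))) ?derive_cst//.
near=> y; rewrite plateau_in//; apply/ltW; near: y.
have := @norm_continuous _ _ x => /(_ [set r : R | r < 1]); apply.
exact: lt_nbhsl.
Unshelve. all: by end_near. Qed.

End step.

(** * Dominated convergence and integration by parts *)

Section sequential.
Context {R : realType} {V W : normedModType R}.

(** Dominated convergence speaks of sequences; this transfers its conclusions to limits at a point.
    If the limit failed, a point at distance less than [1/(k+1)] could be chosen for each [k],
    violating the hypothesis. *)
Lemma cvg_nbhs_seq (f : V -> W) (a : V) (l : W) :
  (forall x : nat -> V, x k @[k --> \oo] --> a -> f (x k) @[k --> \oo] --> l) ->
  f x @[x --> a] --> l.
Proof.
move=> H; apply/cvgrPdist_lt => e e0; apply: contrapT => nH.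
have ex (k : nat) : exists x : V, `|a - x| < k.+1%:R^-1 /\ e <= `|l - f x|.
  apply: contrapT => nex; apply: nH.
  have : \forall x \near a, `|a - x| < k.+1%:R^-1.
    by have /cvgrPdist_lt := @cvg_id _ (nbhs a); apply.
  apply: filterS => x xk; rewrite ltNge; apply/negP => ex.
  by apply: nex; exists x.
have [x Hx] := choice ex.
have xa : x k @[k --> \oo] --> a.
  apply/cvgrPdist_lt => d d0; near=> k.
  apply: lt_trans (Hx k).1 _; near: k.
  exact: (near_infty_natSinv_lt (PosNum d0)).
have /cvgrPdist_lt/(_ _ e0)[N _ HN] := H x xa.
by have := HN N (leqnn N); rewrite ltNge (Hx N).2.
Unshelve. all: by end_near. Qed.

End sequential.

Section Rintegral_tools.
Context d (T : measurableType d) (R : realType) (mu : {measure set T -> \bar R}).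
Implicit Types f g : T -> R.

Lemma Rdominated_cvg (fk : nat -> T -> R) f g :
  (forall k, measurable_fun setT (fk k)) -> measurable_fun setT f ->
  {ae mu, forall x, fk k x @[k --> \oo] --> f x} ->
  mu.-integrable setT (EFin \o g) ->
  {ae mu, forall x k, `|fk k x| <= g x} ->
  mu.-integrable setT (EFin \o f) /\
  \int[mu]_x fk k x @[k --> \oo] --> \int[mu]_x f x.
Proof.
move=> mfk mf cf ig fg.
have mE h : measurable_fun setT h -> measurable_fun setT (EFin \o h : T -> \bar R).
  by move=> mh; exact/measurable_EFinP.
have [] := @dominated_convergence _ _ _ mu setT measurableT
  (fun k => EFin \o fk k) (EFin \o f) (EFin \o g) (fun k => mE _ (mfk k)) (mE _ mf) _ ig.
- by apply: filterS cf => x Hx _; apply: cvg_EFin => //; exact: nearW.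
- by apply: filterS fg => x Hx k _; rewrite /= lee_fin.
move=> iff _ H; split => //.
apply: fine_cvg; rewrite fineK; first exact: H.
exact: integrable_fin_num.
Qed.

Lemma measurable_of_integrable f : mu.-integrable setT (EFin \o f) -> measurable_fun setT f.
Proof. by move=> /measurable_int/measurable_EFinP. Qed.

Lemma le_integrableR f g : measurable_fun setT f ->
  (forall x, `|f x| <= g x) ->
  mu.-integrable setT (EFin \o g) -> mu.-integrable setT (EFin \o f).
Proof.
move=> mf fg; apply: le_integrable => //; first exact/measurable_EFinP.
by move=> x _ /=; rewrite lee_fin (le_trans (fg x))// ler_norm.
Qed.

Lemma integrableDR f g : mu.-integrable setT (EFin \o f) -> mu.-integrable setT (EFin \o g) ->
  mu.-integrable setT (EFin \o (fun x => f x + g x)).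
Proof. by move=> fi gi; exact: (integrableD measurableT fi gi). Qed.

Lemma integrableZR (a : R) f : mu.-integrable setT (EFin \o f) ->
  mu.-integrable setT (EFin \o (fun x => a * f x)).
Proof. by move=> fi; exact: (integrableZl measurableT a fi). Qed.

Lemma integrableNR f : mu.-integrable setT (EFin \o f) ->
  mu.-integrable setT (EFin \o (fun x => - f x)).
Proof. by move=> fi; exact: (integrableN fi). Qed.

Lemma integrableBR f g : mu.-integrable setT (EFin \o f) -> mu.-integrable setT (EFin \o g) ->
  mu.-integrable setT (EFin \o (fun x => f x - g x)).
Proof. by move=> fi gi; exact: (integrableB measurableT fi gi). Qed.

Lemma integrableMbR f (h : T -> R) (M : R) : mu.-integrable setT (EFin \o f) -> measurable_fun setT h ->
  (forall x, `|h x| <= M) -> mu.-integrable setT (EFin \o (fun x => h x * f x)).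
Proof.
move=> fi mh hM.
apply: (@le_integrableR _ (fun x => M * `|f x|)).
- by apply: measurable_funM => //; exact: measurable_of_integrable.
- by move=> x; rewrite normrM ler_wpM2r.
- by apply: integrableZR; exact: integrable_norm.
Qed.

End Rintegral_tools.

Section compact_support_calculus.
Context {R : realType} {n : nat}.
Local Notation E := ('rV[R]_n * R)%type.
Local Notation mE := ('rV[R]_n * measurableTypeR R)%type.
Local Notation mu := (@lebesgue_st R n).
Implicit Types (F : E -> R) (N : R) (z v : E).

Definition cube N : set E := [set z | forall c, `|co c z| <= N].

Lemma measurable_cube N : measurable (cube N : set mE).
Proof.
rewrite (_ : cube N = [set z | forall c, [set x : R | `|x| <= N] (co c z)])//.
apply: (@measurable_box _ _ (fun=> [set x : R | `|x| <= N])) => _.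
rewrite (_ : mkset _ = `[-N, N]%classic)//.
by apply/seteqP; split => x /=; rewrite in_itv/= ler_norml.
Qed.

Lemma cube_lty N : (mu (cube N) < +oo)%E.
Proof.
rewrite (_ : cube N = [set z | forall c, [set x : R | `|x| <= N] (co c z)])//.
have E1 : [set x : R | `|x| <= N] = `[-N, N]%classic.
  by apply/seteqP; split => x /=; rewrite in_itv/= ler_norml.
have m1 : measurable [set x : R | `|x| <= N] by rewrite E1.
rewrite (lebesgue_st_box (A := fun=> [set x : R | `|x| <= N]))// E1.
rewrite lebesgue_measure_itv/=.
have H : (if ((- N)%:E < N%:E)%E then (N%:E - (- N)%:E)%E else 0%E) \is a fin_num by case: ifP.
rewrite ltey_eq fin_numM//; elim/big_ind : _ => // x y; exact: fin_numM.
Qed.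

Lemma compact_cube N : compact (cube N).
Proof.
rewrite (_ : cube N = [set x : 'rV[R]_n | forall i, `[-N, N]%classic (x ord0 i)] `*` `[-N, N]%classic); last first.
  apply/seteqP; split => -[x t] /=.
    move=> H; split; last by have := H None; rewrite ler_norml in_itv.
    by move=> i; have := H (Some i); rewrite ler_norml in_itv.
  move=> [H1 H2] [i|] /=; rewrite ler_norml; first by have := H1 i; rewrite in_itv.
  by move: H2; rewrite in_itv.
apply: compact_setX; last exact: segment_compact.
by apply: (@rV_compact _ _ (fun=> `[-N, N]%classic)) => _; exact: segment_compact.
Qed.

Lemma closed_cube N : closed (cube N).
Proof.
apply: compact_closed; last exact: compact_cube.
exact: (@norm_hausdorff R ('rV[R]_n * R)%type).
Qed.

Lemma cube_bounded F N : continuous F -> (forall z, ~ cube N z -> F z = 0) ->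
  exists2 M, 0 <= M & forall z, `|F z| <= M.
Proof.
move=> cF F0.
have /compact_bounded[M [_ HM]] : compact (F @` cube N).
  apply: continuous_compact; last exact: compact_cube.
  exact: continuous_subspaceT.
exists (`|M| + 1); first by rewrite addr_ge0.
move=> z; have [Nz|Nz] := pselect (cube N z); last by rewrite F0// normr0 addr_ge0.
apply: HM; last by exists z.
by rewrite (le_lt_trans (ler_norm _))// ltrDl.
Qed.

Lemma integrable_cube (M N : R) : mu.-integrable setT (EFin \o (fun z => M * (\1_(cube N) z))).
Proof.
apply: integrableZR; apply/integrableP; split.
  by apply/measurable_EFinP; exact: measurable_indic (measurable_cube N).
under eq_integral do rewrite /= ger0_norm//.
rewrite integral_indic//; last exact: measurable_cube.
by rewrite setIT; exact: cube_lty.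
Qed.

Lemma integrable_bounded_cube F (M N : R) : measurable_fun setT (F : mE -> R) ->
  (forall z, ~ cube N z -> F z = 0) -> (forall z, `|F z| <= M) ->
  mu.-integrable setT (EFin \o F).
Proof.
move=> mF F0 FM; apply: (le_integrableR mF _ (integrable_cube M N)) => z.
rewrite indicE; have [Nz|Nz] := pselect (cube N z); first by rewrite mem_set// mulr1.
by rewrite memNset// mulr0 F0// normr0.
Qed.

Lemma integrable_cont_cube F N : continuous F ->
  (forall z, ~ cube N z -> F z = 0) -> mu.-integrable setT (EFin \o F).
Proof.
move=> cF F0; have [M _ FM] := cube_bounded cF F0.
exact: integrable_bounded_cube (continuous_measurable_st cF) F0 FM.
Qed.

Lemma integral_affine (a : E) (sg : R) (f : mE -> \bar R) :
  sg = 1 \/ sg = -1 -> measurable_fun setT f ->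
  (\int[mu]_x f (a + sg *: x)%R = \int[mu]_x f x)%E.
Proof.
move=> sgE mf; rewrite [LHS]integralE [RHS]integralE.
congr (_ - _)%E.
  rewrite -[RHS](ge0_integral_affine a sgE (measurable_funepos mf) (funepos_ge0 f)).
  by apply: eq_integral => x _; rewrite !unlock.
rewrite -[RHS](ge0_integral_affine a sgE (measurable_funeneg mf) (funeneg_ge0 f)).
by apply: eq_integral => x _; rewrite !unlock.
Qed.

Lemma integrable_affine (a : E) (sg : R) (f : mE -> R) :
  sg = 1 \/ sg = -1 -> mu.-integrable setT (EFin \o f) ->
  mu.-integrable setT (EFin \o (fun z => f (a + sg *: z))).
Proof.
move=> sgE /integrableP[mf fi]; apply/integrableP; split.
  exact: measurableT_comp mf (measurable_affine _ _).
have := @integral_affine a sg (fun z => `|(f z)%:E|)%E sgE.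
by move=> ->//; exact: measurableT_comp.
Qed.

Lemma is_derive_along F z v (t : R) : smooth F ->
  is_derive t 1 (fun t : R => F (z + t *: v)) ('D_v F (z + t *: v)).
Proof.
move=> sF; have [d1 d2] := smooth_is_derive (z + t *: v) v sF.
have E1 (s : R) : F (s *: v + (z + t *: v)) = F (z + (s * 1 + t) *: v).
  by congr F; rewrite mulr1 scalerDl addrCA addrA.
apply: DeriveDef.
  have /derivable1P d1' := d1; apply/derivable1P.
  by under eq_fun do rewrite -E1.
rewrite [LHS]derive_line [RHS]derive_line; f_equal.
by apply/funext => s; rewrite -E1.
Qed.

Lemma mean_value F z v M h : smooth F -> (forall z, `|'D_v F z| <= M) ->
  `|F (z + h *: v) - F z| <= M * `|h|.
Proof.
move=> sF FM.
pose f t := F (z + t *: v).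
have fd (t : R) : is_derive t 1 f ('D_v F (z + t *: v)) by exact: is_derive_along.
have fc : continuous f.
  by move=> t; have [+ _] := fd t; move=> /derivable1_diffP/differentiable_continuous.
have E0 : F z = f 0 by rewrite /f scale0r addr0.
rewrite E0 -/(f h).
have H a b : a <= b -> `|f b - f a| <= M * (b - a).
  move=> ab; have [c _ ->] := MVT_segment ab (fun x _ => fd x) (continuous_subspaceT fc).
  by rewrite normrM (ger0_norm (_ : 0 <= b - a)) ?subr_ge0// ler_wpM2r ?subr_ge0.
have [h0|h0] := leP 0 h; first by have := H _ _ h0; rewrite subr0 (ger0_norm h0).
by have := H _ _ (ltW h0); rewrite sub0r distrC (ltr0_norm h0).
Qed.

Lemma smooth_cvg_quotient F z v (h : nat -> R) : smooth F ->
  (forall k, h k != 0) -> h k @[k --> \oo] --> 0 ->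
  (h k)^-1 * (F (z + h k *: v) - F z) @[k --> \oo] --> 'D_v F z.
Proof.
move=> sF h0 hc; have d := @smooth_derivable _ _ F z v sF.
have /cvgr_dnbhsP/(_ h (conj h0 hc)) := d.
by apply: cvg_trans; apply: near_eq_cvg; apply: nearW => k; rewrite /= (addrC z).
Qed.

(** By translation invariance the difference quotients of [F] have integral zero, and they converge
    to the derivative under a common bound. All integrations by parts below come from this. *)
Lemma integral_derive0 F N v : smooth F -> (forall z, ~ cube N z -> F z = 0) ->
  \int[mu]_z 'D_v F z = 0.
Proof.
move=> sF F0.
have cF := smooth_cont sF; have sD := smooth_derive v sF; have cD := smooth_cont sD.
have D0 := derive_out v F0 (@closed_cube N).
have [M M0 HM] := cube_bounded cD D0.
pose h (k : nat) : R := k.+1%:R^-1.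
have h0 k : h k != 0 by rewrite invr_eq0 pnatr_eq0.
pose fk k z := (h k)^-1 * (F (z + h k *: v) - F z).
have mF := continuous_measurable_st cF.
have iF := integrable_cont_cube cF F0.
have iFt k : mu.-integrable setT (EFin \o (fun z => F (z + h k *: v))).
  have := @integrable_affine (h k *: v) 1 F (or_introl erefl) iF.
  by apply: eq_integrable => // z _ /=; rewrite scale1r addrC.
have ifk k : \int[mu]_z fk k z = 0.
  rewrite RintegralZl//; last exact: integrableBR.
  rewrite RintegralB//.
  rewrite (_ : \int[mu]_z F (z + h k *: v) = \int[mu]_z F z) ?subrr ?mulr0//.
  rewrite /Rintegral -(@integral_affine (h k *: v) 1 (EFin \o F)); [|by left|exact/measurable_EFinP].
  by congr fine; apply: eq_integral => z _; rewrite /= scale1r addrC.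
(* The steps are at most [1], so all the difference quotients vanish outside the cube enlarged by
   the norm of [v]. *)
have [] := @Rdominated_cvg _ _ _ mu fk (fun z => 'D_v F z) (fun z => M * \1_(cube (N + `|v|)) z).
- move=> k; apply: measurable_funM => //; apply: measurable_funB => //.
  exact: measurable_of_integrable (iFt k).
- exact: continuous_measurable_st.
- apply: aeW => z; apply: smooth_cvg_quotient => //; exact: cvg_harmonic.
- exact: integrable_cube.
- apply: aeW => z k; rewrite /fk normrM normfV.
  have hk0 : 0 < `|h k| by rewrite normr_gt0.
  rewrite ler_pdivrMl// indicE.
  have [Nz|Nz] := pselect (cube (N + `|v|) z).
    by rewrite mem_set// mulr1 mulrC mean_value.
  rewrite memNset// mulr0 mulr0.
  have [c Hc] : exists c, ~ `|co c z| <= N + `|v| by apply/existsNP.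
  rewrite !F0 ?subrr ?normr0//.
    move=> /(_ c) H; apply: Hc; apply: le_trans H _; rewrite lerDl//.
  move=> /(_ c) H; apply: Hc.
  rewrite (_ : co c z = co c (z + h k *: v) - h k * co c v); last by rewrite coD coZ addrK.
  rewrite (le_trans (ler_normB _ _))// lerD// normrM -[leRHS]mul1r ler_pM//; last exact: norm_co_le.
  by rewrite ger0_norm ?invr_ge0// invf_le1// ler1n.
move=> _; under eq_fun do rewrite ifk.
by move=> /cvg_lim <-//; rewrite lim_cst.
Qed.

End compact_support_calculus.

(** * Mollification *)

Section convolution.
Context {R : realType} {n : nat}.
Local Notation E := ('rV[R]_n * R)%type.
Local Notation mE := ('rV[R]_n * measurableTypeR R)%type.
Local Notation mu := (@lebesgue_st R n).
Implicit Types (K f : E -> R) (N M : R) (z w v : E).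

Definition convol K f z : R := \int[mu]_w (K (z - w) * f w).

Lemma measurable_reflect K z : continuous K ->
  measurable_fun setT ((fun w => K (z - w)) : mE -> R).
Proof.
move=> /continuous_measurable_st mK.
have -> : (fun w => K (z - w)) = K \o (fun w => z + (-1) *: w).
  by apply/funext => w /=; rewrite scaleN1r.
exact: measurableT_comp mK (measurable_affine _ _).
Qed.

Lemma measurable_sub : measurable_fun setT (fun x : mE * mE => x.1 - x.2 : mE).
Proof.
apply: measurable_fun_co => c; under eq_fun do rewrite coB.
apply: measurable_funB; exact: measurableT_comp (@measurable_co _ _ c) _.
Qed.

Lemma integrable_conv K f z M : continuous K -> (forall w, `|K w| <= M) ->
  mu.-integrable setT (EFin \o f) ->
  mu.-integrable setT (EFin \o (fun w => K (z - w) * f w)).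
Proof.
by move=> cK KM fi; apply: (integrableMbR fi (measurable_reflect z cK)) => w; exact: KM.
Qed.

Lemma continuous_conv K f M : continuous K -> (forall w, `|K w| <= M) ->
  mu.-integrable setT (EFin \o f) -> continuous (convol K f).
Proof.
move=> cK KM fi z; apply: cvg_nbhs_seq => x xz.
have [] := @Rdominated_cvg _ _ _ mu (fun k w => K (x k - w) * f w)
  (fun w => K (z - w) * f w) (fun w => M * `|f w|) => //.
- by move=> k; exact: measurable_of_integrable (integrable_conv _ cK KM fi).
- exact: measurable_of_integrable (integrable_conv _ cK KM fi).
- apply: aeW => w; apply: cvgM; last exact: cvg_cst.
  by apply: (continuous_cvg _ (cK _)); apply: cvgB => //; exact: cvg_cst.
- by apply: integrableZR; exact: integrable_norm.
- by apply: aeW => w k; rewrite normrM ler_wpM2r.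
Qed.

Lemma is_derive_conv K f N z v : smooth K -> (forall w, ~ cube N w -> K w = 0) ->
  mu.-integrable setT (EFin \o f) ->
  is_derive z v (convol K f) (convol (fun w => 'D_v K w) f z).
Proof.
move=> sK K0 fi.
have cK := smooth_cont sK; have sD := smooth_derive v sK; have cD := smooth_cont sD.
have [M _ KM] := cube_bounded cK K0.
have [M' _ DM] := cube_bounded cD (derive_out v K0 (@closed_cube _ _ N)).
suff H : (fun h : R => h^-1 *: ((convol K f \o shift z) (h *: v) - convol K f z)) @ 0^' -->
    convol (fun w => 'D_v K w) f z.
  by apply: DeriveDef; [apply/cvg_ex; eexists; exact: H|exact/cvg_lim].
apply/cvgr_dnbhsP => h [h0 hc].
have quo k : (h k)^-1 *: ((convol K f \o shift z) (h k *: v) - convol K f z) =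
    \int[mu]_w ((h k)^-1 * (K (z - w + h k *: v) - K (z - w)) * f w).
  rewrite /= /convol -RintegralB//; [|exact: integrable_conv KM fi..].
  rewrite -[LHS]/(_ * _) -RintegralZl//; last first.
    by apply: integrableBR; exact: integrable_conv KM fi.
  apply: eq_Rintegral => w _; rewrite -mulrBl mulrA.
  by rewrite (_ : h k *: v + z - w = z - w + h k *: v)// (addrC _ z) addrAC.
under eq_fun do rewrite quo.
have [] := @Rdominated_cvg _ _ _ mu
  (fun k w => (h k)^-1 * (K (z - w + h k *: v) - K (z - w)) * f w)
  (fun w => 'D_v K (z - w) * f w) (fun w => M' * `|f w|) => //.
- move=> k; apply: measurable_funM; last exact: measurable_of_integrable fi.
  apply: measurable_funM => //; apply: measurable_funB; last exact: measurable_reflect.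
  have := @measurable_reflect K (z + h k *: v) cK.
  by under [X in _ -> measurable_fun _ X]eq_fun do rewrite addrAC.
- exact: measurable_of_integrable (integrable_conv _ cD DM fi).
- apply: aeW => w; apply: cvgM; last exact: cvg_cst.
  exact: smooth_cvg_quotient.
- by apply: integrableZR; exact: integrable_norm.
- apply: aeW => w k; rewrite normrM ler_wpM2r// normrM normfV.
  rewrite ler_pdivrMl ?normr_gt0// mulrC.
  exact: mean_value.
Qed.

Lemma smooth_conv K f N : smooth K -> (forall w, ~ cube N w -> K w = 0) ->
  mu.-integrable setT (EFin \o f) -> smooth (convol K f).
Proof.
move=> sK K0 fi; apply/smoothP => k; elim: k K sK K0 => [|k IH] K sK K0.
  split => //; have [M _ KM] := cube_bounded (smooth_cont sK) K0.
  exact: continuous_conv (smooth_cont sK) KM fi.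
have [M _ KM] := cube_bounded (smooth_cont sK) K0.
split; first exact: continuous_conv (smooth_cont sK) KM fi.
split=> [z v|v]; first by have [] := is_derive_conv z v sK K0 fi.
apply: (@Ck_le_ext _ _ _ _ (convol (fun w => 'D_v K w) f)).
  by move=> z; have [] := is_derive_conv z v sK K0 fi.
apply: IH; first exact: smooth_derive.
exact: derive_out K0 (@closed_cube _ _ N).
Qed.

Lemma convD K f g z M : continuous K -> (forall w, `|K w| <= M) ->
  mu.-integrable setT (EFin \o f) -> mu.-integrable setT (EFin \o g) ->
  convol K (fun w => f w + g w) z = convol K f z + convol K g z.
Proof.
move=> cK KM fi gi; rewrite /convol -RintegralD//; [|exact: integrable_conv KM _..].
by apply: eq_Rintegral => w _; rewrite mulrDr.
Qed.

Lemma convZ K f a z M : continuous K -> (forall w, `|K w| <= M) ->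
  mu.-integrable setT (EFin \o f) ->
  convol K (fun w => a * f w) z = a * convol K f z.
Proof.
move=> cK KM fi; rewrite /convol -RintegralZl//; last exact: integrable_conv KM _.
by apply: eq_Rintegral => w _; rewrite mulrCA.
Qed.

Lemma integral_reflect K z : continuous K -> (forall w, 0 <= K w) ->
  (\int[mu]_w (K (z - w))%:E = \int[mu]_w (K w)%:E)%E.
Proof.
move=> cK K0.
rewrite -(@ge0_integral_affine _ _ z (-1) (EFin \o K)); [|by right| |by move=> w; rewrite /= lee_fin].
  by apply: eq_integral => w _; rewrite /= scaleN1r.
by apply/measurable_EFinP; exact: continuous_measurable_st.
Qed.

Lemma integral_translate K w : continuous K -> (forall w, 0 <= K w) ->
  (\int[mu]_z (K (z - w))%:E = \int[mu]_z (K z)%:E)%E.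
Proof.
move=> cK K0.
rewrite -(@ge0_integral_affine _ _ (-w) 1 (EFin \o K)); [|by left| |by move=> z; rewrite /= lee_fin].
  by apply: eq_integral => z _; rewrite /= scale1r addrC.
by apply/measurable_EFinP; exact: continuous_measurable_st.
Qed.

(* By Tonelli, since the translates of [K] have integral [1]. *)
Lemma conv_contraction K f M : continuous K -> (forall w, 0 <= K w) ->
  (forall w, `|K w| <= M) -> (\int[mu]_w (K w)%:E = 1)%E ->
  mu.-integrable setT (EFin \o f) ->
  (\int[mu]_z `|(convol K f z)%:E| <= \int[mu]_z `|(f z)%:E|)%E.
Proof.
move=> cK K0 KM K1 fi.
have mf := measurable_of_integrable fi.
pose G (x : mE * mE) : \bar R := (K (x.1 - x.2) * `|f x.2|)%:E.
have mG : measurable_fun setT G.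
  apply/measurable_EFinP; apply: measurable_funM.
    exact: measurableT_comp (continuous_measurable_st cK) measurable_sub.
  apply: measurableT_comp => //; exact: measurableT_comp mf measurable_snd.
have G0 x : (0 <= G x)%E by rewrite lee_fin mulr_ge0.
have cconv := continuous_conv cK KM fi.
apply: (@le_trans _ _ (\int[mu]_z \int[mu]_w G (z, w))%E).
  apply: ge0_le_integral => //.
  - apply: measurableT_comp => //; apply/measurable_EFinP; exact: continuous_measurable_st.
  - exact: (@measurable_fun_fubini_tonelli_F _ _ _ _ R mu G).
  move=> z _; rewrite /convol /Rintegral fineK; last first.
    by apply: integrable_fin_num => //; exact: integrable_conv KM fi.
  apply: le_trans (le_abse_integral _ _ _) _ => //.
    exact: measurable_int (integrable_conv z cK KM fi).
  apply: ge0_le_integral => //.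
  - by apply: measurableT_comp => //; exact: measurable_int (integrable_conv z cK KM fi).
  - exact: measurableT_comp mG (measurable_pair1 _).
  - by move=> w _; rewrite /G /= lee_fin normrM (ger0_norm (K0 _)).
rewrite (@fubini_tonelli _ _ _ _ R mu mu G mG G0).
apply: ge0_le_integral => //.
- by move=> w _; exact: integral_ge0.
- exact: (@measurable_fun_fubini_tonelli_G _ _ _ _ R mu G).
- by apply: measurableT_comp => //; exact/measurable_EFinP.
move=> w _; rewrite /G /=.
under eq_integral do rewrite mulrC EFinM.
rewrite ge0_integralZl//; last 2 first.
- apply/measurable_EFinP.
  have -> : (fun z => K (z - w)) = K \o (fun z => - w + 1 *: z).
    by apply/funext => z /=; rewrite scale1r addrC.
  exact: measurableT_comp (continuous_measurable_st cK) (measurable_affine _ _).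
- by move=> z _; rewrite lee_fin.
by rewrite integral_translate// K1 mule1.
Qed.

End convolution.

Section mollifier.
Context {R : realType} {n : nat}.
Local Notation E := ('rV[R]_n * R)%type.
Local Notation mE := ('rV[R]_n * measurableTypeR R)%type.
Local Notation mu := (@lebesgue_st R n).
Implicit Types (f g : E -> R) (N M e : R) (z w v : E) (k : nat).

(* Supported in [0 <= z_c <= e]: one-sidedness makes mollifications of
   indicators of half-open boxes converge at every point. *)
Definition bump e z : R := \prod_c (flat 0 (co c z) * flat 0 (e - co c z)).

Definition moll e z : R := bump e z * (\int[mu]_w bump e w)^-1.

Lemma smooth_bump e : smooth (bump e).
Proof.
apply: smooth_prod => c; apply: smoothM; apply: smooth_flat; first exact: smooth_co.
apply: (@smoothD _ _ (fun=> e) (fun z => - co c z)); first exact: smooth_cst.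
under eq_fun do rewrite -mulN1r.
by apply: (@smoothM _ _ (fun=> -1)); [exact: smooth_cst|exact: smooth_co].
Qed.

Lemma bump_ge0 e z : 0 <= bump e z.
Proof. by apply: prodr_ge0 => c _; rewrite mulr_ge0// flat_ge0. Qed.

Lemma bump_neq0 e z : bump e z != 0 -> forall c, 0 < co c z < e.
Proof.
move=> /prodf_neq0 H c; have := H c isT; rewrite mulf_eq0 negb_or => /andP[H1 H2].
apply/andP; split; rewrite ltNge; apply/negP => H3.
  by move: H1; rewrite flat_le0// eqxx.
by move: H2; rewrite flat_le0 ?eqxx// subr_le0.
Qed.

Lemma bump_cube e z : 0 < e -> ~ cube e z -> bump e z = 0.
Proof.
move=> e0 Nz; apply/eqP/negPn/negP => /bump_neq0 H; apply: Nz => c.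
by have /andP[? ?] := H c; rewrite ger0_norm ltW.
Qed.

Lemma integrable_bump e : 0 < e -> mu.-integrable setT (EFin \o bump e).
Proof.
move=> e0; apply: integrable_cont_cube (smooth_cont (@smooth_bump e)) _ => z.
exact: bump_cube.
Qed.

(** A zero integral would make the bump vanish almost everywhere, although it is positive on an open
    box of positive measure. *)
Lemma integral_bump_gt0 e : 0 < e -> 0 < \int[mu]_w bump e w.
Proof.
move=> e0; rewrite lt_neqAle Rintegral_ge0 ?andbT; last by move=> w _; exact: bump_ge0.
apply/eqP => I0.
have mb : measurable_fun setT (EFin \o bump e : mE -> \bar R).
  by apply/measurable_EFinP; exact: continuous_measurable_st (smooth_cont (@smooth_bump e)).
have : (\int[mu]_w `|(bump e w)%:E| = 0)%E.
  under eq_integral do rewrite /= ger0_norm ?bump_ge0//.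
  rewrite -[LHS]fineK; first by rewrite [fine _](esym I0).
  exact: integrable_fin_num (integrable_bump e0).
move/(ae_eq_integral_abs _ measurableT mb) => [A [mA A0 HA]].
pose B := [set z : mE | forall c, `]0, e[%classic (co c z)].
have BA : B `<=` A.
  move=> z Bz; apply: HA => /= /(_ I) [] H.
  have : 0 < bump e z.
    apply: prodr_gt0 => c _; have := Bz c; rewrite /= in_itv/= => /andP[? ?].
    by rewrite mulr_gt0// flat_gt0// subr_gt0.
  by rewrite H ltxx.
have mB : measurable B by exact: (@measurable_box _ _ (fun=> `]0, e[%classic)).
have B0 : mu B = 0%E by exact: subset_measure0 mB mA BA A0.
move: B0; rewrite /B (lebesgue_st_box (A := fun=> `]0, e[%classic))//.
rewrite lebesgue_measure_itv/= lte_fin e0 sube0 => H.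
have : (0 < \prod_(i < n) e%:E * e%:E)%E.
  by rewrite mule_gt0//; elim/big_ind : _ => // x y; exact: mule_gt0.
by rewrite H ltxx.
Qed.

Lemma smooth_moll e : smooth (moll e).
Proof. by apply: smoothM; [exact: smooth_bump|exact: smooth_cst]. Qed.

Lemma moll_ge0 e z : 0 <= moll e z.
Proof.
rewrite mulr_ge0 ?bump_ge0// invr_ge0 Rintegral_ge0// => w _; exact: bump_ge0.
Qed.

Lemma moll_neq0 e z : moll e z != 0 -> forall c, 0 < co c z < e.
Proof. by rewrite mulf_eq0 negb_or => /andP[/bump_neq0]. Qed.

Lemma moll_cube e z : 0 < e -> ~ cube e z -> moll e z = 0.
Proof. by move=> e0 Nz; rewrite /moll bump_cube// mul0r. Qed.

Lemma integral_moll e : 0 < e -> (\int[mu]_w (moll e w)%:E = 1)%E.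
Proof.
move=> e0; have I0 := integral_bump_gt0 e0.
rewrite /moll; under eq_integral do rewrite mulrC EFinM.
rewrite integralZl//; last exact: integrable_bump.
rewrite -[X in (_ * X)%E]fineK; last exact: integrable_fin_num (integrable_bump e0).
by rewrite -EFinM mulVf// gt_eqF.
Qed.

Lemma moll_bounded e : 0 < e -> exists M, forall z, `|moll e z| <= M.
Proof.
move=> e0; have [M _ HM] := cube_bounded (smooth_cont (@smooth_moll e)) (fun z => moll_cube e0).
by exists M.
Qed.

Definition mollify k f := convol (moll k.+1%:R^-1) f.

Lemma mollify_eps k : 0 < k.+1%:R^-1 :> R.
Proof. by rewrite invr_gt0. Qed.

Definition L1norm f : R := \int[mu]_z `|f z|.
Local Notation L1 f := (mu.-integrable setT (EFin \o f)).

Lemma smooth_mollify k f : L1 f -> smooth (mollify k f).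
Proof.
move=> fi; apply: (smooth_conv (@smooth_moll _) _ fi) => z.
exact: (moll_cube (mollify_eps k)).
Qed.

Lemma mollifyD k f g z : L1 f -> L1 g -> mollify k (fun w => f w + g w) z = mollify k f z + mollify k g z.
Proof.
move=> fi gi; have [M HM] := moll_bounded (mollify_eps k).
by rewrite /mollify (convD _ _ HM)//; exact: smooth_cont (@smooth_moll _).
Qed.

Lemma mollifyZ k a f z : L1 f -> mollify k (fun w => a * f w) z = a * mollify k f z.
Proof.
move=> fi; have [M HM] := moll_bounded (mollify_eps k).
by rewrite /mollify (convZ _ _ _ HM)//; exact: smooth_cont (@smooth_moll _).
Qed.

Lemma mollify_L1e k f : L1 f -> (\int[mu]_z `|(mollify k f z)%:E| <= \int[mu]_z `|(f z)%:E|)%E.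
Proof.
move=> fi; have [M HM] := moll_bounded (mollify_eps k).
apply: (conv_contraction _ _ HM) => //; first exact: smooth_cont (@smooth_moll _).
  by move=> w; exact: moll_ge0.
exact: integral_moll (mollify_eps k).
Qed.

Lemma integrable_mollify k f : L1 f -> L1 (mollify k f).
Proof.
move=> fi; apply/integrableP; split.
  apply/measurable_EFinP; apply: continuous_measurable_st.
  exact: smooth_cont (smooth_mollify k fi).
apply: le_lt_trans (mollify_L1e k fi) _.
by have /integrableP[] := fi.
Qed.

Lemma N1E f : L1 f -> (L1norm f)%:E = (\int[mu]_z `|(f z)%:E|)%E.
Proof.
move=> fi; rewrite /L1norm /Rintegral fineK//.
exact: integrable_fin_num (integrable_norm fi).
Qed.

Lemma L1norm_mollify k f : L1 f -> L1norm (mollify k f) <= L1norm f.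
Proof.
move=> fi; rewrite -lee_fin !N1E//; [exact: mollify_L1e|exact: integrable_mollify].
Qed.

Lemma N1_ge0 f : 0 <= L1norm f.
Proof. exact: Rintegral_ge0. Qed.

Lemma N1D f g : L1 f -> L1 g -> L1norm (fun z => f z + g z) <= L1norm f + L1norm g.
Proof.
move=> fi gi; rewrite /L1norm -RintegralD//; [|exact: integrable_norm..].
apply: le_Rintegral => //.
- exact: integrable_norm (integrableDR fi gi).
- by apply: integrableDR; exact: integrable_norm.
- by move=> z _; exact: ler_normD.
Qed.

Lemma N1Z a f : L1 f -> L1norm (fun z => a * f z) = `|a| * L1norm f.
Proof.
move=> fi; rewrite /L1norm -RintegralZl//; last exact: integrable_norm.
by apply: eq_Rintegral => z _; rewrite normrM.
Qed.

(** Kept as a predicate so that closure under sums, multiples and [L^1] limits can be proved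
    separately; boxes, then measurable sets, then simple functions lead to all integrable functions
    of bounded support. *)
Definition mollifiable f := L1 f /\
  L1norm (fun z => mollify k f z - f z) @[k --> \oo] --> 0.

Lemma mollifiableD f g : mollifiable f -> mollifiable g -> mollifiable (fun z => f z + g z).
Proof.
move=> [fi fc] [gi gc]; split; first exact: integrableDR.
apply: (@squeeze_cvgr _ _ _ _ (fun=> 0)
  (fun k => L1norm (fun z => mollify k f z - f z) + L1norm (fun z => mollify k g z - g z))).
- apply: nearW => k; rewrite N1_ge0/=.
  have -> : (fun z => mollify k (fun w => f w + g w) z - (f z + g z)) =
      (fun z => (mollify k f z - f z) + (mollify k g z - g z)).
    by apply/funext => z; rewrite mollifyD// opprD addrACA.
  by apply: N1D; apply: integrableBR => //; exact: integrable_mollify.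
- exact: cvg_cst.
- by rewrite -[X in _ --> X](addr0 0); exact: cvgD.
Qed.

Lemma mollifiableZ a f : mollifiable f -> mollifiable (fun z => a * f z).
Proof.
move=> [fi fc]; split; first exact: integrableZR.
have -> : (fun k => L1norm (fun z => mollify k (fun w => a * f w) z - a * f z)) =
    (fun k => `|a| * L1norm (fun z => mollify k f z - f z)).
  apply/funext => k; rewrite -N1Z; last by apply: integrableBR => //; exact: integrable_mollify.
  by congr L1norm; apply/funext => z; rewrite mollifyZ// mulrBr.
by rewrite -(mulr0 `|a|); apply: cvgM => //; exact: cvg_cst.
Qed.

Lemma mollifiable0 : mollifiable (fun=> 0).
Proof.
split; first exact: integrable0.
have c0 k z : mollify k (fun=> 0) z = 0.
  rewrite /mollify /convol (_ : (fun w => _) = (fun=> 0)); last by apply/funext => w; rewrite mulr0.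
  by rewrite /Rintegral integral0.
rewrite (_ : (fun k => _) = (fun=> 0)); first exact: cvg_cst.
apply/funext => k; rewrite /L1norm (_ : (fun z => _) = (fun=> 0)).
  by rewrite /Rintegral integral0.
by apply/funext => z; rewrite c0 subr0 normr0.
Qed.

Lemma mollifiable_sum (I : Type) (r : seq I) (F : I -> E -> R) :
  (forall i, mollifiable (F i)) -> mollifiable (fun z => \sum_(i <- r) F i z).
Proof.
move=> H; elim: r => [|i r IH].
  by under eq_fun do rewrite big_nil; exact: mollifiable0.
by under eq_fun do rewrite big_cons; exact: mollifiableD.
Qed.

(** The error for [f] is split through [g]: mollification does not increase the [L^1] norm of
    [f - g], so the three pieces are at most [e / 4] each for large [k]. *)
Lemma mollifiable_lim f : L1 f ->
  (forall e, 0 < e -> exists2 g, mollifiable g & L1norm (fun z => f z - g z) <= e) -> mollifiable f.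
Proof.
move=> fi H; split => //; apply/cvgrPdist_le => e e0.
have [g [gi gc] fg] := H (e / 4) ltac:(lra).
move/cvgrPdist_le : gc => /(_ (e / 4) ltac:(lra)); apply: filterS => k.
rewrite !sub0r !normrN !ger0_norm ?N1_ge0// => gk.
have dfi : L1 (fun z => f z - g z) by exact: integrableBR.
have cfi := integrable_mollify k dfi.
have cgi : L1 (fun z => mollify k g z - g z) by apply: integrableBR => //; exact: integrable_mollify.
have -> : (fun z => mollify k f z - f z) =
    (fun z => mollify k (fun z => f z - g z) z + ((mollify k g z - g z) + (-1) * (f z - g z))).
  apply/funext => z.
  have -> : f = (fun w => (f w - g w) + g w) by apply/funext => w; rewrite subrK.
  rewrite (mollifyD k z dfi gi).
  rewrite (_ : (fun z => f z - g z + g z - g z) = (fun z => f z - g z)); last first.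
    by apply/funext => w; rewrite addrK.
  by ring.
apply: le_trans (N1D cfi (integrableDR cgi (integrableZR (-1) dfi))) _.
have := N1D cgi (integrableZR (-1) dfi); rewrite N1Z// normrN1 mul1r.
have := L1norm_mollify k dfi; lra.
Qed.

End mollifier.

(** * Convergence of mollifications in [L^1] *)

Section mollification_L1.
Context {R : realType} {n : nat}.
Local Notation E := ('rV[R]_n * R)%type.
Local Notation mE := ('rV[R]_n * measurableTypeR R)%type.
Local Notation mu := (@lebesgue_st R n).
Local Notation L1 f := (mu.-integrable setT (EFin \o f)).
Implicit Types (f g : E -> R) (N M e : R) (z w v : E) (k : nat).

Lemma integrable_moll_reflect e z : 0 < e -> L1 (fun w => moll e (z - w)).
Proof.
move=> e0; have cK := smooth_cont (@smooth_moll R n e).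
apply/integrableP; split.
  by apply/measurable_EFinP; exact: measurable_reflect.
under eq_integral do rewrite /= ger0_norm ?moll_ge0//.
rewrite integral_reflect//; last by move=> w; exact: moll_ge0.
by rewrite integral_moll// ltry.
Qed.

Lemma Rintegral_moll_reflect e z : 0 < e -> \int[mu]_w moll e (z - w) = 1.
Proof.
move=> e0; rewrite /Rintegral integral_reflect//.
- by rewrite integral_moll.
- exact: smooth_cont (@smooth_moll R n e).
- by move=> w; exact: moll_ge0.
Qed.

Lemma mollify_le k f M z : L1 f -> (forall w, `|f w| <= M) -> `|mollify k f z| <= M.
Proof.
move=> fi fM; have e0 := @mollify_eps R k.
have [B HB] := @moll_bounded R n _ e0.
have ci := integrable_conv z (smooth_cont (@smooth_moll R n _)) HB fi.
apply: le_trans (le_normr_Rintegral measurableT ci) _.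
have -> : M = \int[mu]_w (M * moll k.+1%:R^-1 (z - w)).
  rewrite RintegralZl ?Rintegral_moll_reflect ?mulr1//.
  exact: integrable_moll_reflect.
apply: le_Rintegral => //.
- exact: integrable_norm ci.
- by apply: integrableZR; exact: integrable_moll_reflect.
- by move=> w _; rewrite normrM mulrC (ger0_norm (moll_ge0 _ _)) ler_wpM2r// moll_ge0.
Qed.

Lemma mollify_local k f g z : (forall w, (forall c, 0 < co c z - co c w < k.+1%:R^-1) -> f w = g w) ->
  mollify k f z = mollify k g z.
Proof.
move=> fg; apply: eq_Rintegral => w _.
have [->|/moll_neq0 H] := eqVneq (moll k.+1%:R^-1 (z - w)) 0; first by rewrite !mul0r.
by rewrite fg// => c; rewrite -coB; exact: H.
Qed.

Lemma mollify_cst0 k z : mollify k (fun=> 0 : R) z = 0.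
Proof.
rewrite /mollify /convol (_ : (fun w => _) = (fun=> 0)); last by apply/funext => w; rewrite mulr0.
by rewrite /Rintegral integral0.
Qed.

Lemma mollify_cst1 k z : mollify k (fun=> 1 : R) z = 1.
Proof.
rewrite /mollify /convol (_ : (fun w => _) = (fun w => moll k.+1%:R^-1 (z - w))).
  exact: Rintegral_moll_reflect.
by apply/funext => w; rewrite mulr1.
Qed.

(** Bounded convergence: the kernels are supported at distance at most [1], so all the
    mollifications vanish outside one cube, and averaging preserves the bound [M]. *)
Lemma mollifiable_pointwise f M N : measurable_fun setT (f : mE -> R) ->
  (forall z, `|f z| <= M) -> (forall z, ~ cube N z -> f z = 0) ->
  (forall z, mollify k f z @[k --> \oo] --> f z) -> mollifiable f.
Proof.
move=> mf fM f0 fc; have fi := integrable_bounded_cube mf f0 fM.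
split=> //.
have M0 : 0 <= M by apply: le_trans (fM 0).
have mcm k : measurable_fun setT (mollify k f : mE -> R).
  exact: continuous_measurable_st (smooth_cont (smooth_mollify k fi)).
have [] := @Rdominated_cvg _ _ _ mu (fun k z => `|mollify k f z - f z|) (fun=> 0)
   (fun z => (M + M) * \1_(cube (N + 1)) z) => //.
- by move=> k; apply: measurableT_comp => //; exact: measurable_funB.
- apply: aeW => z; rewrite -(@normr0 _ R) -(subrr (f z)); apply: cvg_norm.
  by apply: cvgB => //; exact: cvg_cst.
- exact: integrable_cube.
- apply: aeW => z k; rewrite normr_id indicE.
  have [Nz|Nz] := pselect (cube (N + 1) z).
    by rewrite mem_set// mulr1 (le_trans (ler_normB _ _))// lerD//; exact: mollify_le.
  rewrite memNset// mulr0 f0; last first.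
    by move=> H; apply: Nz => c; rewrite (le_trans (H c))// lerDl.
  rewrite (@mollify_local k f (fun=> 0)) ?mollify_cst0 ?subrr ?normr0// => w H.
  apply: f0 => Nw; apply: Nz => c; have /andP[H1 H2] := H c.
  rewrite -(subrK (co c w) (co c z)) addrC (le_trans (ler_normD _ _))// lerD//.
  by rewrite gtr0_norm// ltW// (lt_le_trans H2)// invf_le1// ler1n.
by rewrite /L1norm Rintegral_cst//= mul0r.
Qed.

Definition hbox (a b : option 'I_n -> R) : set E := [set z | forall c, a c < co c z <= b c].

Lemma measurable_hbox a b : measurable (hbox a b : set mE).
Proof.
rewrite (_ : hbox a b = [set z | forall c, `]a c, b c]%classic (co c z)])//.
exact: (@measurable_box _ _ (fun c => `]a c, b c]%classic)).
Qed.

Lemma near_invS_lt e : 0 < e -> \forall k \near \oo, k.+1%:R^-1 < e.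
Proof. by move=> e0; exact: (near_infty_natSinv_lt (PosNum e0)). Qed.

(** The kernel looks strictly downwards in each coordinate. A point on an upper face, which belongs
    to the box, eventually sees only the box; a point on a lower face, which does not, sees only the
    outside. Hence the mollified indicator is eventually constant at every point, and no boundary
    has to be shown negligible. *)
Lemma mollifiable_hbox a b : mollifiable (\1_(hbox a b) : E -> R).
Proof.
apply: (@mollifiable_pointwise _ 1 (\sum_c (`|a c| + `|b c|))).
- exact: measurable_indic (measurable_hbox a b).
- by move=> z; rewrite indicE; case: (_ \in _); rewrite ?normr1 ?normr0.
- move=> z Nz; rewrite indicE memNset// => Hz; apply: Nz => c.
  have /andP[H1 H2] := Hz c.
  rewrite (bigD1 c)//= (@le_trans _ _ (`|a c| + `|b c|))//; last first.
    by rewrite lerDl sumr_ge0// => i _; rewrite addr_ge0.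
  rewrite ler_norml; have := ler_norm (b c); have := ler_norm (- a c); rewrite normrN.
  by have := normr_ge0 (a c); have := normr_ge0 (b c); move=> *; apply/andP; split; lra.
- move=> z; have [Hz|Hz] := pselect (hbox a b z).
    rewrite indicE mem_set//.
    apply: (@cvg_trans _ ((fun=> 1 : R) @ \oo)); last exact: cvg_cst.
    apply: near_eq_cvg.
    have H : \forall k \near \oo, forall c, k.+1%:R^-1 < co c z - a c.
      apply: filter_forall => c; apply: near_invS_lt.
      by rewrite subr_gt0; have /andP[] := Hz c.
    apply: filterS H => k Hk.
    rewrite (@mollify_local k _ (fun=> 1)) ?mollify_cst1// => w Hw.
    rewrite indicE mem_set// => c; have /andP[H1 H2] := Hz c.
    have /andP[H3 H4] := Hw c; have H5 := lt_trans H4 (Hk c).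
    by apply/andP; split; lra.
  rewrite indicE memNset//.
  apply: (@cvg_trans _ ((fun=> 0 : R) @ \oo)); last exact: cvg_cst.
  apply: near_eq_cvg.
  have [c Hc] : exists c, ~ (a c < co c z <= b c) by apply/existsNP.
  have : \forall k \near \oo, co c z <= a c \/ k.+1%:R^-1 < co c z - b c.
    have [ac|ac] := leP (co c z) (a c); first by apply: nearW => k; left.
    have bc : b c < co c z by rewrite ltNge; apply/negP => H; apply: Hc; rewrite ac.
    have : 0 < co c z - b c by rewrite subr_gt0.
    by move=> /near_invS_lt; apply: filterS => k; right.
  apply: filterS => k Hk.
  rewrite (@mollify_local k _ (fun=> 0)) ?mollify_cst0// => w Hw.
  rewrite indicE memNset// => /(_ c)/andP[H1 H2].
  have /andP[H3 H4] := Hw c; case: Hk => H5; first lra.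
  by have := lt_trans H4 H5; lra.
Qed.

Definition hboxes : set (set E) := [set A | exists a b, A = hbox a b].

Lemma setI_closed_hboxes : setI_closed hboxes.
Proof.
move=> _ _ [a [b ->]] [a' [b' ->]].
exists (fun c => Num.max (a c) (a' c)), (fun c => Num.min (b c) (b' c)).
apply/seteqP; split => z /=.
  by move=> [H1 H2] c; rewrite gt_max le_min; have /andP[-> ->] := H1 c; have /andP[-> ->] := H2 c.
by move=> H; split => c; have := H c; rewrite gt_max le_min => /andP[/andP[? ?] /andP[? ?]]; apply/andP.
Qed.

Lemma measurable_hboxes (A : set mE) : measurable A -> <<s hboxes >> A.
Proof.
move=> mA.
have mid : measurable_fun setT (id : g_sigma_algebraType hboxes -> mE).
  apply: measurable_fun_co => c.
  apply: (measurability (@ocitv R)) => // _ [_ [[a b] _ <-] <-].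
  rewrite setTI.
  (* A condition on one coordinate is a countable union of boxes whose other sides exhaust the
     line. *)
  rewrite (_ : _ @^-1` _ = \bigcup_(m : nat) hbox
     (fun c' => if c' == c then a else - m%:R) (fun c' => if c' == c then b else m%:R)).
    apply: bigcupT_measurable => m; apply: sub_sigma_algebra.
    by do 2 eexists.
  apply/seteqP; split => z /=; last first.
    by move=> [m _ /(_ c)]; rewrite eqxx in_itv.
  rewrite in_itv/= => Hz.
  exists (Num.truncn (\sum_c' `|co c' z|)).+1 => // c'.
  case: eqP => [->//|_].
  have H : `|co c' z| < (Num.truncn (\sum_c' `|co c' z|)).+1%:R.
    apply: le_lt_trans (truncnS_gt _).
    by rewrite (bigD1 c')//= lerDl sumr_ge0.
  by move: H; rewrite ltr_norml => /andP[-> /ltW ->].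
by have := mid measurableT A mA; rewrite setTI.
Qed.

(** Dynkin's argument: the boxes are stable under intersection and generate the sigma-algebra, and
    the sets with this property form a lambda-system. Intersecting with a fixed box keeps all
    indicators integrable. *)
Lemma mollifiable_indic (A : set mE) N : measurable A -> mollifiable (\1_(A `&` hbox (fun=> -N) (fun=> N)) : E -> R).
Proof.
set Q := hbox _ _ => mA.
have mQ : measurable (Q : set mE) by exact: measurable_hbox.
pose H : set (set mE) := [set A | measurable A /\ mollifiable (\1_(A `&` Q) : E -> R)].
suff : <<s hboxes >> `<=` H by move=> /(_ A (measurable_hboxes mA))[].
have L1I (B : set mE) : measurable B -> L1 (\1_(B `&` Q) : E -> R).
  move=> mB; have [Qi _] := @mollifiable_hbox (fun=> -N) (fun=> N).
  apply: (le_integrableR _ _ Qi); first exact: measurable_indic (measurableI _ _ mB mQ).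
  move=> z; rewrite !indicE in_setI -/Q; case: (_ \in Q); rewrite ?andbF ?andbT; last by rewrite normr0.
  by case: (_ \in B); rewrite ?normr0 ?normr1.
apply: (lambda_system_subset setI_closed_hboxes (D := setT)) => //; last first.
- move=> _ [a [b ->]]; split; first exact: measurable_hbox.
  have [a' [b' ->]] : hboxes (hbox a b `&` Q).
    by apply: setI_closed_hboxes; [exists a, b|exists (fun=> -N), (fun=> N)].
  exact: mollifiable_hbox.
split => //.
- by split => //; rewrite setTI; exact: mollifiable_hbox.
- move=> B C CB [mB aB] [mC aC]; split; first exact: measurableD.
  have -> : \1_((B `\` C) `&` Q) = (fun z => \1_(B `&` Q) z + (-1) * \1_(C `&` Q) z) :> (E -> R).
    apply/funext => z; rewrite !indicE in_setI classical_sets.in_setD !in_setI.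
    have : z \in C -> z \in B by rewrite !inE; exact: CB.
    case: (z \in B); case: (z \in C) => // H1; case: (z \in Q) => /=; rewrite ?mulr0 ?mulr1 ?addr0 ?subrr//.
    by have := H1 isT.
  by apply: mollifiableD => //; exact: mollifiableZ.
- move=> F ndF HF; have mF i : measurable (F i) by have [] := HF i.
  split; first exact: bigcupT_measurable.
  have mU : measurable (\bigcup_i F i : set mE) by exact: bigcupT_measurable.
  apply: mollifiable_lim => [|e e0]; first exact: L1I.
  have [] := @Rdominated_cvg _ _ _ mu
     (fun k z => `|\1_(\bigcup_i F i `&` Q) z - \1_(F k `&` Q) z|) (fun=> 0)
     (\1_(setT `&` Q) : E -> R) => //.
  + move=> k; apply: measurableT_comp => //; apply: measurable_funB.
      exact: measurable_of_integrable (L1I _ mU).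
    exact: measurable_of_integrable (L1I _ (mF k)).
  + apply: aeW => z.
    apply: (@cvg_trans _ ((fun=> 0 : R) @ \oo)); last exact: cvg_cst.
    apply: near_eq_cvg.
    have [[i _ Fiz]|nU] := pselect ((\bigcup_i F i) z).
      exists i => // k /= ik; rewrite !indicE !in_setI.
      have -> : z \in \bigcup_i F i by rewrite inE; exists i.
      have -> : z \in F k by rewrite inE; move: (ndF _ _ ik) => /subsetPset; apply.
      by rewrite subrr normr0.
    apply: nearW => k; rewrite !indicE !in_setI memNset//.
    have -> : (z \in F k) = false by apply: memNset => Fk; apply: nU; exists k.
    by rewrite subrr normr0.
  + exact: L1I.
  + apply: aeW => z k; rewrite normr_id !indicE !in_setI in_setT/=.
    case: (_ \in Q); rewrite ?andbF ?andbT ?subrr ?normr0//.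
    have : (z \in F k) -> (z \in \bigcup_i F i) by rewrite !inE => ?; exists k.
    case: (z \in F k); case: (z \in \bigcup_i _) => // H1; rewrite ?subrr ?subr0 ?normr0 ?normr1//.
    by have := H1 isT.
  move=> _; rewrite Rintegral_cst//= mul0r => /cvgrPdist_le/(_ e e0)[k _ /(_ k (leqnn k))].
  rewrite sub0r normrN ger0_norm; last exact: Rintegral_ge0.
  by move=> Hk; exists (\1_(F k `&` Q)) => //; have [] := HF k.
Qed.

Import HBSimple.

Lemma integrable_mollifiable f N : L1 f -> (forall z, ~ cube N z -> f z = 0) -> mollifiable f.
Proof.
move=> fi f0.
(* The margin [1] makes up for the lower faces, which do not belong to [Q]. *)
pose Q := hbox (fun=> - (N + 1)) (fun=> N + 1).
have mQ : measurable (Q : set mE) by exact: measurable_hbox.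
have f0Q z : ~ Q z -> f z = 0.
  move=> Qz; apply: f0 => Nz; apply: Qz => c; have := Nz c; rewrite ler_norml => /andP[? ?].
  by apply/andP; split; lra.
have fiQ : mu.-integrable Q (EFin \o f) by exact: integrableS fi.
have [g [gi _ gc]] := approximation_sfun_integrable mQ fiQ.
apply: mollifiable_lim => // e e0.
have gQE k z : g k z * \1_Q z = \sum_(y <- finmap.enum_fset (fset_set (range (g k)))) y * \1_(g k @^-1` [set y] `&` Q) z.
  rewrite fimfunE fsbig_finite//= mulr_suml; apply: eq_bigr => y _.
  by rewrite -mulrA; congr (_ * _); rewrite !indicE in_setI; case: (_ \in _); case: (_ \in _); rewrite ?mul0r ?mul1r ?mulr0.
have ag k : mollifiable (fun z => g k z * \1_Q z).
  under eq_fun do rewrite gQE.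
  apply: mollifiable_sum => y; apply: mollifiableZ; exact: mollifiable_indic.
have /fine_cvgP[_ /cvgrPdist_le/(_ e e0)[k _ /(_ k (leqnn k))]] := gc.
rewrite /= sub0r normrN ger0_norm; last first.
  by apply: fine_ge0; exact: integral_ge0.
move=> Hk; exists (fun z => g k z * \1_Q z) => //.
apply: le_trans Hk; rewrite /L1norm /Rintegral [in leRHS]integral_mkcond le_eqVlt; apply/orP; left; apply/eqP.
congr fine; apply: eq_integral => z _; rewrite patchE indicE.
have [zQ|zQ] := pselect (Q z); first by rewrite !mem_set// mulr1.
by rewrite !memNset// mulr0 subr0 f0Q// normr0.
Qed.

End mollification_L1.

Global Instance ae_filter_st (R : realType) n : Filter (nbhs (almost_everywhere (@lebesgue_st R n))).
Proof. exact: ae_filter_ringOfSetsType. Qed.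

(** Either [y <= kap * x], and the first summand suffices, or [x < y / kap], and the second does.
    The constants are not sharp, but no conjugate exponent appears. *)
Lemma powR_young (R : realType) (x y kap r : R) : 0 <= x -> 0 <= y -> 0 < kap -> 1 <= r ->
  x `^ (r - 1) * y <= kap * x `^ r + kap `^ (1 - r) * y `^ r.
Proof.
move=> x0 y0 k0 r1.
have r1' : 0 <= r - 1 by rewrite subr_ge0.
have pow_split a : 0 <= a -> a `^ r = a `^ (r - 1) * a.
  by move=> a0; rewrite mulrC mulr_powRB1//; lra.
have [yx|xy] := leP y (kap * x).
  apply: (@le_trans _ _ (kap * x `^ r)); last by rewrite lerDl mulr_ge0// powR_ge0.
  by rewrite pow_split// mulrCA ler_wpM2l ?powR_ge0.
apply: (@le_trans _ _ (kap `^ (1 - r) * y `^ r)); last by rewrite lerDr mulr_ge0 ?powR_ge0// ltW.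
rewrite (pow_split y)// mulrA ler_wpM2r//.
have -> : kap `^ (1 - r) = (kap^-1) `^ (r - 1).
  by rewrite -powR_inv1 ?ltW// -powRrM; congr (_ `^ _); ring.
rewrite -powRM ?invr_ge0 ?(ltW k0)//.
apply: ge0_ler_powR; rewrite ?nnegrE ?mulr_ge0 ?invr_ge0 ?(ltW k0)//.
by rewrite ltW// ltr_pdivlMl.
Qed.

Section Rintegral_sum.
Context d (T : measurableType d) (R : realType) (mu : {measure set T -> \bar R}).

Lemma integrable_normR (f : T -> R) : mu.-integrable setT (EFin \o f) ->
  mu.-integrable setT (EFin \o (fun x => `|f x|)).
Proof. exact: integrable_norm. Qed.

Lemma integrable_sumR (I : Type) (r : seq I) (F : I -> T -> R) :
  (forall i, mu.-integrable setT (EFin \o F i)) ->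
  mu.-integrable setT (EFin \o (fun x => \sum_(i <- r) F i x)).
Proof.
move=> Fi; have := @integrable_sum _ _ _ mu setT measurableT I r xpredT (fun i => EFin \o F i) (fun i _ => Fi i).
by apply: eq_integrable => // x _; rewrite /= sumEFin.
Qed.

Lemma Rintegral_sum (I : Type) (r : seq I) (F : I -> T -> R) :
  (forall i, mu.-integrable setT (EFin \o F i)) ->
  \int[mu]_x (\sum_(i <- r) F i x) = \sum_(i <- r) \int[mu]_x F i x.
Proof.
move=> Fi; elim: r => [|i r IH].
  rewrite big_nil (_ : (fun x => _) = (fun=> 0)); last by apply/funext => x; rewrite big_nil.
  by rewrite /Rintegral integral0.
rewrite big_cons -IH -RintegralD//; last exact: integrable_sumR.
by apply: eq_Rintegral => x _; rewrite big_cons.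
Qed.

End Rintegral_sum.

Lemma cvg_sum0 (R : realType) (I : Type) (r : seq I) (u : I -> nat -> R) :
  (forall i, u i k @[k --> \oo] --> 0) -> \sum_(i <- r) u i k @[k --> \oo] --> 0.
Proof.
move=> H; elim: r => [|i r IH].
  by under eq_fun do rewrite big_nil; exact: cvg_cst.
rewrite (_ : (fun k => _) = (fun k => u i k + \sum_(j <- r) u j k)); last first.
  by apply/funext => k; rewrite big_cons.
by rewrite -[X in _ --> X](addr0 0); exact: cvgD.
Qed.

(** * Pointwise control of mollifications *)

Section domination.
Context {R : realType} {n : nat}.
Local Notation E := ('rV[R]_n * R)%type.
Local Notation mE := ('rV[R]_n * measurableTypeR R)%type.
Local Notation mu := (@lebesgue_st R n).
Local Notation L1 f := (mu.-integrable setT (EFin \o f)).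
Implicit Types (f g : E -> R) (N M e : R) (z w v : E) (k : nat).

(** The conclusion holds at every [z], not almost every one: a mollification shifted by a positive
    constant can then be raised to any real power smoothly. *)
Lemma mollify_ge0 k f z : {ae mu, forall w, 0 <= f w} -> L1 f -> 0 <= mollify k f z.
Proof.
move=> f0 fi; rewrite /mollify /convol /Rintegral; apply: fine_ge0.
have -> : (\int[mu]_w (moll k.+1%:R^-1 (z - w) * f w)%:E =
    \int[mu]_w (moll k.+1%:R^-1 (z - w) * `|f w|)%:E)%E.
  have mm := @measurable_reflect R n _ z (smooth_cont (@smooth_moll R n k.+1%:R^-1)).
  have mf := measurable_of_integrable fi.
  apply: ae_eq_integral => //.
  - by apply/measurable_EFinP; exact: measurable_funM.
  - by apply/measurable_EFinP; apply: measurable_funM => //; exact: measurableT_comp.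
  - by apply: filterS f0 => w fw _; rewrite ger0_norm.
by apply: integral_ge0 => w _; rewrite lee_fin mulr_ge0// moll_ge0.
Qed.

(** A Jensen inequality with a lossy constant, from Young's inequality with [kap = 1/2]: writing [m]
    for the norm of the average, averaging the bound on [m^(p-1)] times the norm of [f w] gives
    [m^p / 2] plus [2^(p-1)] times the average of the [p]-th powers, and the first term is
    absorbed. *)
Lemma mollify_Jensen k f p z : 1 <= p -> L1 f -> L1 (fun w => `|f w| `^ p) ->
  `|mollify k f z| `^ p <= 2 `^ p * mollify k (fun w => `|f w| `^ p) z.
Proof.
move=> p1 fi fpi; have e0 := @mollify_eps R k.
have [B HB] := @moll_bounded R n _ e0.
have cK := smooth_cont (@smooth_moll R n k.+1%:R^-1).
have ci := integrable_conv z cK HB fi.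
have cpi := integrable_conv z cK HB fpi.
set m := `|mollify k f z|; have m0 : 0 <= m by exact: normr_ge0.
have m1 : m <= \int[mu]_w (moll k.+1%:R^-1 (z - w) * `|f w|).
  apply: le_trans (le_normr_Rintegral measurableT ci) _.
  rewrite le_eqVlt; apply/orP; left; apply/eqP; apply: eq_Rintegral => w _.
  by rewrite normrM (ger0_norm (moll_ge0 _ _)).
have cni := @integrable_conv R n _ (fun w => `|f w|) z _ cK HB (integrable_normR fi).
have mi := @integrable_moll_reflect R n _ z e0.
have H : m `^ (p - 1) * m <= 2^-1 * m `^ p + 2^-1 `^ (1 - p) * mollify k (fun w => `|f w| `^ p) z.
  apply: le_trans (ler_wpM2l (powR_ge0 _ _) m1) _.
  rewrite -RintegralZl//.
  have -> : 2^-1 * m `^ p = \int[mu]_w (2^-1 * m `^ p * moll k.+1%:R^-1 (z - w)).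
    by rewrite RintegralZl// Rintegral_moll_reflect// mulr1.
  rewrite /mollify /convol -RintegralZl// -RintegralD//; last 2 first.
  - exact: integrableZR.
  - exact: integrableZR.
  apply: le_Rintegral => //.
  - exact: integrableZR.
  - by apply: integrableDR; exact: integrableZR.
  move=> w _; have := @powR_young R m `|f w| 2^-1 p m0 (normr_ge0 _) ltac:(lra) p1.
  by move=> /(ler_wpM2l (moll_ge0 k.+1%:R^-1 (z - w))); lra.
have mp : m `^ (p - 1) * m = m `^ p.
  by rewrite mulrC mulr_powRB1//; lra.
move: H; rewrite mp => H.
have -> : 2 `^ p = 2 * 2^-1 `^ (1 - p) :> R.
  rewrite -powR_inv1// -powRrM -{2}(@powRr1 _ 2)// -powRD; last by apply/implyP => _; rewrite pnatr_eq0.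
  by congr (_ `^ _); ring.
by rewrite -mulrA; lra.
Qed.

(* A subsequence with summable [L^1] errors converges almost everywhere and is
   dominated by the limit plus the sum of the errors. *)
Lemma mollify_dominated (J : finType) (f : J -> E -> R) N :
  (forall i, L1 (f i)) -> (forall i z, ~ cube N z -> f i z = 0) ->
  exists (phi : nat -> nat) (h : E -> R), [/\ forall k, (k <= phi k)%N, L1 h,
    {ae mu, forall z, forall i, mollify (phi k) (f i) z @[k --> \oo] --> f i z} &
    {ae mu, forall z k i, `|mollify (phi k) (f i) z| <= h z}].
Proof.
move=> fi f0.
pose S m z := \sum_i `|mollify m (f i) z - f i z|.
have di m i : L1 (fun z => mollify m (f i) z - f i z).
  by apply: integrableBR => //; exact: integrable_mollify.
have Si m : L1 (S m).
  by apply: integrable_sumR => i; exact: integrable_normR (di m i).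
have S0 m z : 0 <= S m z by apply: sumr_ge0 => i _.
have SE m : \int[mu]_z S m z = \sum_i L1norm (fun z => mollify m (f i) z - f i z).
  by rewrite Rintegral_sum// => i; exact: integrable_normR (di m i).
have Sc : \int[mu]_z S m z @[m --> \oo] --> 0.
  under eq_fun do rewrite SE.
  apply: cvg_sum0 => i.
  by have [] := @integrable_mollifiable _ _ (f i) N (fi i) (f0 i).
(* The errors at stage [k] are at most [2^-(k+1)], so that they sum to at most [1]; [k <= m] forces
   the scales of the subsequence to shrink. *)
have ephi k : exists m, (k <= m)%N /\ \int[mu]_z S m z <= 1 / (2 ^ k.+1)%:R.
  have : 0 < 1 / (2 ^ k.+1)%:R :> R by rewrite divr_gt0// ltr0n expn_gt0.
  move/cvgrPdist_le : Sc => H /H[m0 _ Hm].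
  exists (maxn k m0); split; first exact: leq_maxl.
  have := Hm _ (leq_maxr k m0); rewrite /= sub0r normrN ger0_norm//.
  by apply: Rintegral_ge0 => z _; exact: S0.
have [phi Hphi] := choice ephi.
pose G z : \bar R := (\sum_(k <oo) (S (phi k) z)%:E)%E.
have mS k : measurable_fun setT (fun z : mE => (S (phi k) z)%:E : \bar R).
  exact: measurable_int (Si (phi k)).
have G0 z : (0 <= G z)%E by apply: nneseries_ge0 => k _ _; rewrite lee_fin.
have mG : measurable_fun setT (G : mE -> \bar R).
  apply: ge0_emeasurable_sum => [k z _ _|k _]; last exact: mS.
  by rewrite lee_fin.
have Gi : mu.-integrable setT G.
  apply/integrableP; split => //.
  under eq_integral do rewrite gee0_abs//.
  rewrite /G integral_nneseries//; last by move=> k z _; rewrite lee_fin.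
  apply: (@le_lt_trans _ _ 1%E); last exact: ltry.
  apply: le_trans (epsilon_trick0 xpredT (@ler01 R)).
  apply: lee_nneseries => [k _ _|k _]; first by apply: integral_ge0 => z _; rewrite lee_fin.
  rewrite -[leLHS]fineK; last exact: integrable_fin_num (Si _).
  by rewrite lee_fin; exact: (Hphi k).2.
have Gfin := integrable_ae measurableT Gi.
pose h z := fine (G z) + \sum_i `|f i z|.
have Sle z k : G z \is a fin_num -> S (phi k) z <= fine (G z).
  move=> Gz; rewrite -lee_fin fineK//.
  apply: le_trans (nneseries_lim_ge k.+1 _); last by move=> j _ _; rewrite lee_fin.
  by rewrite big_nat_recr//= leeDr// sume_ge0// => j _; rewrite lee_fin.
have S1 z m i : `|mollify m (f i) z - f i z| <= S m z.
  by rewrite /S (bigD1 i)//= lerDl sumr_ge0.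
exists phi, h; split.
- by move=> k; exact: (Hphi k).1.
- apply: integrableDR; last by apply: integrable_sumR => i; exact: integrable_normR.
  apply: (le_integrable measurableT _ _ Gi) => [|z _].
    by apply/measurable_EFinP; exact: measurableT_comp mG.
  by rewrite /=; case: (G z) => [r||] //=; rewrite normr0 leey.
- apply: filterS Gfin => z /(_ I) Gz i.
  have Sc0 : S (phi k) z @[k --> \oo] --> 0.
    apply: cvg_series_cvg_0; apply: nondecreasing_is_cvgn.
      by apply: nondecreasing_series => j _ _; exact: S0.
    exists (fine (G z)) => _ [k _ <-].
    rewrite -lee_fin fineK// /series/= -sumEFin.
    by apply: nneseries_lim_ge => j _ _; rewrite lee_fin.
  apply/cvgrPdist_le => e e0; move/cvgrPdist_le : Sc0 => /(_ e e0).
  apply: filterS => k; rewrite sub0r normrN (ger0_norm (S0 _ _)).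
  by apply: le_trans; rewrite distrC; exact: S1.
- apply: filterS Gfin => z /(_ I) Gz k i.
  rewrite -(subrK (f i z) (mollify (phi k) (f i) z)) (le_trans (ler_normD _ _))// lerD//.
    exact: le_trans (S1 _ _ _) (Sle _ _ Gz).
  by rewrite (bigD1 i)//= lerDl sumr_ge0.
Qed.

End domination.

(** * The weak formulation for smooth test functions *)

Section admissible.
Context {R : realType} {n : nat}.
Local Notation E := ('rV[R]_n * R)%type.
Local Notation mE := ('rV[R]_n * measurableTypeR R)%type.
Local Notation mu := (@lebesgue_st R n).
Local Notation L1 f := (mu.-integrable setT (EFin \o f)).
Implicit Types (f g psi phi : E -> R) (N M e tau : R) (z w v : E) (k : nat).

Definition dirc (c : option 'I_n) : E := oapp (fun i => dir_x i) (dir_t n) c.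

Lemma co_dirc c c' : co c (dirc c') = (c == c')%:R.
Proof.
case: c => [i|]; case: c' => [j|] //=; rewrite !mxE//= ?eqxx//.
Qed.

Definition grad psi z : 'rV[R]_n := \row_i 'D_(dirc (Some i)) psi z.

(** The vanishing up to a positive time [tau] gives a zero trace at the initial time, kills the
    boundary term in time, and leaves room for mollification kernels inside the open half-space. *)
Definition admissible N tau psi := [/\ smooth psi, 0 < tau, forall z, 0 <= psi z,
  forall z, ~ cube N z -> psi z = 0 & forall z, z.2 <= tau -> psi z = 0].

Lemma closed_ge_time tau : closed [set z : E | tau <= z.2].
Proof.
have -> : [set z : E | tau <= z.2] = (co None) @^-1` [set x | tau <= x] by [].
apply: closed_comp; last exact: closed_ge.
by move=> z _; exact: continuous_co.
Qed.

Lemma derive_time_out psi tau v : (forall z, z.2 <= tau -> psi z = 0) ->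
  forall z, z.2 < tau -> 'D_v psi z = 0.
Proof.
move=> p0 z zt; apply: (@derive_out _ _ [set z | tau <= z.2] psi v) => //.
- by move=> w /= /negP; rewrite -ltNge => wt; apply: p0; exact: ltW.
- exact: closed_ge_time.
- by apply/negP; rewrite -ltNge.
Qed.

Lemma admissible_test N tau psi (U : set E) : admissible N tau psi -> @open_half_space R n `<=` U ->
  test_function U psi.
Proof.
move=> [sp t0 p0 pN pt] HU; split => //.
exists (cube N `&` [set z | tau <= z.2]); split.
- by apply: compact_closedI; [exact: compact_cube|exact: closed_ge_time].
- by move=> z [_ /= tz]; apply: HU; exact: lt_le_trans tz.
- move=> z nz; have [zN|/pN//] := pselect (cube N z).
  apply: pt; rewrite leNgt; apply/negP => tz; apply: nz; split => //; exact: ltW.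
Qed.

Definition half_cube N : set E := cube N `&` half_space (R := R) (n := n).

Lemma compact_half_cube N : compact (half_cube N).
Proof. by apply: compact_closedI; [exact: compact_cube|exact: closed_ge_time]. Qed.

Lemma patch_id (D : set E) f : (forall z, ~ D z -> f z = 0) -> f \_ D = f.
Proof.
move=> f0; apply/funext => z; rewrite patchE.
by have [Dz|Dz] := pselect (D z); [rewrite mem_set|rewrite memNset// f0].
Qed.

Lemma bounded_Lfun f M N (r : R) : measurable_fun setT (f : mE -> R) -> (forall z, `|f z| <= M) ->
  (forall z, ~ cube N z -> f z = 0) -> 0 < r -> f \in Lfun mu r%:E.
Proof.
move=> mf fM f0 r0; apply/andP; split; rewrite inE//=.
rewrite /finite_norm unlock; apply: poweR_lty.
have : L1 (fun z => `|f z| `^ r).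
  have mfr : measurable_fun setT ((fun z => `|f z| `^ r) : mE -> R).
    by apply: (measurableT_comp (measurable_powR _)); exact: measurableT_comp.
  apply: (@integrable_bounded_cube _ _ _ (M `^ r) N mfr).
    by move=> z /f0 ->; rewrite normr0 powR0// gt_eqF.
  move=> z; rewrite ger0_norm ?powR_ge0//; apply: ge0_ler_powR; rewrite ?nnegrE ?(ltW r0)//.
  exact: le_trans (fM z).
move=> /integrableP[_]; apply: le_lt_trans; rewrite le_eqVlt; apply/orP; left; apply/eqP.
by apply: eq_integral => z _; rewrite /= (ger0_norm (powR_ge0 _ _)).
Qed.

Lemma bounded_Lfun_oo f M : measurable_fun setT (f : mE -> R) -> (forall z, `|f z| <= M) ->
  f \in Lfun mu +oo%E.
Proof.
move=> mf fM; apply/andP; split; rewrite inE//=.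
rewrite /finite_norm unlock; case: ifP => // _.
apply: (@le_lt_trans _ _ M%:E); last exact: ltry.
by apply/ess_sup_inf.ess_supP; apply: aeW => z; rewrite /= lee_fin.
Qed.

Lemma smooth_weak_derivative psi N tau v : admissible N tau psi ->
  weak_derivative v psi (fun z => 'D_v psi z).
Proof.
move=> [sp t0 _ pN p0] phi [sphi _].
have D0 := derive_out v pN (@closed_cube _ _ N).
have sD := smooth_derive v sp; have sDphi := smooth_derive v sphi.
rewrite [LHS]Rintegral_mkcond [X in _ = - X]Rintegral_mkcond.
have psi0 z : ~ @open_half_space R n z -> psi z = 0.
  by rewrite /open_half_space/= => /negP; rewrite -leNgt => zt; apply: p0; apply: le_trans zt (ltW t0).
have Dpsi0 z : ~ @open_half_space R n z -> 'D_v psi z = 0.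
  rewrite /open_half_space/= => /negP; rewrite -leNgt => zt.
  exact: derive_time_out p0 _ (le_lt_trans zt t0).
rewrite (patch_id (f := fun z => psi z * 'D_v phi z)); last by move=> z /psi0 ->; rewrite mul0r.
rewrite (patch_id (f := fun z => 'D_v psi z * phi z)); last by move=> z /Dpsi0 ->; rewrite mul0r.
apply/eqP; rewrite -subr_eq0 opprK; apply/eqP.
have i1 : L1 (fun z => psi z * 'D_v phi z).
  apply: (@integrable_cont_cube _ _ _ N); last by move=> z /pN ->; rewrite mul0r.
  exact: smooth_cont (smoothM sp sDphi).
have i2 : L1 (fun z => 'D_v psi z * phi z).
  apply: (@integrable_cont_cube _ _ _ N); last by move=> z /D0 ->; rewrite mul0r.
  exact: smooth_cont (smoothM sD sphi).
rewrite -RintegralD//.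
have := @integral_derive0 _ _ (fun z => psi z * phi z) N v (smoothM sp sphi).
move=> <-; last by move=> z /pN ->; rewrite mul0r.
apply: eq_Rintegral => z _; rewrite deriveM; [|exact: smooth_derivable..].
by rewrite /GRing.scale/= (mulrC (phi z)).
Qed.

End admissible.

(** * Pointwise bounds on the fluxes *)

Section flux_bounds.
Context {R : realType} {n : nat}.
Implicit Types (v w : 'rV[R]_n) (r : R).

Lemma inner_ge0 v : 0 <= inner v v.
Proof. by apply: sumr_ge0 => i _; rewrite -expr2 sqr_ge0. Qed.

Lemma enorm_sq v : enorm v ^+ 2 = inner v v.
Proof. by rewrite /enorm sqr_sqrtr// inner_ge0. Qed.

Lemma enorm_ge0 v : 0 <= enorm v.
Proof. exact: sqrtr_ge0. Qed.

Lemma co_le_enorm v i : `|v ord0 i| <= enorm v.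
Proof.
rewrite -sqrtr_sqr ler_sqrt ?inner_ge0// /inner (bigD1 i)//= -expr2 lerDl.
by apply: sumr_ge0 => j _; rewrite -expr2 sqr_ge0.
Qed.

Lemma flux_le r v w : 1 < r -> `|flux r v w| <= enorm v `^ (r - 1) * \sum_i `|w ord0 i|.
Proof.
move=> r1; rewrite /flux normrM ger0_norm ?powR_ge0//.
have H : `|inner v w| <= enorm v * \sum_i `|w ord0 i|.
  apply: le_trans (ler_norm_sum _ _ _) _; rewrite mulr_sumr; apply: ler_sum => i _.
  by rewrite normrM ler_wpM2r// co_le_enorm.
apply: le_trans (ler_wpM2l (powR_ge0 _ _) H) _; rewrite mulrA ler_wpM2r ?sumr_ge0//.
(* The exponent [r - 2] may be negative, so the law of exponents needs a nonzero base. *)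
have [->|v0] := eqVneq (enorm v) 0; first by rewrite mulr0 powR_ge0.
rewrite -{2}(powRr1 (enorm_ge0 v)) -powRD; last by rewrite v0 implybT.
by rewrite (_ : r - 2 + 1 = r - 1)//; ring.
Qed.

Lemma flux_self r v : 0 < r -> flux r v v = enorm v `^ r.
Proof.
move=> r0; rewrite /flux -enorm_sq.
have [->|v0] := eqVneq (enorm v) 0; first by rewrite expr0n/= mulr0 powR0// gt_eqF.
rewrite -powR_mulrn ?enorm_ge0// -powRD; last by rewrite v0 implybT.
by rewrite subrK.
Qed.

Lemma fluxDr r v w w' : flux r v (w + w') = flux r v w + flux r v w'.
Proof.
rewrite /flux -mulrDr; congr (_ * _); rewrite /inner -big_split/=.
by apply: eq_bigr => i _; rewrite mxE mulrDr.
Qed.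

Lemma fluxZr r v a w : flux r v (a *: w) = a * flux r v w.
Proof.
rewrite /flux mulrCA; congr (_ * _); rewrite /inner mulr_sumr.
by apply: eq_bigr => i _; rewrite mxE mulrCA.
Qed.

Lemma flux0r r v : flux r v 0 = 0.
Proof. by rewrite -(scale0r (0 : 'rV[R]_n)) fluxZr mul0r. Qed.

(** The Euclidean norm is at most [n] times the largest component, whose [r]-th power is one of the
    summands; for [n = 0] there is no largest component. *)
Lemma enorm_powR_le r v : 0 < r ->
  enorm v `^ r <= n%:R `^ r * \sum_i `|v ord0 i| `^ r.
Proof.
move=> r0.
have H1 : enorm v <= \sum_i `|v ord0 i|.
  rewrite -[leRHS]ger0_norm ?sumr_ge0// -sqrtr_sqr ler_sqrt ?sqr_ge0//.
  rewrite expr2 mulr_suml; apply: ler_sum => i _.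
  apply: le_trans (ler_norm _) _; rewrite normrM ler_wpM2l//.
  by rewrite (bigD1 i)//= lerDl sumr_ge0.
have [n0|n0] := posnP n.
  have e0 : enorm v = 0.
    apply/eqP; rewrite eq_le enorm_ge0 andbT; apply: le_trans H1 _.
    by rewrite big1// => j _; have := ltn_ord j; rewrite [X in (_ < X)%N]n0.
  by rewrite e0 powR0 ?gt_eqF// mulr_ge0 ?powR_ge0// sumr_ge0// => i _; exact: powR_ge0.
pose i0 := Ordinal n0.
have [i _ Hi] := @Order.TotalTheory.arg_maxP _ _ _ i0 xpredT (fun i => `|v ord0 i|) isT.
have H2 : enorm v <= n%:R * `|v ord0 i|.
  apply: le_trans H1 _; apply: (@le_trans _ _ (\sum_(j < n) `|v ord0 i|)).
    by apply: ler_sum => j _; exact: Hi.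
  by rewrite sumr_const card_ord mulr_natl.
apply: (@le_trans _ _ ((n%:R * `|v ord0 i|) `^ r)).
  by apply: ge0_ler_powR; rewrite ?nnegrE ?(ltW r0) ?enorm_ge0 ?mulr_ge0.
by rewrite powRM// ler_wpM2l ?powR_ge0// (bigD1 i)//= lerDl sumr_ge0// => j _.
Qed.

Lemma measurable_enorm : measurable_fun setT (@enorm R n).
Proof.
have ms : measurable_fun setT (@Num.sqrt R).
  by apply: continuous_measurable_fun; exact: sqrt_continuous.
have mi : measurable_fun setT (fun v : 'rV[R]_n => inner v v).
  rewrite (_ : (fun v => inner v v) = (fun v => \sum_i (v ord0 i * v ord0 i)))//.
  apply: measurable_sum => i; apply: measurable_funM; exact: measurable_coord.
exact: measurableT_comp ms mi.
Qed.

Lemma measurable_flux d (T : measurableType d) r (f g : T -> 'rV[R]_n) :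
  measurable_fun setT f -> (forall i, measurable_fun setT (fun x => g x ord0 i)) ->
  measurable_fun setT (fun x => flux r (f x) (g x)).
Proof.
move=> mf mg; apply: measurable_funM.
  by apply: (measurableT_comp (measurable_powR _)); exact: measurableT_comp measurable_enorm mf.
rewrite (_ : (fun x => inner (f x) (g x)) = (fun x => \sum_i (f x ord0 i * g x ord0 i)))//.
apply: measurable_sum => i; apply: measurable_funM => //.
exact: measurableT_comp (@measurable_coord _ _ i) mf.
Qed.

End flux_bounds.

Lemma powR_le1D (R : realType) (x a b : R) : 0 <= x -> 0 <= a -> a <= b -> x `^ a <= 1 + x `^ b.
Proof.
move=> x0 a0 ab; have [x1|x1] := leP x 1.
  apply: (@le_trans _ _ 1); last by rewrite lerDl powR_ge0.
  apply: (@le_trans _ _ (1 `^ a)); last by rewrite powR1.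
  by apply: ge0_ler_powR; rewrite ?nnegrE.
apply: (@le_trans _ _ (x `^ b)); last by rewrite lerDr.
by rewrite ler_powR// ltW.
Qed.

Section reflected.
Context {R : realType} {n : nat}.
Local Notation E := ('rV[R]_n * R)%type.
Implicit Types (K : E -> R) (z w v : E).

Lemma is_derive_reflect K z w v : smooth K ->
  is_derive w v (fun w => K (z - w)) (- 'D_v K (z - w)).
Proof.
move=> sK.
suff H : (fun h : R => h^-1 *: (((fun w => K (z - w)) \o shift w) (h *: v) - K (z - w))) @ 0^' -->
    - 'D_v K (z - w).
  by apply: DeriveDef; [apply/cvg_ex; eexists; exact: H|exact/cvg_lim].
apply/cvgr_dnbhsP => h [h0 hc].
have hN0 k : - h k != 0 by rewrite oppr_eq0.
have hNc : - h k @[k --> \oo] --> 0 by rewrite -[X in _ --> X]oppr0; exact: cvgN.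
have H := @smooth_cvg_quotient _ _ K (z - w) v (fun k => - h k) sK hN0 hNc.
apply: (@cvg_trans _ ((fun k => - ((- h k)^-1 * (K (z - w + - h k *: v) - K (z - w)))) @ \oo)); last exact: cvgN.
apply: near_eq_cvg; apply: nearW => k.
rewrite /= -[RHS]/(_ * _) invrN mulNr opprK.
by rewrite (_ : z - w + - h k *: v = z - (h k *: v + w))// scaleNr -addrA -opprD (addrC w).
Qed.

Lemma smooth_reflect K z : smooth K -> smooth (fun w => K (z - w)).
Proof.
move=> sK; apply/smoothP => k; elim: k K sK => [|k IH] K sK.
  split => // w; apply: (@continuous_comp _ _ _ (fun w => z - w) K); last exact: smooth_cont.
  by apply: cvgB; [exact: cvg_cst|exact: cvg_id].
split; first exact: Ck_le_cont (IH K sK).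
split=> [w v|v]; first by have [] := is_derive_reflect z w v sK.
apply: (@Ck_le_ext _ _ _ _ (fun w => (-1) * 'D_v K (z - w))).
  by move=> w; have [_ ->] := is_derive_reflect z w v sK; rewrite mulN1r.
by apply: Ck_leM; [exact: Ck_le_cst|exact: IH (smooth_derive v sK)].
Qed.

End reflected.

(** * Truncation of the solution to a half cube *)

Section truncated.
Context {R : realType} {n : nat}.
Local Notation E := ('rV[R]_n * R)%type.
Local Notation mE := ('rV[R]_n * measurableTypeR R)%type.
Local Notation mu := (@lebesgue_st R n).
Local Notation L1 f := (mu.-integrable setT (EFin \o f)).
Implicit Types (f g psi phi : E -> R) (M e tau : R) (z w v : E) (k : nat).

Lemma Rintegral_open_half f g : (forall z, ~ open_half_space z -> g z = 0) ->
  (forall z, open_half_space z -> f z = g z) ->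
  \int[mu]_(z in open_half_space (n := n)) f z = \int[mu]_z g z.
Proof.
move=> g0 fg; rewrite Rintegral_mkcond; apply: eq_Rintegral => z _; rewrite patchE.
have [hz|hz] := pselect (open_half_space z); first by rewrite mem_set// fg.
by rewrite memNset// g0.
Qed.

(** On a set of finite measure [L^r] lies in [L^1], because [x <= 1 + x^r]. *)
Lemma Lp_loc_integrable r f N : 1 <= r -> Lp_loc r%:E f ->
  L1 (f \_ (half_cube N)) /\ L1 (fun z => `|(f \_ (half_cube N)) z| `^ r).
Proof.
move=> r1 Hf.
have Lf : (f \_ (half_cube N)) \in Lfun mu r%:E.
  by apply: Hf; [exact: compact_half_cube|move=> z []].
have i2 := Lfun_integrable r1 Lf.
have mf : measurable_fun setT ((f \_ (half_cube N)) : mE -> R).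
  by move: Lf => /andP[]; rewrite inE.
split; last exact: i2.
apply: (@le_integrableR _ _ _ mu _ (fun z => 1 * \1_(cube N) z + `|(f \_ (half_cube N)) z| `^ r)) => //.
  move=> z; rewrite patchE indicE.
  have [[Nz hz]|Wz] := pselect (half_cube N z).
    rewrite !mem_set// mulr1 -[leLHS]powRr1//; apply: powR_le1D => //.
  by rewrite (memNset Wz) normr0 addr_ge0 ?powR_ge0// mulr_ge0.
by apply: integrableDR => //; exact: integrable_cube.
Qed.

Variables (p q s : R) (u0 : 'rV[R]_n -> R) (u : E -> R) (Du : E -> 'rV[R]_n) (ut : E -> R).
Hypotheses (q_gt1 : 1 < q) (le_qp : q <= p) (s_gt1 : 1 < s).
Hypotheses (u_Ls : Lp_loc s%:E u) (u_ge0 : nonneg_ae u) (u_W1p : W1p_loc p u Du ut).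
Hypothesis u_weak : forall psi Dpsi psit (psi0 : 'rV[R]_n -> R),
  W1p p psi Dpsi psit -> Lp +oo%E (half_space (n := n)) psi ->
  nonneg_ae psi -> compact_support psi -> trace0 p psi Dpsi psit psi0 ->
  weak_inequality p q s u0 u Du psi Dpsi psit psi0.
Variable N : R.

Let p_gt1 : 1 < p. Proof. exact: lt_le_trans le_qp. Qed.

Definition DU (c : option 'I_n) z : R := oapp (fun i => Du z ord0 i) (ut z) c.

Local Notation uW := (u \_ (half_cube N)).
Local Notation gW c := ((DU c) \_ (half_cube N)).
Definition GW z : 'rV[R]_n := \row_i gW (Some i) z.

Lemma Lp_loc_DU c : Lp_loc p%:E (DU c).
Proof.
have [_ H1 [H2 _]] := u_W1p.
by case: c => [i|]; [have [] := H1 i|].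
Qed.

Lemma weak_derivative_DU c : weak_derivative (dirc c) u (DU c).
Proof.
have [_ H1 [_ H2]] := u_W1p.
by case: c => [i|]; [have [] := H1 i|].
Qed.

Lemma integrable_uW : L1 uW.
Proof. by have [] := Lp_loc_integrable N (ltW s_gt1) u_Ls. Qed.

Lemma integrable_uWs : L1 (fun z => uW z `^ s).
Proof.
have [_ H] := Lp_loc_integrable N (ltW s_gt1) u_Ls.
have mu_ := measurable_of_integrable integrable_uW.
apply: (@le_integrableR _ _ _ mu _ (fun z => 1 * \1_(cube N) z + `|uW z| `^ s)).
- exact: (measurableT_comp (measurable_powR _) mu_).
- move=> z; rewrite ger0_norm ?powR_ge0// indicE patchE.
  have [[Nz hz]|Wz] := pselect (half_cube N z); last first.
    rewrite (memNset Wz) normr0 powR0 ?addr0 ?mul1r// gt_eqF//.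
    exact: lt_trans s_gt1.
  rewrite !mem_set// mulr1.
  have [u0_|u0_] := leP 0 (u z); first by rewrite ger0_norm// lerDr.
  (* A negative base has power [1] by convention, which the indicator in the dominating function
     covers. *)
  by rewrite lt0_powR1// lerDl powR_ge0.
- by apply: integrableDR => //; exact: integrable_cube.
Qed.

Lemma integrable_gW c : L1 (gW c).
Proof. by have [] := Lp_loc_integrable N (ltW p_gt1) (Lp_loc_DU c). Qed.

Lemma integrable_gWp c : L1 (fun z => `|gW c z| `^ p).
Proof. by have [] := Lp_loc_integrable N (ltW p_gt1) (Lp_loc_DU c). Qed.

Lemma measurable_GW : measurable_fun setT (GW : mE -> 'rV[R]_n).
Proof.
apply: measurable_fun_rV => i; under eq_fun do rewrite mxE.
exact: measurable_of_integrable (integrable_gW (Some i)).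
Qed.

Lemma integrable_enormp : L1 (fun z => enorm (GW z) `^ p).
Proof.
apply: (@le_integrableR _ _ _ mu _ (fun z => n%:R `^ p * \sum_i `|gW (Some i) z| `^ p)).
- apply: (measurableT_comp (measurable_powR _)).
  exact: measurableT_comp measurable_enorm measurable_GW.
- move=> z; rewrite ger0_norm ?powR_ge0//.
  apply: le_trans (enorm_powR_le _ _) _; first exact: lt_trans p_gt1.
  by rewrite le_eqVlt; apply/orP; left; apply/eqP; congr (_ * _); apply: eq_bigr => i _; rewrite mxE.
- by apply: integrableZR; apply: integrable_sumR => i; exact: integrable_gWp.
Qed.

Lemma uW_ge0 : {ae mu, forall z, 0 <= uW z}.
Proof.
apply: filterS u_ge0 => z Hz; rewrite patchE.
by case: ifPn => // /set_mem[_ hz]; exact: Hz.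
Qed.

Lemma uW_out z : ~ cube N z -> uW z = 0.
Proof. by move=> Nz; rewrite patchE memNset// => -[]. Qed.

Lemma gW_out c z : ~ cube N z -> gW c z = 0.
Proof. by move=> Nz; rewrite patchE memNset// => -[]. Qed.

Lemma integrable_flux r (w : E -> 'rV[R]_n) M : 1 < r -> r <= p ->
  (forall i, measurable_fun setT ((fun z => w z ord0 i) : mE -> R)) ->
  (forall z, ~ cube N z -> w z = 0) -> (forall z i, `|w z ord0 i| <= M) ->
  L1 (fun z => flux r (GW z) (w z)).
Proof.
move=> r1 rp mw w0 wM.
apply: (@le_integrableR _ _ _ mu _ (fun z => (M * n%:R) * \1_(cube N) z + (M * n%:R) * enorm (GW z) `^ p)).
- apply: measurable_flux => //; exact: measurable_GW.
- move=> z; have [Nz|Nz] := pselect (cube N z); last first.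
    rewrite w0// flux0r normr0.
    (* When [n = 0] the bound on [w] is vacuous and [M] may be negative. *)
    have Mn0 : 0 <= M * n%:R.
      have [n0|n0] := posnP n; first by rewrite (_ : n%:R = 0 :> R) ?mulr0// n0.
      by rewrite mulr_ge0//; exact: le_trans (wM z (Ordinal n0)).
    by rewrite addr_ge0// mulr_ge0 ?powR_ge0.
  rewrite indicE mem_set// mulr1 -[X in _ <= X + _]mulr1 -mulrDr.
  apply: le_trans (flux_le _ _ r1) _; rewrite mulrC ler_pM ?sumr_ge0 ?powR_ge0//.
    apply: (@le_trans _ _ (\sum_(i < n) M)); first by apply: ler_sum.
    by rewrite sumr_const card_ord mulr_natr.
  apply: powR_le1D; [exact: enorm_ge0|lra|lra].
- apply: integrableDR; first exact: integrable_cube.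
  by apply: integrableZR; exact: integrable_enormp.
Qed.

(** Truncation makes the local functions integrable on the whole space. The truncated gradient is
    not the gradient of the truncated function, but test functions supported in the cube after time
    [tau] do not see the difference. *)
Lemma truncate_eq f tau psi z : (forall z, ~ cube N z -> psi z = 0) ->
  0 < tau -> (forall z, z.2 < tau -> psi z = 0) -> (f \_ (half_cube N)) z * psi z = f z * psi z.
Proof.
move=> pN t0 pt; have [Nz|Nz] := pselect (cube N z); last by rewrite pN// !mulr0.
have [zt|zt] := ltP z.2 tau; first by rewrite pt// !mulr0.
rewrite patchE mem_set//; split => //; exact: ltW (lt_le_trans t0 zt).
Qed.

Lemma admissible_W1p tau psi : admissible N tau psi -> W1p p psi (grad psi) (fun z => 'D_(dirc None) psi z).
Proof.
move=> adm; have [sp t0 p0 pN pt] := adm.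
have half0 (f : E -> R) : (forall z, z.2 < tau -> f z = 0) -> forall z, ~ half_space z -> f z = 0.
  by move=> H z /negP; rewrite -ltNge => z0; apply: H; exact: lt_trans t0.
have LpS f : smooth f -> (forall z, ~ cube N z -> f z = 0) -> (forall z, z.2 < tau -> f z = 0) ->
    Lp p%:E (half_space (n := n)) f.
  move=> sf fN ft; rewrite /Lp (patch_id (half0 _ ft)).
  have [M _ HM] := cube_bounded (smooth_cont sf) fN.
  by apply: (bounded_Lfun (continuous_measurable_st (smooth_cont sf)) HM fN); exact: lt_trans p_gt1.
have LpD v : Lp p%:E (half_space (n := n)) (fun z => 'D_v psi z).
  apply: LpS; [exact: smooth_derive|exact: derive_out pN (@closed_cube _ _ N)|].
  exact: derive_time_out.
have gradE i : (fun z => grad psi z ord0 i) = (fun z => 'D_(dirc (Some i)) psi z).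
  by apply/funext => z; rewrite mxE.
split.
- by apply: LpS => // z zt; apply: pt; exact: ltW.
- by move=> i; rewrite gradE; split; [exact: LpD|exact: smooth_weak_derivative adm].
- by split; [exact: LpD|exact: smooth_weak_derivative adm].
Qed.

(** Such a function is smooth with compact support in the whole space, so the constant sequence
    approximates it, and its restriction to the initial time is zero. The initial datum thus
    disappears from the inequality. *)
Lemma admissible_trace0 tau psi : admissible N tau psi ->
  trace0 p psi (grad psi) (fun z => 'D_(dirc None) psi z) (fun=> 0).
Proof.
move=> adm; have [sp t0 p0 pN pt] := adm.
have N0 d (T : measurableType d) (m : {measure set T -> \bar R}) : Lnorm m p%:E (fun=> 0%E) = 0%E.
  by apply: Lnorm0; rewrite eqe gt_eqF//; exact: lt_trans p_gt1.
have cvg0 f : Lp_cvg p (fun=> f) f.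
  rewrite /Lp_cvg (_ : (fun k : nat => _) = (fun=> 0%E)); first exact: cvg_cst.
  apply/funext => k; rewrite (_ : EFin \o _ = (fun=> 0%E)) ?N0//.
  by apply/funext => z; rewrite /= patchE; case: ifP => //; rewrite /= subrr.
split.
  apply/andP; split; rewrite inE//=.
  by rewrite /finite_norm (_ : EFin \o _ = (fun=> 0%E)) ?N0.
exists (fun=> psi); split.
- by move=> k; apply: admissible_test adm _ => z.
- exact: cvg0.
- move=> i; rewrite (_ : (fun z => grad psi z ord0 i) = (fun z => 'D_(dirc (Some i)) psi z)).
    exact: cvg0.
  by apply/funext => z; rewrite mxE.
- exact: cvg0.
- rewrite (_ : (fun k : nat => _) = (fun=> 0%E)); first exact: cvg_cst.
  apply/funext => k; rewrite (_ : EFin \o _ = (fun=> 0%E)) ?N0//.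
  by apply/funext => x; rewrite /= subr0 pt//= ltW.
Qed.

(** The time derivative sits on the solution, as the weak derivative [gW None]; only [psi] and its
    spatial gradient remain, so [psi] may later contain the solution itself. *)
Definition weak_integrand psi z : R :=
  - (gW None z * psi z) + uW z `^ s * psi z
  - (flux p (GW z) (grad psi z) + flux q (GW z) (grad psi z)).

Lemma truncated_inequality tau psi : admissible N tau psi ->
  L1 (weak_integrand psi) /\ \int[mu]_z weak_integrand psi z <= 0.
Proof.
move=> adm; have [sp t0 p0 pN pt] := adm.
have pt' z : z.2 < tau -> psi z = 0 by move=> zt; apply: pt; exact: ltW.
have DN v := derive_out v pN (@closed_cube _ _ N).
have Dt v := derive_time_out v pt.
have gradN z : ~ cube N z -> grad psi z = 0.
  by move=> Nz; apply/rowP => i; rewrite !mxE DN.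
have gradt z : z.2 < tau -> grad psi z = 0.
  by move=> zt; apply/rowP => i; rewrite !mxE Dt.
have bound f : smooth f -> (forall z, ~ cube N z -> f z = 0) -> exists M, forall z, `|f z| <= M.
  by move=> sf f0; have [M _ HM] := cube_bounded (smooth_cont sf) f0; exists M.
have [M0 HM0] := bound _ sp pN.
have [Mt HMt] := bound _ (smooth_derive (dirc None) sp) (DN _).
have mpsi := continuous_measurable_st (smooth_cont sp).
have mDpsi v := continuous_measurable_st (smooth_cont (smooth_derive v sp)).
have [Mx HMx] : exists M, forall z i, `|grad psi z ord0 i| <= M.
  have /choice[M HM] : forall i, exists M, forall z, `|'D_(dirc (Some i)) psi z| <= M.
    by move=> i; apply: bound; [exact: smooth_derive|exact: DN].
  exists (\sum_i `|M i|) => z i; rewrite mxE (le_trans (HM i z))// (le_trans (ler_norm _))//.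
  by rewrite (bigD1 i)//= lerDl sumr_ge0.
have mgrad i : measurable_fun setT ((fun z => grad psi z ord0 i) : mE -> R).
  by under eq_fun do rewrite mxE; exact: mDpsi.
have i1 : L1 (fun z => uW z * 'D_(dirc None) psi z).
  by under eq_fun do rewrite mulrC; exact: integrableMbR integrable_uW (mDpsi _) HMt.
have i2 : L1 (fun z => gW None z * psi z).
  by under eq_fun do rewrite mulrC; exact: integrableMbR (integrable_gW None) mpsi HM0.
have i3 : L1 (fun z => uW z `^ s * psi z).
  by under eq_fun do rewrite mulrC; exact: integrableMbR integrable_uWs mpsi HM0.
have i4 := integrable_flux p_gt1 (lexx p) mgrad gradN HMx.
have i5 := integrable_flux q_gt1 le_qp mgrad gradN HMx.
have toT (f g : E -> R) : (forall z, ~ half_space z -> f z = 0) -> f =1 g ->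
    (\int[mu]_(z in half_space (n := n)) (f z)%:E = \int[mu]_z (g z)%:E)%E.
  move=> f0 fg; rewrite integral_mkcond; apply: eq_integral => z _; rewrite patchE -fg.
  have [hz|hz] := pselect (half_space z); first by rewrite mem_set.
  by rewrite memNset// f0.
have halfN z : ~ half_space z -> z.2 < tau.
  by move=> /negP; rewrite -ltNge => z0; exact: lt_trans t0.
have fluxE r z : flux r (Du z) (grad psi z) = flux r (GW z) (grad psi z).
  have [Wz|Wz] := pselect (half_cube N z).
    congr (flux r _ _); apply/rowP => i; rewrite mxE patchE mem_set//.
  have -> : grad psi z = 0.
    have [Nz|Nz] := pselect (cube N z); last exact: gradN.
    by apply: gradt; apply: halfN => hz; apply: Wz.
  by rewrite !flux0r.
(* Integration by parts in time is the definition of the weak time derivative; there is no boundary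
   term, since [psi] vanishes up to time [tau]. *)
have e1 : (\int[mu]_(z in half_space (n := n)) (u z * 'D_(dirc None) psi z)%:E =
    (- \int[mu]_z (gW None z * psi z))%:E)%E.
  rewrite (toT _ (fun z => uW z * 'D_(dirc None) psi z)); last 2 first.
  - by move=> z /halfN zt; rewrite Dt// mulr0.
  - by move=> z; rewrite (truncate_eq u z (DN _) t0 (Dt _)).
  rewrite -[LHS]fineK; last exact: integrable_fin_num i1.
  congr EFin.
  have := weak_derivative_DU None (admissible_test adm (fun z hz => hz)).
  rewrite (@Rintegral_open_half _ (fun z => uW z * 'D_(dirc None) psi z)); last 2 first.
  - move=> z /negP; rewrite -leNgt => hz; rewrite Dt ?mulr0//; exact: le_lt_trans t0.
  - by move=> z _; rewrite (truncate_eq u z (DN _) t0 (Dt _)).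
  rewrite (@Rintegral_open_half _ (fun z => gW None z * psi z))//.
  - move=> z /negP; rewrite -leNgt => hz; rewrite pt ?mulr0//; exact: le_trans (ltW t0).
  - by move=> z _; rewrite (truncate_eq (DU None) z pN t0 pt').
have e2 : (\int[lebesgue_rV n]_x (u0 x * 0)%:E = 0)%E.
  by under eq_integral do rewrite mulr0; rewrite integral0.
have e3 : (\int[mu]_(z in half_space (n := n)) (u z `^ s * psi z)%:E =
    (\int[mu]_z (uW z `^ s * psi z))%:E)%E.
  rewrite (toT _ (fun z => uW z `^ s * psi z)); last 2 first.
  - by move=> z /halfN zt; rewrite pt' ?mulr0.
  - move=> z; have [Wz|Wz] := pselect (half_cube N z); first by rewrite patchE mem_set.
    have -> : psi z = 0; last by rewrite !mulr0.
    have [Nz|Nz] := pselect (cube N z); last exact: pN.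
    by apply: pt'; apply: halfN => hz; apply: Wz.
  by rewrite -[LHS]fineK; last exact: integrable_fin_num i3.
have e4 r : L1 (fun z => flux r (GW z) (grad psi z)) ->
    (\int[mu]_(z in half_space (n := n)) (flux r (Du z) (grad psi z))%:E =
    (\int[mu]_z (flux r (GW z) (grad psi z)))%:E)%E.
  move=> i; rewrite (toT _ (fun z => flux r (GW z) (grad psi z))).
  - by rewrite -[LHS]fineK; last exact: integrable_fin_num i.
  - by move=> z /halfN zt; rewrite gradt// flux0r.
  - by move=> z; exact: fluxE.
have : weak_inequality p q s u0 u Du psi (grad psi) (fun z => 'D_(dirc None) psi z) (fun=> 0).
  apply: u_weak.
  - exact: admissible_W1p adm.
  - rewrite /Lp patch_id; first exact: bounded_Lfun_oo mpsi HM0.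
    by move=> z /halfN; exact: pt'.
  - by apply: aeW => z _; exact: p0.
  - exists (half_cube N); split; [exact: compact_half_cube|by move=> z []|].
    apply: aeW => z hz nW; apply: pN => Nz; exact: nW.
  - exact: admissible_trace0 adm.
rewrite /weak_inequality e1 e2 e3 !e4// adde0 -!EFinD lee_fin => H.
have j1 : L1 (fun z => - (gW None z * psi z) + uW z `^ s * psi z).
  by apply: integrableDR => //; exact: integrableNR.
have j2 : L1 (fun z => flux p (GW z) (grad psi z) + flux q (GW z) (grad psi z)).
  exact: integrableDR.
split; first exact: integrableBR j1 j2.
rewrite /weak_integrand RintegralB//.
rewrite [X in X - _]RintegralD//; last exact: integrableNR.
rewrite [X in _ - X]RintegralD// subr_le0 (le_trans _ H)//.
rewrite lerD2r -mulN1r -RintegralZl// le_eqVlt; apply/orP; left; apply/eqP.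
by apply: eq_Rintegral => z _; rewrite mulN1r.
Qed.

(** For [z] at distance [1] from the boundary of the cube and at a time later than the scale of the
    kernel, the reflected kernel [w |-> K (z - w)] is a test function supported in the truncation
    region. Reflection changes the sign of its derivative, which cancels the sign in the definition
    of the weak derivative. *)
Lemma derive_mollify_uW k c z tau : cube (N - 1) z -> tau <= z.2 -> k.+1%:R^-1 < tau ->
  'D_(dirc c) (mollify k uW) z = mollify k (gW c) z.
Proof.
move=> Nz tz ktau; have e0 := @mollify_eps R k.
have e1 : k.+1%:R^-1 <= 1 :> R by rewrite invf_le1// ler1n.
have sm := @smooth_moll R n k.+1%:R^-1.
have m0 := fun w => @moll_cube R n _ w e0.
have [_ ->] := is_derive_conv z (dirc c) sm m0 integrable_uW.
set K := moll k.+1%:R^-1 in sm m0 *.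
pose C := cube N `&` [set w : E | z.2 - k.+1%:R^-1 <= w.2].
have cC : compact C.
  by apply: compact_closedI; [exact: compact_cube|exact: closed_ge_time].
have K0 w : ~ C w -> K (z - w) = 0.
  move=> nC; apply/eqP/negPn/negP => /moll_neq0 H; apply: nC; split.
    move=> c'; have /andP[H1 H2] := H c'; have H3 := lt_le_trans H2 e1.
    have := Nz c'; move: H1 H3; rewrite coB !ler_norml => ? ? /andP[? ?].
    by apply/andP; split; lra.
  by have := H None; rewrite coB /= => /andP[_ /ltW]; rewrite lerBlDr addrC -lerBlDr.
have clC : closed C by apply: compact_closed cC; exact: (@norm_hausdorff R ('rV[R]_n * R)%type).
have CW w : C w -> half_cube N w /\ open_half_space w.
  move=> [Nw /= tw]; have w0 : 0 < w.2.
    by apply: lt_le_trans tw; rewrite subr_gt0; exact: lt_le_trans tz.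
  by split => //; split => //; exact: ltW.
have testK : test_function (@open_half_space R n) (fun w => K (z - w)).
  by split; [exact: smooth_reflect|exists C; split => // w /CW[]].
have DK w v : 'D_v (fun w => K (z - w)) w = - 'D_v K (z - w).
  by have [] := is_derive_reflect z w v sm.
have DK0 w v : ~ C w -> 'D_v K (z - w) = 0.
  move=> nC; apply/eqP; rewrite -oppr_eq0 -DK; apply/eqP.
  exact: derive_out K0 clC w nC.
have := weak_derivative_DU c testK.
rewrite (@Rintegral_open_half _ (fun w => (-1) * ('D_(dirc c) K (z - w) * uW w))); last 2 first.
- move=> w hw; rewrite DK0 ?mul0r ?mulr0// => /CW[_]; exact: hw.
- move=> w hw; have [Cw|Cw] := pselect (C w); last by rewrite DK DK0// oppr0 mulr0 mul0r mulr0.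
  by have [Ww _] := CW w Cw; rewrite DK patchE mem_set//; ring.
rewrite (@Rintegral_open_half _ (fun w => K (z - w) * gW c w)); last 2 first.
- move=> w hw; rewrite K0 ?mul0r// => /CW[_]; exact: hw.
- move=> w hw; have [Cw|Cw] := pselect (C w); last by rewrite K0// mulr0 mul0r.
  by have [Ww _] := CW w Cw; rewrite patchE mem_set// mulrC.
rewrite RintegralZl//.
  by rewrite mulN1r => /oppr_inj.
have sD := smooth_derive (dirc c) sm.
have [M _ HM] := cube_bounded (smooth_cont sD) (derive_out (dirc c) m0 (@closed_cube _ _ _)).
have H := @integrable_conv _ _ (fun w => 'D_(dirc c) K w) uW z M (smooth_cont sD) HM integrable_uW.
exact: H.
Qed.

End truncated.

(** * Nonlinear test functions *)

Section nonlinear_test.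
Context {R : realType} {n : nat}.
Local Notation E := ('rV[R]_n * R)%type.
Local Notation mE := ('rV[R]_n * measurableTypeR R)%type.
Local Notation mu := (@lebesgue_st R n).
Local Notation L1 f := (mu.-integrable setT (EFin \o f)).
Implicit Types (f psi phi : E -> R) (M e tau : R) (z w v : E) (k : nat).

Definition rowg (g : option 'I_n -> E -> R) z : 'rV[R]_n := \row_i g (Some i) z.

(* What the weak formulation says about the restrictions [U] of [u] and [g] of
   its weak derivatives to the half cube [half_cube N]. *)
Record local_solution (p q s N : R) (U : E -> R) (g : option 'I_n -> E -> R) : Prop := {
  ls_U : L1 U;
  ls_Us : L1 (fun z => U z `^ s);
  ls_g : forall c, L1 (g c);
  ls_gp : forall c, L1 (fun z => `|g c z| `^ p);
  ls_ep : L1 (fun z => enorm (rowg g z) `^ p);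
  ls_U0 : {ae mu, forall z, 0 <= U z};
  ls_Uout : forall z, ~ cube N z -> U z = 0;
  ls_gout : forall c z, ~ cube N z -> g c z = 0;
  ls_dcm : forall k c z tau, cube (N - 1) z -> tau <= z.2 -> k.+1%:R^-1 < tau ->
    'D_(dirc c) (mollify k U) z = mollify k (g c) z;
  ls_ineq : forall tau psi, admissible N tau psi ->
    \int[mu]_z (- (g None z * psi z) + U z `^ s * psi z
      - (flux p (rowg g z) (grad psi z) + flux q (rowg g z) (grad psi z))) <= 0 }.

Variables (p q s N : R) (U : E -> R) (g : option 'I_n -> E -> R).
Hypotheses (q_gt1 : 1 < q) (le_qp : q <= p).
Hypothesis sol : local_solution p q s N U g.
Variables (al de La : R).
Hypotheses (al_gt0 : 0 < al) (al_lt1 : al < 1) (de_gt0 : 0 < de) (La_ge0 : 0 <= La).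

(* The test functions are [weight v * phi]. *)
Definition weight (y : R) : R := 1 + La * y `^ (- al).
Definition weight' (y : R) : R := - (La * al * y `^ (- al - 1)).
(** The primitive of [weight] with value [0] at the origin, hence nonnegative for positive
    arguments; the sign argument for the time cutoff needs this. *)
Definition weight_int (y : R) : R := y + La / (1 - al) * y `^ (1 - al).

Lemma weight_ge1 y : 1 <= weight y.
Proof. by rewrite lerDl mulr_ge0// powR_ge0. Qed.

Lemma powRN_le y a : 0 <= a -> de <= y -> y `^ (- a) <= de `^ (- a).
Proof.
move=> a0 dy; rewrite !powRN lef_pV2 ?posrE ?powR_gt0//; last exact: lt_le_trans dy.
by apply: ge0_ler_powR; rewrite ?nnegrE ?(ltW de_gt0)// (le_trans _ dy)// ltW.
Qed.

Lemma weight_le y : de <= y -> weight y <= weight de.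
Proof. by move=> dy; rewrite lerD2l ler_wpM2l// powRN_le// ltW. Qed.

Lemma weight'_le y : de <= y -> `|weight' y| <= `|weight' de|.
Proof.
move=> dy; rewrite /weight' !normrN !normrM !(ger0_norm (powR_ge0 _ _)) ler_wpM2l//.
by rewrite -opprD powRN_le// addr_ge0// ltW.
Qed.

Lemma is_derive_weight (y : R) : 0 < y -> is_derive y 1 weight (weight' y).
Proof.
move=> y0; have H := @is_derive1_powR R (- al) y y0.
have A : is_derive y 1 (fun=> 1 : R) 0 by exact: is_derive_cst.
have B := @is_deriveZ R _ _ (fun y : R => y `^ (- al)) La y 1 _ H.
have D := @is_deriveD _ _ _ _ _ _ _ _ _ A B.
by apply: (is_derive_eq D); rewrite add0r /weight' /GRing.scale/=; ring.
Qed.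

Lemma is_derive_weight_int (y : R) : 0 < y -> is_derive y 1 weight_int (weight y).
Proof.
move=> y0; have H := @is_derive1_powR R (1 - al) y y0.
have A : is_derive y 1 (fun y => y : R) 1 by exact: is_derive_id.
have B := @is_deriveZ R _ _ (fun y : R => y `^ (1 - al)) (La / (1 - al)) y 1 _ H.
have D := @is_deriveD _ _ _ _ _ _ _ _ _ A B.
apply: (is_derive_eq D); rewrite /weight /GRing.scale/=; congr (_ + _).
rewrite (_ : 1 - al - 1 = - al); last by ring.
by rewrite mulrA divfK// gt_eqF// subr_gt0.
Qed.

Lemma smooth_weight f : smooth f -> (forall z, 0 < f z) -> smooth (fun z => weight (f z)).
Proof.
move=> sf f0; apply: (@smoothD _ _ (fun=> 1)); first exact: smooth_cst.
by apply: (@smoothM _ _ (fun=> La)); [exact: smooth_cst|exact: smooth_powR].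
Qed.

Lemma smooth_weight_int f : smooth f -> (forall z, 0 < f z) -> smooth (fun z => weight_int (f z)).
Proof.
move=> sf f0; apply: smoothD => //.
by apply: (@smoothM _ _ (fun=> La / (1 - al))); [exact: smooth_cst|exact: smooth_powR].
Qed.

Lemma cvg_powR (a : R) (y : nat -> R) (l : R) : 0 < l -> y k @[k --> \oo] --> l ->
  y k `^ a @[k --> \oo] --> l `^ a.
Proof.
move=> l0 yl; have [+ _] := is_derive1_powR a l0.
move=> /derivable1_diffP/differentiable_continuous C.
exact: (cvg_comp _ _ yl C).
Qed.

Lemma cvg_weight (y : nat -> R) (l : R) : 0 < l -> y k @[k --> \oo] --> l ->
  weight (y k) @[k --> \oo] --> weight l.
Proof.
by move=> l0 yl; apply: cvgD; [exact: cvg_cst|apply: cvgM; [exact: cvg_cst|exact: cvg_powR]].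
Qed.

Lemma cvg_weight' (y : nat -> R) (l : R) : 0 < l -> y k @[k --> \oo] --> l ->
  weight' (y k) @[k --> \oo] --> weight' l.
Proof.
by move=> l0 yl; apply: cvgN; apply: cvgM; [exact: cvg_cst|exact: cvg_powR].
Qed.

Lemma cvg_weight_int (y : nat -> R) (l : R) : 0 < l -> y k @[k --> \oo] --> l ->
  weight_int (y k) @[k --> \oo] --> weight_int l.
Proof.
by move=> l0 yl; apply: cvgD => //; apply: cvgM; [exact: cvg_cst|exact: cvg_powR].
Qed.

Lemma measurable_powRc (a b : R) f : measurable_fun setT (f : mE -> R) ->
  measurable_fun setT ((fun z => b * f z `^ a) : mE -> R).
Proof.
move=> mf; apply: measurable_funM => //.
exact: (measurableT_comp (measurable_powR _) mf).
Qed.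

Let v_ z : R := U z + de.

(** With [M] the larger of the two factors, each product is at most [M^r <= 1 + M^p]. A bound by
    [p]-th powers thus serves both fluxes. *)
Lemma flux_Young r (G w : 'rV[R]_n) : 1 < r -> r <= p ->
  `|flux r G w| <= \sum_i (1 + enorm G `^ p + `|w ord0 i| `^ p).
Proof.
move=> r1 rp; apply: le_trans (flux_le _ _ r1) _; rewrite mulr_sumr; apply: ler_sum => i _.
have [M [M0 M1 M2 M3]] : exists M : R, [/\ 0 <= M, enorm G <= M, `|w ord0 i| <= M & M `^ p <= enorm G `^ p + `|w ord0 i| `^ p].
  have [H|H] := leP (enorm G) `|w ord0 i|.
    by exists `|w ord0 i|; split => //; rewrite lerDr powR_ge0.
  by exists (enorm G); split; rewrite ?enorm_ge0// ?lerDl ?powR_ge0// ltW.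
apply: (@le_trans _ _ (M `^ r)).
  rewrite -(@mulr_powRB1 _ M r)//; last by lra.
  rewrite mulrC ler_pM ?powR_ge0//; apply: ge0_ler_powR; rewrite ?nnegrE ?enorm_ge0//; lra.
rewrite -addrA; apply: le_trans (powR_le1D M0 _ rp) _; first lra.
by rewrite lerD2l.
Qed.

Lemma cvg_shift (k0 : nat) (y : nat -> R) (l : R) : y k @[k --> \oo] --> l ->
  y (k + k0)%N @[k --> \oo] --> l.
Proof. by move=> yl; have := yl; rewrite -(cvg_shiftn k0). Qed.

Lemma cvg_sumr (I : Type) (r : seq I) (y : nat -> I -> R) (l : I -> R) :
  (forall i, y k i @[k --> \oo] --> l i) ->
  \sum_(i <- r) y k i @[k --> \oo] --> \sum_(i <- r) l i.
Proof.
move=> yl; elim: r => [|i r IH].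
  rewrite big_nil (_ : (fun k => _) = fun=> 0); first exact: cvg_cst.
  by apply/funext => k; rewrite big_nil.
rewrite big_cons (_ : (fun k => _) = fun k => y k i + \sum_(j <- r) y k j).
  exact: cvgD.
by apply/funext => k; rewrite big_cons.
Qed.

Lemma cvg_flux r (G w : 'rV[R]_n) (Gk : nat -> 'rV[R]_n) :
  (forall i, Gk k ord0 i @[k --> \oo] --> w ord0 i) ->
  flux r G (Gk k) @[k --> \oo] --> flux r G w.
Proof.
move=> Gw; apply: cvgM; first exact: cvg_cst.
by apply: cvg_sumr => i; apply: cvgM; [exact: cvg_cst|exact: Gw].
Qed.

Lemma cvg_le0 (y : nat -> R) (l : R) : y k @[k --> \oo] --> l -> (forall k, y k <= 0) -> l <= 0.
Proof.
move=> yl y0; rewrite -(cvg_lim _ yl)//; apply: limr_le; first exact: cvgP yl.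
exact: nearW.
Qed.

Definition nonlinear_integrand phi z : R :=
  weight_int (v_ z) * 'D_(dirc None) phi z + U z `^ s * (weight (v_ z) * phi z)
  - (weight' (v_ z) * phi z * (enorm (rowg g z) `^ p + enorm (rowg g z) `^ q)
     + weight (v_ z) * (flux p (rowg g z) (grad phi z) + flux q (rowg g z) (grad phi z))).

(** [ls_ineq] accepts smooth functions only, so it is applied to [weight (vk k) * phi], where [vk]
    mollifies [v], and dominated convergence gives the limit. The margin between [N - 1] and [N]
    makes the derivatives of [vk] mollified weak derivatives on the support of [phi]. *)
Lemma nonlinear_inequality tau phi : admissible (N - 1) tau phi ->
  L1 (nonlinear_integrand phi) /\ \int[mu]_z nonlinear_integrand phi z <= 0.
Proof.
move=> [sphi t0 phi0 phiN phit]; have [iU iUs ig igp iep U0 Uout gout dcm ineq] := sol.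
(* All these functions are mollified along one subsequence. The powers of the gradient components
   are included because Jensen's inequality bounds the powers of the mollified components by their
   mollifications. *)
pose fam (j : option (option 'I_n + 'I_n)) : E -> R :=
  match j with None => U | Some (inl c) => g c | Some (inr i) => fun z => `|g (Some i) z| `^ p end.
have p1 : 1 < p by exact: lt_le_trans q_gt1 le_qp.
have p0 : 0 < p by apply: lt_trans p1.
have ifam j : L1 (fam j) by case: j => [[c|i]|] //=.
have fam0 j z : ~ cube N z -> fam j z = 0.
  move=> Nz; case: j => [[c|i]|] /=; [exact: gout| |exact: Uout].
  by rewrite gout// normr0 powR0// gt_eqF.
have [sub0 [h [sub0k ih cfam hfam]]] := mollify_dominated ifam fam0.
(* Dropping the first [k0] terms makes all kernel scales smaller than [tau]. *)
have [k0 _ Hk0] := near_invS_lt t0.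
pose sub k := sub0 (k + k0)%N.
have subt k : (sub k).+1%:R^-1 < tau.
  by apply: Hk0; rewrite /= (leq_trans _ (sub0k _))// leq_addl.
have csub : {ae mu, forall z j, mollify (sub k) (fam j) z @[k --> \oo] --> fam j z}.
  apply: filterS cfam => z H j; have := H j.
  exact: (cvg_shift k0).
have hsub : {ae mu, forall z k j, `|mollify (sub k) (fam j) z| <= h z}.
  by apply: filterS hfam => z H k j; exact: H.
pose vk k z := mollify (sub k) U z + de.
have vk_de k z : de <= vk k z by rewrite lerDr mollify_ge0.
have vk0 k z : 0 < vk k z by exact: lt_le_trans (vk_de k z).
have scm k j : smooth (mollify (sub k) (fam j)) by exact: smooth_mollify.
have svk k : smooth (vk k).
  by apply: smoothD; [exact: (scm k None)|exact: smooth_cst].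
have sF k := smooth_weight (svk k) (vk0 k).
pose psi k z := weight (vk k z) * phi z.
have spsi k : smooth (psi k) by exact: smoothM.
have apsi k : admissible N tau (psi k).
  split => //.
  - by move=> z; rewrite mulr_ge0// (le_trans _ (weight_ge1 _)).
  - move=> z Nz; rewrite /psi phiN ?mulr0// => H; apply: Nz => c.
    by have := H c; lra.
  - by move=> z zt; rewrite /psi phit ?mulr0.
(* The factor [phi z] is kept because the formula for the derivative of [vk] is available only on
   the support of [phi]. *)
have dvk k c z : 'D_(dirc c) (vk k) z * phi z = mollify (sub k) (g c) z * phi z.
  have [->|pz] := eqVneq (phi z) 0; first by rewrite !mulr0.
  have D1 := smooth_is_derive z (dirc c) (scm k None).
  have D2 : is_derive z (dirc c) (fun=> de : R) 0 by exact: is_derive_cst.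
  have [_ ->] : is_derive z (dirc c) (vk k) ('D_(dirc c) (mollify (sub k) (fam None)) z + 0) := is_deriveD D1 D2.
  congr (_ * _); rewrite addr0 (dcm _ _ _ tau)//.
    by apply: contrapT => Nz; move: pz; rewrite phiN// eqxx.
  by rewrite leNgt; apply/negP => zt; move: pz; rewrite phit ?eqxx// ltW.
have dFvk k z v : 'D_v (fun z => weight (vk k z)) z = weight' (vk k z) * 'D_v (vk k) z.
  by have [] := is_derive_comp1 (smooth_is_derive z v (svk k)) (is_derive_weight (vk0 k z)).
have dpsi k c z : 'D_(dirc c) (psi k) z =
    weight' (vk k z) * phi z * mollify (sub k) (g c) z + weight (vk k z) * 'D_(dirc c) phi z.
  rewrite /psi deriveM; [|exact: smooth_derivable..].
  rewrite dFvk /GRing.scale/=; have := dvk k c z.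
  rewrite addrC => H; congr (_ + _).
  rewrite -(mulrA (weight' _)) (mulrC (phi z) (mollify _ _ _)) -H; ring.
pose gk k z : 'rV[R]_n := \row_i mollify (sub k) (g (Some i)) z.
have gradpsi k z : grad (psi k) z = (weight' (vk k z) * phi z) *: gk k z + weight (vk k z) *: grad phi z.
  by apply/rowP => i; rewrite !mxE dpsi.
(* The integrand for [psi k] with its gradient expanded: the unmollified gradient stays in the
   nonlinear argument, and [gk k] occurs linearly. *)
pose wk k z := - (g None z * psi k z) + U z `^ s * psi k z
  - (weight' (vk k z) * phi z * (flux p (rowg g z) (gk k z) + flux q (rowg g z) (gk k z))
     + weight (vk k z) * (flux p (rowg g z) (grad phi z) + flux q (rowg g z) (grad phi z))).
have wk_le0 k : \int[mu]_z wk k z <= 0.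
  have := ineq tau (psi k) (apsi k); congr (_ <= _); apply: eq_Rintegral => z _.
  by rewrite /wk gradpsi !fluxDr !fluxZr; ring.
pose w z := - (g None z * (weight (v_ z) * phi z)) + U z `^ s * (weight (v_ z) * phi z)
  - (weight' (v_ z) * phi z * (enorm (rowg g z) `^ p + enorm (rowg g z) `^ q)
     + weight (v_ z) * (flux p (rowg g z) (grad phi z) + flux q (rowg g z) (grad phi z))).
have cv z : (forall j, mollify (sub k) (fam j) z @[k --> \oo] --> fam j z) -> vk k z @[k --> \oo] --> v_ z.
  by move=> H; apply: cvgD; [exact: (H None)|exact: cvg_cst].
have v0 z : 0 <= U z -> 0 < v_ z by move=> Uz; rewrite ltr_wpDl.
have [M M0 HM] := cube_bounded (smooth_cont sphi) phiN.
have DN v := derive_out v phiN (@closed_cube _ _ (N - 1)).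
have sDphi v := smooth_derive v sphi.
have [Mt Mt0 HMt] := cube_bounded (smooth_cont (sDphi (dirc None))) (DN _).
have [Mx Mx0 HMx] : exists2 M, 0 <= M & forall z i, `|grad phi z ord0 i| <= M.
  have /choice[M' HM'] : forall i, exists M, forall z, `|'D_(dirc (Some i)) phi z| <= M.
    by move=> i; have [M' _ ?] := cube_bounded (smooth_cont (sDphi (dirc (Some i)))) (DN _); exists M'.
  exists (\sum_i `|M' i|); first exact: sumr_ge0.
  move=> z i; rewrite mxE (le_trans (HM' i z))// (le_trans (ler_norm _))//.
  by rewrite (bigD1 i)//= lerDl sumr_ge0.
have Fde0 : 0 <= weight de by rewrite (le_trans _ (weight_ge1 _)).
have psiM k z : `|psi k z| <= weight de * M.
  rewrite normrM ler_pM// ger0_norm ?weight_le// (le_trans _ (weight_ge1 _))//.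
pose e z := enorm (rowg g z) `^ p.
(* The part of the bound in [flux_Young] that does not depend on [k]; the [p]-th powers of the
   components of [gk] are at most [2^p * h] by Jensen's inequality. *)
pose S (c : R) z := n%:R * (c * \1_(cube N) z + e z).
pose dom z := weight de * M * `|g None z| + weight de * M * (U z `^ s)
  + (`|weight' de| * M * (2 * (S 1 z + n%:R * (2 `^ p * h z)))
  + weight de * (2 * S (1 + Mx `^ p) z)).
have iS c : L1 (S c).
  by apply: integrableZR; apply: integrableDR => //; exact: integrable_cube.
have idom : L1 dom.
  apply: integrableDR; first by apply: integrableDR; apply: integrableZR => //; exact: integrable_normR.
  apply: integrableDR; apply: integrableZR; apply: integrableZR => //.
  by apply: integrableDR => //; do 2 apply: integrableZR.
have mcont f : smooth f -> measurable_fun setT (f : mE -> R).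
  by move=> sf; exact: continuous_measurable_st (smooth_cont sf).
have mG : measurable_fun setT (rowg g : mE -> 'rV[R]_n).
  apply: measurable_fun_rV => i; under eq_fun do rewrite mxE.
  exact: measurable_of_integrable (ig _).
have mDphi i : measurable_fun setT ((fun z => grad phi z ord0 i) : mE -> R).
  by under eq_fun do rewrite mxE; exact: mcont (sDphi _).
have mgt : measurable_fun setT (g None : mE -> R) := measurable_of_integrable (ig None).
have mUs : measurable_fun setT ((fun z => U z `^ s) : mE -> R) := measurable_of_integrable iUs.
have mphi := mcont _ sphi.
have mv : measurable_fun setT (v_ : mE -> R).
  by apply: measurable_funD => //; exact: measurable_of_integrable iU.
have me r : measurable_fun setT ((fun z => enorm (rowg g z) `^ r) : mE -> R).
  apply: (measurableT_comp (measurable_powR _)).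
  exact: measurableT_comp (@measurable_enorm R n) mG.
have mF (f : mE -> R) : measurable_fun setT f -> measurable_fun setT (fun z => weight (f z)).
  by move=> mf; apply: measurable_funD => //; exact: measurable_powRc.
have mF' (f : mE -> R) : measurable_fun setT f -> measurable_fun setT (fun z => weight' (f z)).
  move=> mf; rewrite (_ : (fun z => weight' (f z)) = fun z => - (La * al) * f z `^ (- al - 1)).
    exact: measurable_powRc.
  by apply/funext => z; rewrite mulNr.
have mwk k : measurable_fun setT (wk k : mE -> R).
  have mg i : measurable_fun setT ((fun z => gk k z ord0 i) : mE -> R).
    by under eq_fun do rewrite mxE; exact: mcont (scm k (Some (inl (Some i)))).
  have mp := mcont _ (spsi k).
  apply: measurable_funB.
    apply: measurable_funD; last exact: measurable_funM.
    by apply: measurableT_comp => //; exact: measurable_funM.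
  apply: measurable_funD; apply: measurable_funM.
  - by apply: measurable_funM => //; apply: mF'; exact: mcont (svk k).
  - by apply: measurable_funD; exact: measurable_flux.
  - exact: mcont (sF k).
  - by apply: measurable_funD; exact: measurable_flux.
have mw : measurable_fun setT (w : mE -> R).
  have mFv := mF _ mv.
  apply: measurable_funB.
    apply: measurable_funD; last by do 2 apply: measurable_funM => //.
    by apply: measurableT_comp => //; do 2 apply: measurable_funM => //.
  apply: measurable_funD; apply: measurable_funM => //.
  - by apply: measurable_funM => //; apply: mF'.
  - exact: measurable_funD.
  - by apply: measurable_funD; exact: measurable_flux.
have cw : {ae mu, forall z, wk k z @[k --> \oo] --> w z}.
  apply: filterS2 csub U0 => z H Uz; have Hv := cv z H; have v0z := v0 z Uz.
  have Hpsi : psi k z @[k --> \oo] --> weight (v_ z) * phi z.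
    by apply: cvgM; [exact: cvg_weight|exact: cvg_cst].
  have Hfl r : 0 < r -> flux r (rowg g z) (gk k z) @[k --> \oo] --> enorm (rowg g z) `^ r.
    move=> r0; rewrite -flux_self//; apply: cvg_flux => i; rewrite mxE.
    under eq_fun do rewrite mxE; exact: (H (Some (inl (Some i)))).
  apply: cvgB.
    apply: cvgD; last by apply: cvgM => //; exact: cvg_cst.
    by apply: cvgN; apply: cvgM => //; exact: cvg_cst.
  apply: cvgD; apply: cvgM.
  - by apply: cvgM; [exact: cvg_weight'|exact: cvg_cst].
  - by apply: cvgD; apply: Hfl => //; exact: lt_trans q_gt1.
  - exact: cvg_weight.
  - exact: cvg_cst.
have bw : {ae mu, forall z k, `|wk k z| <= dom z}.
  apply: filterS hsub => z H k.
  have h0 : 0 <= h z by rewrite (le_trans _ (H 0%N None)).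
  have [Nz|Nz] := pselect (cube N z); last first.
    have N1z : ~ cube (N - 1) z by move=> Hc; apply: Nz => c; have := Hc c; lra.
    have g0 : grad phi z = 0 by apply/rowP => i; rewrite !mxE DN.
    rewrite /wk /psi phiN// g0 !flux0r !(mulr0, mul0r, addr0, subr0, oppr0) normr0.
    by rewrite /dom /S /e; do !(apply: addr_ge0 || apply: mulr_ge0); rewrite ?powR_ge0.
  have S1 c : S c z = n%:R * (c + e z) by rewrite /S indicE mem_set// mulr1.
  have sumn (b : 'I_n -> R) c : (forall i, b i <= c) -> \sum_i b i <= n%:R * c.
    by move=> bc; rewrite (le_trans (ler_sum _ (fun i _ => bc i)))// sumr_const card_ord mulr_natl.
  have flK r : 1 < r -> r <= p -> `|flux r (rowg g z) (gk k z)| <= S 1 z + n%:R * (2 `^ p * h z).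
    move=> r1 rp; apply: le_trans (flux_Young _ _ r1 rp) _; rewrite S1 -mulrDr; apply: sumn => i.
    rewrite lerD2l mxE; apply: le_trans (mollify_Jensen _ _ (ltW p1) (ig (Some i)) (igp (Some i))) _.
    by rewrite ler_wpM2l ?powR_ge0// (le_trans (ler_norm _))//; exact: (H k (Some (inr i))).
  have flD r : 1 < r -> r <= p -> `|flux r (rowg g z) (grad phi z)| <= S (1 + Mx `^ p) z.
    move=> r1 rp; apply: le_trans (flux_Young _ _ r1 rp) _; rewrite S1; apply: sumn => i.
    rewrite addrAC lerD2r lerD2l; apply: ge0_ler_powR; rewrite ?nnegrE//; exact: ltW.
  have fl2 (a b c : R) : `|a| <= c -> `|b| <= c -> `|a + b| <= 2 * c.
    by move=> ac bc; rewrite mulr_natl mulr2n (le_trans (ler_normD _ _))// lerD.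
  have Fk : `|weight (vk k z)| <= weight de.
    by rewrite ger0_norm ?weight_le// (le_trans _ (weight_ge1 _)).
  rewrite /wk /dom.
  apply: le_trans (ler_normB _ _) _; apply: lerD.
    apply: le_trans (ler_normD _ _) _; apply: lerD.
      by rewrite normrN normrM mulrC ler_wpM2r.
    by rewrite normrM mulrC (ger0_norm (powR_ge0 _ _)) ler_wpM2r ?powR_ge0.
  apply: le_trans (ler_normD _ _) _; apply: lerD; rewrite normrM ler_pM//.
  - by rewrite normrM ler_pM// weight'_le.
  - by apply: fl2; apply: flK.
  - by apply: fl2; apply: flD.
have [iw cIw] := Rdominated_cvg mwk mw cw idom bw.
have Iw : \int[mu]_z w z <= 0.
  exact: cvg_le0 cIw wk_le0.
(* The time derivative of [weight_int (vk k) * phi], so its integral vanishes. Adding the limit [y]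
   to [w] trades the weak time derivative of the solution for a time derivative of [phi]. *)
pose yk k z := weight_int (vk k z) * 'D_(dirc None) phi z + mollify (sub k) (g None) z * psi k z.
pose y z := weight_int (v_ z) * 'D_(dirc None) phi z + g None z * (weight (v_ z) * phi z).
have sH k := smooth_weight_int (svk k) (vk0 k).
have Iyk k : \int[mu]_z yk k z = 0.
  have HN z : ~ cube (N - 1) z -> weight_int (vk k z) * phi z = 0 by move=> Nz; rewrite phiN// mulr0.
  rewrite -(integral_derive0 (dirc None) (smoothM (sH k) sphi) HN).
  apply: eq_Rintegral => z _.
  have D1 := smooth_is_derive z (dirc None) sphi.
  have D2 := is_derive_comp1 (smooth_is_derive z (dirc None) (svk k)) (is_derive_weight_int (vk0 k z)).
  have [_ ->] := is_deriveM D2 D1.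
  rewrite /yk /psi /GRing.scale/=; congr (_ + _).
  have H : 'D_(dir_t n) (vk k) z * phi z = mollify (sub k) (g None) z * phi z := dvk k None z.
  by rewrite (mulrCA (mollify _ _ _)) -H; ring.
have cy : {ae mu, forall z, yk k z @[k --> \oo] --> y z}.
  apply: filterS2 csub U0 => z H Uz; have Hv := cv z H; have v0z := v0 z Uz.
  apply: cvgD; first by apply: cvgM; [exact: cvg_weight_int|exact: cvg_cst].
  apply: cvgM; first exact: (H (Some (inl None))).
  by apply: cvgM; [exact: cvg_weight|exact: cvg_cst].
pose c0 := La / (1 - al).
have c00 : 0 <= c0 by rewrite divr_ge0// subr_ge0 ltW.
(* [weight_int] grows at most linearly, since [x^(1 - al) <= 1 + x]; hence [h] controls it. *)
pose domy z := Mt * ((1 + c0) * h z + ((1 + c0) * de + c0) * \1_(cube N) z)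
  + weight de * M * h z.
have idomy : L1 domy.
  apply: integrableDR; last exact: integrableZR.
  apply: integrableZR; apply: integrableDR; [exact: integrableZR|exact: integrable_cube].
have by_ : {ae mu, forall z k, `|yk k z| <= domy z}.
  apply: filterS hsub => z H k.
  have h0 : 0 <= h z by rewrite (le_trans _ (H 0%N None)).
  have [Nz|Nz] := pselect (cube N z); last first.
    have N1z : ~ cube (N - 1) z by move=> Hc; apply: Nz => c; have := Hc c; lra.
    rewrite /yk /psi phiN// DN// !(mulr0, addr0) normr0 /domy indicE memNset//.
    by rewrite !(mulr0, addr0) addr_ge0// !mulr_ge0// addr_ge0.
  have hv : vk k z <= h z + de.
    by rewrite lerD2r (le_trans (ler_norm _))//; exact: (H k None).
  have Hv : `|weight_int (vk k z)| <= (1 + c0) * h z + ((1 + c0) * de + c0).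
    rewrite ger0_norm; last first.
      by rewrite addr_ge0 ?(ltW (vk0 _ _))// mulr_ge0 ?powR_ge0.
    have P : vk k z `^ (1 - al) <= 1 + vk k z.
      rewrite -[X in _ <= 1 + X]powRr1 ?(ltW (vk0 _ _))//.
      by apply: powR_le1D; rewrite ?(ltW (vk0 _ _))// ?subr_ge0 ?(ltW al_lt1)// gerBl ltW.
    apply: (@le_trans _ _ ((1 + c0) * vk k z + c0)).
      apply: (@le_trans _ _ (vk k z + c0 * (1 + vk k z))); last by rewrite le_eqVlt; apply/orP; left; apply/eqP; ring.
      by rewrite lerD2l ler_wpM2l.
    by rewrite addrA -mulrDr lerD2r ler_wpM2l// addr_ge0// ler01.
  rewrite /yk /domy indicE mem_set// mulr1 (le_trans (ler_normD _ _))// lerD//.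
    by rewrite normrM mulrC ler_pM.
  by rewrite normrM mulrC ler_pM//; exact: (H k (Some (inl None))).
have myk k : measurable_fun setT (yk k : mE -> R).
  apply: measurable_funD; apply: measurable_funM.
  - exact: mcont (sH k).
  - exact: mcont (sDphi _).
  - exact: mcont (scm k (Some (inl None))).
  - exact: mcont (spsi k).
have my : measurable_fun setT (y : mE -> R).
  have mFv := mF _ mv.
  apply: measurable_funD; apply: measurable_funM => //.
  - by apply: measurable_funD => //; exact: measurable_powRc.
  - exact: mcont (sDphi _).
  - exact: measurable_funM.
have [iy cIy] := Rdominated_cvg myk my cy idomy by_.
have Iy : \int[mu]_z y z <= 0 by apply: cvg_le0 cIy _ => k; rewrite Iyk.
have NE : nonlinear_integrand phi = fun z => w z + y z.
  by apply/funext => z; rewrite /nonlinear_integrand /w /y; ring.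
rewrite NE; split; first exact: integrableDR.
by rewrite RintegralD// -[leRHS](addr0 0) lerD.
Qed.

End nonlinear_test.

(** * Scaling estimates *)

Section power_estimates.
Context {R : realType}.
Implicit Types (a b r s al ga ka rho w X K B e : R).

Lemma powRDp X a b : 0 < X -> X `^ (a + b) = X `^ a * X `^ b.
Proof. by move=> X0; rewrite powRD// (gt_eqF X0) implybT. Qed.

Lemma powR_le1 X a : 0 <= X -> X <= 1 -> 0 <= a -> X `^ a <= 1.
Proof.
move=> X0 X1 a0; apply: (@le_trans _ _ (1 `^ a)); last by rewrite powR1.
by apply: ge0_ler_powR; rewrite ?nnegrE.
Qed.

Lemma powRD_le X Y a : 0 <= X -> 0 <= Y -> 0 <= a ->
  (X + Y) `^ a <= 2 `^ a * (X `^ a + Y `^ a).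
Proof.
move=> X0 Y0 a0.
wlog XY : X Y X0 Y0 / X <= Y.
  move=> H; have [|/ltW] := leP X Y; first exact: H.
  by move=> /H; rewrite addrC (addrC (Y `^ a)); exact.
apply: (@le_trans _ _ ((2 * Y) `^ a)).
  by apply: ge0_ler_powR; rewrite ?nnegrE ?addr_ge0 ?mulr_ge0// mulr_natl mulr2n lerD2r.
by rewrite powRM// ler_wpM2l ?powR_ge0// lerDr powR_ge0.
Qed.

Lemma absorb a s j m ka w X : 0 < a -> a < s -> j * s <= m * (s - a) -> 0 < ka -> 0 < w ->
  0 < X -> X <= 1 -> w `^ a * X `^ (m - j) <= ka + ka `^ (1 - s / a) * (w `^ s * X `^ m).
Proof.
move=> a0 as_ jm ka0 w0 X0 X1; set Y := w `^ a * X `^ (m - j).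
have Y0 : 0 < Y by rewrite mulr_gt0// powR_gt0.
have [Yk|kY] := leP Y ka.
  by rewrite (le_trans Yk)// lerDl !mulr_ge0// powR_ge0.
apply: (@le_trans _ _ (ka `^ (1 - s / a) * (w `^ s * X `^ m))); last by rewrite lerDr ltW.
have sa1 : 1 <= s / a by rewrite ler_pdivlMr// mul1r ltW.
have YE : Y = Y `^ (1 - s / a) * Y `^ (s / a).
  by rewrite -powRDp// subrK powRr1// ltW.
rewrite YE ler_pM ?powR_ge0//.
  rewrite -(opprB _ 1) !powRN lef_pV2 ?posrE ?powR_gt0//.
  by apply: ge0_ler_powR; rewrite ?nnegrE ?subr_ge0// ltW.
rewrite /Y powRM ?powR_ge0// -!powRrM mulrCA divff ?gt_eqF// mulr1 ler_wpM2l ?powR_ge0//.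
have E : 0 <= (m - j) * (s / a) - m.
  have -> : (m - j) * (s / a) - m = (m * (s - a) - j * s) / a by field; rewrite gt_eqF.
  by rewrite divr_ge0 ?subr_ge0// ltW.
rewrite (_ : (m - j) * (s / a) = m + ((m - j) * (s / a) - m)); last by ring.
by rewrite powRDp// -[leRHS]mulr1 ler_wpM2l ?powR_ge0// powR_le1// ltW.
Qed.

Lemma scale_le rho K ga r s : 1 <= K -> rho = K `^ (- ga) -> ga * (s - r + 1) <= r ->
  rho `^ (r - 1) * K `^ (- r) <= rho `^ s.
Proof.
move=> K1 -> H; have K0 : 0 < K := lt_le_trans ltr01 K1.
by rewrite -!powRrM -powRDp// ler_powR//; nra.
Qed.

(** Young's inequality with [kap] equal to the coefficient of the good gradient term, which depends
    on the point through [w]. The factor [kap^(1 - r)] contributes the power [(1 + al) * (r - 1)] of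
    [w], and [(1 + w^-al)^r] lowers it by [0] or [al * r]; the second case is [r - 1 - al]. *)
Lemma gradient_term r al rho w X K B e : 1 < r -> 0 < al -> 0 < rho -> 0 < w -> 0 < X ->
  0 < K -> 0 <= B -> 0 <= e ->
  (1 + w `^ (- al)) * (e `^ (r - 1) * (B / (K * X))) <=
  al / rho * w `^ (- al - 1) * e `^ r
  + 2 `^ r * al `^ (1 - r) * B `^ r * (rho `^ (r - 1) * K `^ (- r))
    * ((w `^ ((1 + al) * (r - 1)) + w `^ (r - 1 - al)) * X `^ (- r)).
Proof.
move=> r1 al0 rho0 w0 X0 K0 B0 e0.
have r0 : 0 <= r by rewrite ltW// (lt_trans ltr01).
set kap := al / rho * w `^ (- al - 1).
have kap0 : 0 < kap by rewrite mulr_gt0 ?divr_gt0// powR_gt0.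
have BKX : 0 <= B / (K * X) by rewrite divr_ge0// mulr_ge0// ltW.
have F0 : 0 <= 1 + w `^ (- al) by rewrite addr_ge0// powR_ge0.
rewrite mulrCA.
apply: le_trans (powR_young e0 (mulr_ge0 F0 BKX) kap0 (ltW r1)) _.
have E1 : (B / (K * X)) `^ r = B `^ r * (K `^ (- r) * X `^ (- r)).
  have KX := mulr_gt0 K0 X0.
  rewrite powRM ?invr_ge0 ?(ltW KX)// -powR_inv1 ?(ltW KX)// -powRrM mulN1r.
  by rewrite powRM ?ltW.
rewrite lerD2l (powRM _ F0 BKX) E1.
rewrite /kap powRM ?powR_ge0 ?divr_ge0 ?(ltW al0) ?(ltW rho0)//.
rewrite powRM ?invr_ge0 ?(ltW al0) ?(ltW rho0)//.
rewrite -[rho^-1]powR_inv1 ?(ltW rho0)// -!powRrM mulN1r opprB.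
rewrite (_ : (- al - 1) * (1 - r) = (1 + al) * (r - 1)); last by ring.
have H := powRD_le ler01 (powR_ge0 w (- al)) r0.
rewrite powR1 -powRrM in H.
rewrite (_ : r - 1 - al = (1 + al) * (r - 1) + - al * r); last by ring.
rewrite (powRDp _ _ w0).
set W := w `^ ((1 + al) * (r - 1)); set A := al `^ _; set Rr := rho `^ _; set Bb := B `^ r.
set Kk := K `^ _; set Xx := X `^ _.
have P : 0 <= A * Rr * W * (Bb * (Kk * Xx)) by rewrite !mulr_ge0// powR_ge0.
have := ler_wpM2l P H; congr (_ <= _); ring.
Qed.

End power_estimates.

(** * Space-time cutoff functions *)

Section cutoff.
Context {R : realType} {n : nat}.
Local Notation E := ('rV[R]_n * R)%type.
Implicit Types (z v : E) (c : option 'I_n).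

Lemma is_derive_prod0 (I : Type) (r : seq I) (P : pred I) (F : I -> E -> R) z v :
  (forall i, P i -> is_derive z v (F i) 0) ->
  is_derive z v (fun w => \prod_(i <- r | P i) F i w) 0.
Proof.
move=> F0; elim: r => [|i r IH].
  rewrite (_ : (fun w => _) = fun=> 1); first exact: is_derive_cst.
  by apply/funext => w; rewrite big_nil.
have [Pi|/negbTE Pi] := boolP (P i); last first.
  by rewrite (_ : (fun w => _) = (fun w => \prod_(i <- r | P i) F i w))//; apply/funext => w; rewrite big_cons Pi.
rewrite (_ : (fun w => _) = (fun w => F i w * \prod_(i <- r | P i) F i w)).
  by apply: is_derive_eq (is_deriveM (F0 i Pi) IH) _; rewrite !scaler0 addr0.
by apply/funext => w; rewrite big_cons Pi.
Qed.

Variables (L : option 'I_n -> R) (T : R) (m : nat).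
Hypotheses (L_gt0 : forall c, 0 < L c) (T_gt0 : 0 < T).

Definition xi z : R := \prod_c plateau (co c z / L c).
(** Rises from [0] at time [1/(2T)] to [1] at time [1/T]; the descent at large times is left to the
    time factor of [xi]. *)
Definition chi z : R := stepf (2 * T * z.2 - 1).
(** Only [xi] is raised to a power, to leave room for negative powers of [xi] in the error terms;
    the derivative of [chi] is discarded by its sign. *)
Definition cutoff z : R := xi z ^+ m.+1 * chi z.
Definition core : set E := [set z | forall c, `|co c z| < L c].

Lemma xi_ge0 z : 0 <= xi z.
Proof. by apply: prodr_ge0 => c _; exact: plateau_ge0. Qed.

Lemma xi_le1 z : xi z <= 1.
Proof. by apply: prodr_ile1 => c _; rewrite plateau_ge0 plateau_le1. Qed.

Lemma xi_out c z : 2 * L c <= `|co c z| -> xi z = 0.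
Proof.
move=> H; rewrite /xi (bigD1 c)//= plateau_out ?mul0r//.
by rewrite normrM normfV (gtr0_norm (L_gt0 c)) ler_pdivlMr.
Qed.

Lemma xi_in z : (forall c, `|co c z| <= L c) -> xi z = 1.
Proof.
move=> H; rewrite /xi big1// => c _; apply: plateau_in.
by rewrite normrM normfV (gtr0_norm (L_gt0 c)) ler_pdivrMr// mul1r.
Qed.

Lemma smooth_scaled c : smooth (fun z => co c z / L c).
Proof.
by apply: smoothM; [exact: smooth_co|exact: smooth_cst].
Qed.

Lemma smooth_xi : smooth xi.
Proof. by apply: smooth_prod => c; apply: smooth_plateau; exact: smooth_scaled. Qed.

Lemma is_derive_factor c z v : is_derive z v (fun w => plateau (co c w / L c))
  ('D_1 plateau (co c z / L c) * (co c v / L c)).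
Proof.
have sp : smooth (@plateau R) by exact: smooth_plateau smooth_id.
apply: is_derive_comp1; last exact: smooth_is_derive.
have D1 := is_derive_co c z v.
have D2 : is_derive z v (fun=> (L c)^-1) 0 by exact: is_derive_cst.
by apply: is_derive_eq (is_deriveM D1 D2) _; rewrite scaler0 add0r /GRing.scale/= mulrC.
Qed.

Lemma derive_xi c z : 'D_(dirc c) xi z =
  'D_1 plateau (co c z / L c) / L c * \prod_(c' | c' != c) plateau (co c' z / L c').
Proof.
have D1 := is_derive_factor c z (dirc c).
have D2 : is_derive z (dirc c) (fun w => \prod_(c' | c' != c) plateau (co c' w / L c')) 0.
  apply: is_derive_prod0 => c' cc'; apply: is_derive_eq (is_derive_factor c' z (dirc c)) _.
  by rewrite co_dirc (negbTE cc') mul0r mulr0.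
rewrite (_ : xi = fun w => plateau (co c w / L c) * \prod_(c' | c' != c) plateau (co c' w / L c')).
  by have [_ ->] := is_deriveM D1 D2; rewrite scaler0 add0r /GRing.scale/= co_dirc eqxx mul1r mulrC.
by apply/funext => w; rewrite /xi (bigD1 c).
Qed.

Lemma derive_xi_le M c z : (forall x : R, `|'D_1 plateau x| <= M) ->
  `|'D_(dirc c) xi z| <= M / L c * \1_(~` core) z.
Proof.
move=> HM; rewrite indicE; have [Cz|Cz] := pselect (core z).
  rewrite memNset; last by move=> /(_ Cz).
  rewrite mulr0 derive_xi derive_plateau_in ?mul0r ?normr0//.
  by rewrite normrM normfV (gtr0_norm (L_gt0 c)) ltr_pdivrMr// mul1r.
rewrite mem_set// mulr1 derive_xi normrM normrM normfV (gtr0_norm (L_gt0 c)).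
rewrite -[leRHS]mulr1 ler_pM ?divr_ge0 ?(ltW (L_gt0 c))//.
  by rewrite ler_wpM2r// invr_ge0 ltW.
rewrite ger0_norm; first by apply: prodr_ile1 => c' _; rewrite plateau_ge0 plateau_le1.
by apply: prodr_ge0 => c' _; exact: plateau_ge0.
Qed.

Lemma is_derive_chi z v : is_derive z v chi ('D_1 stepf (2 * T * z.2 - 1) * (2 * T * v.2)).
Proof.
have sp : smooth (@stepf R) by exact: smooth_stepf smooth_id.
apply: (is_derive_comp1 (f := fun z => 2 * T * z.2 - 1)); last exact: smooth_is_derive.
have D1 : is_derive z v (fun z => z.2) v.2 := is_derive_co None z v.
have D2 : is_derive z v (fun=> 2 * T) 0 by exact: is_derive_cst.
have D3 : is_derive z v (fun=> -1 : R) 0 by exact: is_derive_cst.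
apply: is_derive_eq (is_deriveD (is_deriveM D2 D1) D3) _.
by rewrite scaler0 !addr0.
Qed.

Lemma smooth_chi : smooth chi.
Proof.
apply: smooth_stepf; apply: (@smoothD _ _ (fun z => 2 * T * z.2) (fun=> -1)); last exact: smooth_cst.
by apply: (@smoothM _ _ (fun=> 2 * T)); [exact: smooth_cst|exact: (@smooth_co _ _ None)].
Qed.

Lemma chi_ge0 z : 0 <= chi z. Proof. exact: stepf_ge0. Qed.
Lemma chi_le1 z : chi z <= 1. Proof. exact: stepf_le1. Qed.

Lemma chi_out z : z.2 <= (2 * T)^-1 -> chi z = 0.
Proof.
move=> H; apply: stepf_le0; rewrite subr_le0.
by rewrite -(@ler_pdivlMl _ (2 * T)) ?mulr1// mulr_gt0.
Qed.

Lemma chi_in z : T^-1 <= z.2 -> chi z = 1.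
Proof.
move=> H; apply: stepf_ge1; have : 1 <= T * z.2 by rewrite -(@ler_pdivrMl _ T) ?mulr1.
by lra.
Qed.

Lemma smooth_cutoff : smooth cutoff.
Proof. by apply: smoothM; [exact: smoothX smooth_xi|exact: smooth_chi]. Qed.

Lemma derive_xiX z v j : 'D_v (fun w => xi w ^+ j.+1) z = j.+1%:R * xi z ^+ j * 'D_v xi z.
Proof.
have D := smooth_is_derive z v smooth_xi.
suff : is_derive z v (fun w => xi w ^+ j.+1) (j.+1%:R * xi z ^+ j * 'D_v xi z) by case.
elim: j => [|j IH].
  rewrite (_ : (fun w => _) = xi); first by rewrite expr0 !mul1r.
  by apply/funext => w; rewrite expr1.
rewrite (_ : (fun w => _) = (fun w => xi w * xi w ^+ j.+1)); last first.
  by apply/funext => w; rewrite exprS.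
apply: is_derive_eq (is_deriveM D IH) _.
rewrite /GRing.scale/= exprS -[X in _ = X%:R * _ * _]addn1 natrD; ring.
Qed.

Lemma derive_cutoff z v : 'D_v cutoff z =
  m.+1%:R * xi z ^+ m * 'D_v xi z * chi z + xi z ^+ m.+1 * 'D_v chi z.
Proof.
have D1 := smooth_is_derive z v (smoothX m.+1 smooth_xi).
have D2 := smooth_is_derive z v smooth_chi.
have [_ ->] := is_deriveM D1 D2.
by rewrite derive_xiX /GRing.scale/= addrC (mulrC (chi z)).
Qed.

Lemma derive_cutoff_x M i z : (forall x : R, `|'D_1 plateau x| <= M) ->
  `|'D_(dirc (Some i)) cutoff z| <=
  m.+1%:R * M / L (Some i) * (xi z ^+ m * chi z * \1_(~` core) z).
Proof.
move=> HM; rewrite derive_cutoff.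
have [_ ->] := is_derive_chi z (dirc (Some i)); rewrite /= !mulr0 addr0.
rewrite 3!normrM (ger0_norm (chi_ge0 z)) (ger0_norm (exprn_ge0 _ (xi_ge0 z))) normr_nat.
have P := mulr_ge0 (mulr_ge0 (ler0n R m.+1) (exprn_ge0 m (xi_ge0 z))) (chi_ge0 z).
have := ler_wpM2l P (derive_xi_le (Some i) z HM); congr (_ <= _); ring.
Qed.

(** Only a lower bound, because the contribution of the increasing factor [chi] is nonnegative and
    is dropped: it has size [T] and would not scale. *)
Lemma derive_cutoff_t M z : (forall x : R, `|'D_1 plateau x| <= M) ->
  - (m.+1%:R * M / L None * (xi z ^+ m * chi z * \1_(~` core) z))
    <= 'D_(dirc None) cutoff z.
Proof.
move=> HM; rewrite derive_cutoff.
have P := mulr_ge0 (mulr_ge0 (ler0n R m.+1) (exprn_ge0 m (xi_ge0 z))) (chi_ge0 z).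
have Q : 0 <= xi z ^+ m.+1 * 'D_(dirc None) chi z.
  have [_ ->] := is_derive_chi z (dirc None).
  apply: mulr_ge0 (exprn_ge0 _ (xi_ge0 z)) _; apply: mulr_ge0 (derive_stepf_ge0 _) _.
  by rewrite mulr1 mulr_ge0// ltW.
rewrite ler_wpDr//.
have := ler_wpM2l P (derive_xi_le None z HM).
set D := 'D_(dirc None) xi z => H.
have {}H : - (m.+1%:R * xi z ^+ m * chi z * D) <= m.+1%:R * xi z ^+ m * chi z * (M / L None * \1_(~` core) z).
  by apply: le_trans H; rewrite -mulrN ler_wpM2l// -normrN ler_norm.
rewrite lerNl; move: H; congr (_ <= _); ring.
Qed.

Lemma cutoff_out N z : (forall c, 2 * L c <= N) -> ~ cube N z -> cutoff z = 0.
Proof.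
move=> HN Nz; have [c Hc] : exists c, N < `|co c z|.
  apply: contrapT => H; apply: Nz => c; rewrite leNgt; apply/negP => Hc; apply: H; by exists c.
by rewrite /cutoff (@xi_out c) ?expr0n ?mul0r//; apply: le_trans (HN c) (ltW Hc).
Qed.

Lemma cutoff_ge0 z : 0 <= cutoff z.
Proof. exact: mulr_ge0 (exprn_ge0 _ (xi_ge0 z)) (chi_ge0 z). Qed.

Lemma cutoff_le1 z : cutoff z <= 1.
Proof.
apply: mulr_ile1 (exprn_ge0 _ (xi_ge0 z)) (chi_ge0 z) _ (chi_le1 z).
exact: exprn_ile1 (xi_ge0 z) (xi_le1 z).
Qed.

Lemma admissible_cutoff N : (forall c, 2 * L c <= N) -> admissible N (2 * T)^-1 cutoff.
Proof.
move=> HN; split.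
- exact: smooth_cutoff.
- by rewrite invr_gt0 mulr_gt0.
- exact: cutoff_ge0.
- by move=> z; exact: cutoff_out.
- by move=> z zt; rewrite /cutoff chi_out// mulr0.
Qed.

Lemma cutoff_in z : (forall c, `|co c z| <= L c) -> T^-1 <= z.2 -> cutoff z = 1.
Proof. by move=> zL zT; rewrite /cutoff xi_in// chi_in// expr1n mul1r. Qed.

Lemma measurable_core : measurable (core : set ('rV[R]_n * measurableTypeR R)).
Proof.
rewrite (_ : core = [set z : E | forall c, `]- L c, L c[%classic (co c z)]).
  by apply: (@measurable_box _ _ (fun c => `]- L c, L c[%classic)) => c.
by apply/seteqP; split => z H c; have := H c; rewrite /= in_itv/= ltr_norml.
Qed.

End cutoff.

(** * The pointwise inequality at scale [K] *)

Section pointwise.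
Context {R : realType} {n : nat}.
Local Notation E := ('rV[R]_n * R)%type.
Implicit Types (z : E) (c : option 'I_n) (a r ka K v w : R).
Variables (p q s al : R) (m : nat) (M : R).

(* The powers of [w = v / rho] produced by Young's inequality. *)
Definition exponents : seq R :=
  [:: 1; 1 - al; (1 + al) * (p - 1); p - 1 - al; (1 + al) * (q - 1); q - 1 - al].
(** One constant for all the exponents. As each of them lies strictly between [0] and [s], it tends
    to [0] when [ka] grows, which is what permits absorption into the left side. *)
Definition absorb_cst ka : R := \sum_(a <- exponents) ka `^ (1 - s / a).

(* [rho] is the size of [v] that balances [v^s] with the [q]-flux at space scale
   [K], and [K^be] is the corresponding time scale. *)
Definition ga : R := q / (s - q + 1).
Definition be : R := ga * (s - 1).
Definition rho K : R := K `^ (- ga).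
Definition Lk K c : R := if c is None then K `^ be else K.

Hypotheses (q_gt1 : 1 < q) (le_qp : q <= p) (p_lts : p - 1 < s) (s_gt1 : 1 < s).
Hypotheses (al_gt0 : 0 < al) (al_lt1 : al < 1) (al_ltq : al < q - 1) (al_s : (1 + al) * (p - 1) < s).
Hypotheses (m_gt0 : (0 < m)%N) (m_large : forall a, a \in exponents -> p * s <= m.+1%:R * (s - a)).
Hypotheses (M_ge0 : 0 <= M) (HM : forall x : R, `|'D_1 plateau x| <= M).

(** The smallness conditions on [al] serve this purpose: [al < q - 1] makes the smallest exponents
    positive, and [(1 + al) * (p - 1) < s] keeps the largest below the source power. *)
Lemma exponents_bounds a : a \in exponents -> 0 < a < s.
Proof.
move: q_gt1 le_qp p_lts s_gt1 al_gt0 al_lt1 al_ltq al_s => ? ? ? ? ? ? ? ?.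
have P : 0 < (1 + al) * (q - 1) by rewrite mulr_gt0//; lra.
have Q : 0 < (1 + al) * (p - 1) by rewrite mulr_gt0//; lra.
have T : (1 + al) * (q - 1) <= (1 + al) * (p - 1) by rewrite ler_pM2l//; lra.
by rewrite !inE => /orP[|/orP[|/orP[|/orP[|/orP[|]]]]] /eqP ->; apply/andP; split; lra.
Qed.

Lemma absorb_cst_ge0 ka : 0 <= absorb_cst ka.
Proof. by apply: sumr_ge0 => a _; exact: powR_ge0. Qed.

Lemma absorb_exponents a j ka w X : a \in exponents -> j <= p -> 0 < ka -> 0 < w -> 0 < X -> X <= 1 ->
  w `^ a * X `^ (m.+1%:R - j) <= ka + absorb_cst ka * (w `^ s * X `^ m.+1%:R).
Proof.
move=> ae jp ka0 w0 X0 X1; have /andP[a0 as_] := exponents_bounds ae.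
have jm : j * s <= m.+1%:R * (s - a).
  by apply: le_trans (m_large ae); rewrite ler_wpM2r// ltW// (lt_trans ltr01).
apply: le_trans (absorb a0 as_ jm ka0 w0 X0 X1) _.
rewrite lerD2l ler_wpM2r ?mulr_ge0 ?powR_ge0// /absorb_cst (big_rem a ae)/= lerDl.
by apply: sumr_ge0 => b _; exact: powR_ge0.
Qed.

(** The constant of [gradient_term] for [B = n * m.+1 * M], which bounds the sum of the spatial
    derivatives of the cutoff up to the factor [xi^m / K]. *)
Definition flux_cst r : R := 2 `^ r * al `^ (1 - r) * (n%:R * m.+1%:R * M) `^ r.
Definition total_cst : R := 2 * (flux_cst p + flux_cst q + m.+1%:R * M / (1 - al)).

Lemma flux_cst_ge0 r : 0 <= flux_cst r.
Proof. by rewrite !mulr_ge0// powR_ge0. Qed.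

Lemma total_cst_ge0 : 0 <= total_cst.
Proof. by rewrite mulr_ge0// !addr_ge0 ?flux_cst_ge0// divr_ge0 ?mulr_ge0// subr_ge0 ltW. Qed.

Section fixed.
Variables (K ka : R).
Hypotheses (K_ge1 : 1 <= K) (ka_gt0 : 0 < ka).
Let K_gt0 : 0 < K. Proof. exact: lt_le_trans K_ge1. Qed.
Let rho_gt0 : 0 < rho K. Proof. exact: powR_gt0. Qed.
Local Notation L := (Lk K).
Local Notation La := (rho K `^ al).
Local Notation phi := (cutoff L K m).

Lemma Lk_gt0 c : 0 < L c.
Proof. by case: c => [i|] /=; rewrite ?powR_gt0. Qed.

(** There is equality for [r = q]; for larger [r] the left side decreases and the right side
    increases. This is why the [p]-flux is harmless at scales [K >= 1]. *)
Lemma ga_scale r : q <= r -> r <= p -> ga * (s - r + 1) <= r.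
Proof.
move=> qr rp; move: q_gt1 le_qp p_lts s_gt1 al_gt0 al_lt1 al_ltq al_s => ? ? ? ? ? ? ? ?.
have D : 0 < s - q + 1 by lra.
rewrite /ga mulrAC ler_pdivrMr//.
apply: (@le_trans _ _ (q * (s - q + 1))); first by rewrite ler_wpM2l; lra.
by rewrite ler_wpM2r// ltW.
Qed.

Lemma flux_term r (G : 'rV[R]_n) v z : 1 < r -> q <= r -> r <= p -> 0 < v -> 0 < xi L z ->
  (1 + al) * (r - 1) \in exponents -> r - 1 - al \in exponents ->
  weight al La v * flux r G (grad phi z) <=
  - (weight' al La v * phi z * enorm G `^ r)
  + flux_cst r * (rho K `^ s * (2 * (ka + absorb_cst ka * ((v / rho K) `^ s * xi L z ^+ m.+1)))
                  * (chi K z * \1_(~` core L) z)).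
Proof.
move=> r1 qr rp v0 X0 e1 e2; set X := xi L z in X0 *; set w := v / rho K.
have w0 : 0 < w by exact: divr_gt0.
have vE : v = rho K * w by rewrite mulrC divfK// gt_eqF.
(* The choice [La = rho^al] leaves no parameter in the weight once it is written in [w]. *)
have FE : weight al La v = 1 + w `^ (- al).
  rewrite /weight vE powRM ?(ltW w0) ?(ltW rho_gt0)// mulrA -powRDp// subrr powRr0 mul1r//.
have F'E : - weight' al La v = al / rho K * w `^ (- al - 1).
  rewrite /weight' vE opprK powRM ?(ltW w0) ?(ltW rho_gt0)// mulrA; congr (_ * _).
  by rewrite (mulrC La) -mulrA -powRDp// addrA addrN sub0r powR_inv1 ?(ltW rho_gt0).
set I := \1_(~` core L) z; have I0 : 0 <= I by rewrite /I indicE.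
have I1 : I <= 1 by rewrite /I indicE lern1 leq_b1.
have c0 := chi_ge0 K z : 0 <= chi K z.
set e := enorm G; have e0 : 0 <= e by exact: enorm_ge0.
pose B : R := n%:R * m.+1%:R * M.
have B0 : 0 <= B by rewrite !mulr_ge0.
have X1 : X <= 1 := xi_le1 L z.
have F0 : 0 <= 1 + w `^ (- al) by rewrite addr_ge0// powR_ge0.
(* Lets the good term keep the full [phi] although Young's inequality is used only where the cutoff
   varies. *)
have phiY : X ^+ m.+1 * (chi K z * I) <= phi z.
  by rewrite ler_wpM2l ?exprn_ge0 ?(ltW X0)// ler_piMr.
have Hx i : `|grad phi z ord0 i| <= m.+1%:R * M / K * (X ^+ m * (chi K z * I)).
  by rewrite mxE (mulrA (X ^+ m) (chi K z) I); exact: (derive_cutoff_x K m Lk_gt0 i z HM).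
have [Y YE Y0] : exists2 Y, Y = chi K z * I & 0 <= Y by exists (chi K z * I) => //; exact: mulr_ge0.
rewrite -YE in phiY Hx *.
have P : 0 <= X ^+ m.+1 * Y by rewrite mulr_ge0 ?exprn_ge0 ?(ltW X0).
(* The derivative has one power of [X] less than the cutoff; writing [X^m] as [X^(m+1) / X] puts the
   loss inside Young's inequality, where it becomes [X^(-r)]. *)
have H1 : flux r G (grad phi z) <= e `^ (r - 1) * (B / (K * X)) * (X ^+ m.+1 * Y).
  apply: le_trans (ler_norm _) _; apply: le_trans (flux_le _ _ r1) _.
  rewrite -mulrA ler_wpM2l ?powR_ge0//.
  apply: le_trans (ler_sum _ (fun i _ => Hx i)) _.
  rewrite sumr_const card_ord -mulr_natl le_eqVlt; apply/orP; left; apply/eqP.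
  by rewrite /B exprS; field; rewrite !gt_eqF.
rewrite FE; apply: le_trans (ler_wpM2l F0 H1) _; rewrite (mulrA (1 + w `^ (- al))).
have H2 := ler_wpM2r P (gradient_term r1 al_gt0 rho_gt0 w0 X0 K_gt0 B0 e0).
apply: le_trans H2 _; rewrite mulrDl; apply: lerD.
  have -> : - (weight' al La v * phi z * e `^ r) = al / rho K * w `^ (- al - 1) * e `^ r * phi z.
    by rewrite -F'E; ring.
  by rewrite ler_wpM2l// mulr_ge0 ?powR_ge0// mulr_ge0 ?powR_ge0// divr_ge0 ?ltW.
have H3 := scale_le K_ge1 (erefl (rho K)) (ga_scale qr rp).
have H4 : (w `^ ((1 + al) * (r - 1)) + w `^ (r - 1 - al)) * X `^ (- r) * X ^+ m.+1 <=
    2 * (ka + absorb_cst ka * (w `^ s * X ^+ m.+1)).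
  rewrite -powR_mulrn ?(ltW X0)// -mulrA -powRDp// [- r + _]addrC mulrDl mulr_natl mulr2n.
  by apply: lerD; apply: absorb_exponents.
set W := _ + _ in H4 *; set Z := 2 * _ in H4 *.
have W0 : 0 <= W by rewrite addr_ge0 ?powR_ge0.
have WX : 0 <= W * X `^ (- r) * X ^+ m.+1 by rewrite !mulr_ge0 ?exprn_ge0 ?powR_ge0 ?(ltW X0).
have RK : 0 <= rho K `^ (r - 1) * K `^ (- r) by rewrite mulr_ge0 ?powR_ge0.
have H5 := ler_wpM2r Y0 (ler_wpM2l (flux_cst_ge0 r) (ler_pM RK WX H3 H4)).
move: H5; rewrite /flux_cst -/B; congr (_ <= _); ring.
Qed.

(** [weight_int] is at most [rho / (1 - al) * (w + w^(1 - al))], whence the exponents [1] and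
    [1 - al]. The time scale is defined so that [rho * K^(-be) = rho^s]. *)
Lemma time_term v z : 0 < v -> 0 < xi L z ->
  - (m.+1%:R * M / (1 - al) *
    (rho K `^ s * (2 * (ka + absorb_cst ka * ((v / rho K) `^ s * xi L z ^+ m.+1)))
       * (chi K z * \1_(~` core L) z)))
  <= weight_int al La v * 'D_(dirc None) phi z.
Proof.
move=> v0 X0; have := derive_cutoff_t m Lk_gt0 K_gt0 z HM; set D := 'D_(dirc None) phi z.
have X1 : xi L z <= 1 := xi_le1 L z.
set X := xi L z in X0 X1 *; set w := v / rho K.
have w0 : 0 < w by exact: divr_gt0.
have vE : v = rho K * w by rewrite mulrC divfK// gt_eqF.
have al1 : 0 < 1 - al by rewrite subr_gt0.
set I := \1_(~` core L) z; have I0 : 0 <= I by rewrite /I indicE.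
have c0 := chi_ge0 K z : 0 <= chi K z.
rewrite -(mulrA (X ^+ m) (chi K z) I).
have [Y -> Y0] : exists2 Y, chi K z * I = Y & 0 <= Y by exists (chi K z * I) => //; exact: mulr_ge0.
move=> HD; pose c1 : R := m.+1%:R * M.
have c10 : 0 <= c1 by exact: mulr_ge0.
have H0 : 0 <= weight_int al La v.
  by rewrite addr_ge0 ?(ltW v0)// mulr_ge0 ?powR_ge0// divr_ge0 ?powR_ge0// ltW.
have HE : weight_int al La v <= rho K / (1 - al) * (w + w `^ (1 - al)).
  have -> : weight_int al La v = rho K * (w + w `^ (1 - al) / (1 - al)).
    rewrite /weight_int vE powRM ?(ltW w0) ?(ltW rho_gt0)//.
    have : La * rho K `^ (1 - al) = rho K by rewrite -powRDp// addrC subrK powRr1// ltW.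
    by move=> H; rewrite mulrDr; congr (_ + _); rewrite -[in RHS]H; field; rewrite gt_eqF.
  rewrite -mulrA ler_wpM2l ?(ltW rho_gt0)// mulrDr [X in _ <= _ + X]mulrC lerD2r.
  by rewrite ler_peMl ?(ltW w0)// invf_ge1// gerBl ltW.
have LE : rho K * K `^ (- be) = rho K `^ s.
  by rewrite /rho -powRrM -powRDp// /be; congr powR; ring.
have H4 : (w + w `^ (1 - al)) * X ^+ m <= 2 * (ka + absorb_cst ka * (w `^ s * X ^+ m.+1)).
  have -> : X ^+ m = X `^ (m.+1%:R - 1) by rewrite -[m.+1]addn1 natrD addrK powR_mulrn// ltW.
  rewrite -powR_mulrn ?(ltW X0)// mulrDl mulr_natl mulr2n.
  have p1 : 1 <= p by rewrite (le_trans _ le_qp)// ltW.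
  rewrite -[X in X * _ + _]powRr1 ?(ltW w0)//.
  by apply: lerD; apply: absorb_exponents; rewrite // !inE eqxx ?orbT.
apply: (@le_trans _ _ (- (weight_int al La v * (c1 / K `^ be * (X ^+ m * Y))))); last first.
  by rewrite -mulrN ler_wpM2l.
rewrite lerN2.
have P : 0 <= c1 / K `^ be * (X ^+ m * Y).
  by rewrite mulr_ge0 ?mulr_ge0 ?exprn_ge0 ?(ltW X0)// ?invr_ge0 ?powR_ge0.
apply: le_trans (ler_wpM2r P HE) _.
have Q : 0 <= c1 / (1 - al) * rho K `^ s * Y.
  by rewrite mulr_ge0// mulr_ge0 ?powR_ge0// divr_ge0// ltW.
have := ler_wpM2l Q H4; rewrite -LE powRN /c1; congr (_ <= _); last by ring.
field; rewrite !gt_eqF// powR_gt0//.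
Qed.

Definition box : set E := [set z | forall c, `|co c z| <= 2 * L c].

(** The three bounds above are added, and the gradient terms with [weight'] cancel. The error in
    [v^s] is returned to the solution by [(U + om * rho)^s <= 2^s * (U^s + om^s * rho^s)]: the part
    with [U^s] keeps the indicator of the transition region, the others are charged to the whole
    box. *)
Lemma pointwise_inequality (om : R) (U : E -> R) (g : option 'I_n -> E -> R) z :
  0 <= U z -> 0 < om ->
  U z `^ s * phi z <= nonlinear_integrand p q s U g al (om * rho K) La phi z
   + (total_cst * (ka * (rho K `^ s * \1_box z))
   + total_cst * 2 `^ s * absorb_cst ka * (U z `^ s * phi z * \1_(~` core L) z + om `^ s * (rho K `^ s * \1_box z))).
Proof.
move=> Uz om0; have X0 : 0 <= xi L z := xi_ge0 L z.
have I0 : 0 <= \1_(~` core L) z :> R by rewrite indicE.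
have B0 : 0 <= \1_box z :> R by rewrite indicE.
have phi0 := cutoff_ge0 L K m z.
have T0 := total_cst_ge0.
have R0 : 0 <= rho K `^ s by exact: powR_ge0.
have K0 := absorb_cst_ge0 ka.
have P : 0 <= total_cst * (ka * (rho K `^ s * \1_box z))
   + total_cst * 2 `^ s * absorb_cst ka * (U z `^ s * phi z * \1_(~` core L) z + om `^ s * (rho K `^ s * \1_box z)).
  apply: addr_ge0; first by rewrite mulr_ge0// mulr_ge0 ?(ltW ka_gt0)// mulr_ge0.
  rewrite mulr_ge0//; first by rewrite mulr_ge0// mulr_ge0 ?powR_ge0.
  apply: addr_ge0; first by rewrite mulr_ge0// mulr_ge0// powR_ge0.
  by rewrite mulr_ge0 ?powR_ge0// mulr_ge0.
move: X0; rewrite le_eqVlt => /orP[/eqP X0|X0].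
  (* Negative powers of [xi] are used below, so its zeros are treated apart: there [phi] vanishes
     and, as [m] is positive, so do its derivatives. *)
  have p0 : phi z = 0 by rewrite /cutoff -X0 expr0n mul0r.
  have D0 (y : E) : 'D_y phi z = 0.
    by rewrite derive_cutoff -X0 !expr0n (gtn_eqF m_gt0) !(mulr0, mul0r, addr0).
  have g0 : grad phi z = 0 by apply/rowP => i; rewrite !mxE D0.
  have -> : nonlinear_integrand p q s U g al (om * rho K) La phi z = 0.
    by rewrite /nonlinear_integrand g0 D0 !flux0r p0 !(mulr0, mul0r, addr0, subr0).
  by rewrite add0r {1}p0 mulr0.
have X1 : xi L z <= 1 := xi_le1 L z.
(* The box contains every point where [xi] is positive. *)
have Bz : \1_box z = 1 :> R.
  rewrite indicE mem_set// => c; rewrite leNgt; apply/negP => H.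
  by move: X0; rewrite (xi_out Lk_gt0 (ltW H)) ltxx.
move: P; rewrite Bz !mulr1 => _.
pose v := U z + om * rho K.
have omr : 0 < om * rho K by exact: mulr_gt0.
have v0 : 0 < v by rewrite ltr_wpDl.
have p1 : 1 < p by exact: lt_le_trans le_qp.
have Fp := @flux_term p (rowg g z) v z p1 le_qp (lexx p) v0 X0.
have Fq := @flux_term q (rowg g z) v z q_gt1 (lexx q) le_qp v0 X0.
have {}Fp := Fp ltac:(by rewrite !inE eqxx ?orbT) ltac:(by rewrite !inE eqxx ?orbT).
have {}Fq := Fq ltac:(by rewrite !inE eqxx ?orbT) ltac:(by rewrite !inE eqxx ?orbT).
have Ft := time_term v0 X0.
have F1 : U z `^ s * phi z <= U z `^ s * (weight al La v * phi z).
  by rewrite ler_wpM2l ?powR_ge0// ler_peMl// lerDl mulr_ge0 ?powR_ge0.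
have VS : rho K `^ s * (v / rho K) `^ s = v `^ s.
  by rewrite -powRM ?(ltW rho_gt0) ?divr_ge0 ?(ltW v0) ?(ltW rho_gt0)// mulrC divfK// gt_eqF.
have VS2 : v `^ s <= 2 `^ s * (U z `^ s + om `^ s * rho K `^ s).
  rewrite -powRM ?(ltW om0) ?(ltW rho_gt0)//; apply: powRD_le => //; first exact: ltW.
  by rewrite ltW// (lt_trans ltr01).
set I := \1_(~` core L) z in I0 Fp Fq Ft *.
have I1 : I <= 1 by rewrite /I indicE lern1 leq_b1.
have c0 := chi_ge0 K z : 0 <= chi K z.
have c1 := chi_le1 K z : chi K z <= 1.
have CI : rho K `^ s * (2 * (ka + absorb_cst ka * ((v / rho K) `^ s * xi L z ^+ m.+1))) * (chi K z * I)
   <= 2 * (ka * rho K `^ s + absorb_cst ka * 2 `^ s * (U z `^ s * phi z * I + om `^ s * rho K `^ s)).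
  have -> : rho K `^ s * (2 * (ka + absorb_cst ka * ((v / rho K) `^ s * xi L z ^+ m.+1))) * (chi K z * I)
    = 2 * (ka * rho K `^ s * (chi K z * I) + absorb_cst ka * (v `^ s * (phi z * I))).
    by rewrite -VS /cutoff; ring.
  rewrite ler_wpM2l// lerD//.
    by rewrite ler_piMr ?mulr_ge0 ?(ltW ka_gt0)// mulr_ile1.
  rewrite -mulrA ler_wpM2l//; apply: le_trans (ler_wpM2r (mulr_ge0 phi0 I0) VS2) _.
  rewrite -(mulrA (2 `^ s)) ler_wpM2l ?powR_ge0// mulrDl mulrA lerD2l ler_piMr ?mulr_ge0 ?powR_ge0//.
  by rewrite mulr_ile1// cutoff_le1.
move: Fp Fq Ft CI; move: (rho K `^ s * _ * _) => A Fp Fq Ft CI.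
have H : (flux_cst p + flux_cst q + m.+1%:R * M / (1 - al)) * A <=
    total_cst * (ka * rho K `^ s + absorb_cst ka * 2 `^ s * (U z `^ s * phi z * I + om `^ s * rho K `^ s)).
  have := ler_wpM2l T0 CI; set Q := ka * _ + _.
  have -> : total_cst * A = 2 * ((flux_cst p + flux_cst q + m.+1%:R * M / (1 - al)) * A).
    by rewrite /total_cst; ring.
  by rewrite (mulrCA total_cst 2) ler_pM2l.
rewrite /nonlinear_integrand -/v.
have -> : total_cst * (ka * rho K `^ s) + total_cst * 2 `^ s * absorb_cst ka * (U z `^ s * phi z * I + om `^ s * rho K `^ s)
   = total_cst * (ka * rho K `^ s + absorb_cst ka * 2 `^ s * (U z `^ s * phi z * I + om `^ s * rho K `^ s)) by ring.
move: H; set Q := total_cst * _.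
move: Fp Fq Ft F1; move: (weight al La v) (weight' al La v) Q; clear.
move: (phi z) (enorm (rowg g z)) (weight_int al La v * _) (flux p _ _) (flux q _ _) (flux_cst p) (flux_cst q) (m.+1%:R * M / (1 - al)).
by move=> *; lra.
Qed.
End fixed.
End pointwise.

(** * Integrated estimates *)

Section integration.
Context {R : realType} {n : nat}.
Local Notation E := ('rV[R]_n * R)%type.
Local Notation mE := ('rV[R]_n * measurableTypeR R)%type.
Local Notation mu := (@lebesgue_st R n).
Local Notation L1 f := (mu.-integrable setT (EFin \o f)).
Implicit Types (f g psi phi : E -> R) (M e tau : R) (z w v : E) (k : nat).

Lemma ae_le_Rintegral f g : L1 f -> L1 g -> {ae mu, forall z, f z <= g z} ->
  \int[mu]_z f z <= \int[mu]_z g z.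
Proof.
move=> fi gi fg; rewrite -subr_ge0 -RintegralB//.
have hi := integrableBR gi fi; set h := fun z => g z - f z in hi *.
have -> : \int[mu]_z h z = \int[mu]_z `|h z|.
  congr fine; apply: ae_eq_integral => //.
  - exact: measurable_int hi.
  - exact: measurable_int (integrable_normR hi).
  - apply: filterS fg => z fz _ /=; rewrite ger0_norm//.
    by rewrite subr_ge0.
by apply: Rintegral_ge0.
Qed.

(** Fatou's lemma: a uniform bound on the integrals passes to the pointwise limit. *)
Lemma nonneg_integrable (f : E -> R) (fk : nat -> E -> R) (B : R) :
  (forall k, L1 (fk k)) -> (forall k z, 0 <= fk k z) ->
  (forall z, fk k z @[k --> \oo] --> f z) -> (forall k, \int[mu]_z fk k z <= B) -> L1 f.
Proof.
move=> ik f0 cf HB.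
have mk k := measurable_of_integrable (ik k).
have mf : measurable_fun setT f.
  by apply: (@measurable_fun_cvg _ _ _ _ fk) => // z _; exact: cf.
have fpos z : 0 <= f z.
  rewrite -(cvg_lim _ (cf z))//; apply: limr_ge; first exact: cvgP (cf z).
  exact: nearW.
apply/integrableP; split; first exact/measurable_EFinP.
have -> : (\int[mu]_z `|(EFin \o f) z| = \int[mu]_z limn_einf (fun k => (fk k z)%:E))%E.
  apply: eq_integral => z _; rewrite /= ger0_norm//.
  have cz : (fk k z)%:E @[k --> \oo] --> (f z)%:E by apply: cvg_EFin; [exact: nearW|exact: cf].
  by rewrite (cvg_limn_einf_sup cz).1.
apply: (@le_lt_trans _ _ B%:E); last exact: ltry.
apply: le_trans (@fatou _ _ _ mu _ measurableT (fun k z => (fk k z)%:E) _ _) _.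
- by move=> k; exact/measurable_EFinP.
- by move=> k z _; rewrite lee_fin.
rewrite limn_einf_lim; apply: lime_le; first exact: is_cvg_einfs.
apply: nearW => k; apply: (@le_trans _ _ (\int[mu]_z (fk k z)%:E)%E).
  by apply: ereal_inf_lbound; exists k => /=.
have F : (\int[mu]_z (fk k z)%:E)%E \is a fin_num by exact: integrable_fin_num (ik k).
by rewrite -(fineK F) lee_fin; exact: HB.
Qed.

Lemma ae_time_neq0 : {ae mu, forall z, z.2 != 0}.
Proof.
exists (setT `*` [set 0]); split.
- by apply: measurableX.
- rewrite /lebesgue_st product_measure1E//= lebesgue_measure_set1 mule0//.
- by move=> z /= /negP; rewrite negbK => /eqP z0; split.
Qed.

Variables (p q s al : R) (m : nat) (M : R).
Hypotheses (q_gt1 : 1 < q) (le_qp : q <= p) (p_lts : p - 1 < s) (s_gt1 : 1 < s).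
Hypotheses (al_gt0 : 0 < al) (al_lt1 : al < 1) (al_ltq : al < q - 1) (al_s : (1 + al) * (p - 1) < s).
Hypotheses (m_gt0 : (0 < m)%N) (m_large : forall a, a \in exponents p q al -> p * s <= m.+1%:R * (s - a)).
Hypotheses (M_ge0 : 0 <= M) (HM : forall x : R, `|'D_1 plateau x| <= M).
Hypothesis n_le_ga : n%:R <= ga q s.

Local Notation L K := (Lk q s K).
Local Notation phi K := (@cutoff R n (L K) K m).

(** The volume is [4^(n+1) * K^(n + be)] and [be - ga * s = - ga], so the product equals
    [4^(n+1) * K^(n - ga)]. Here the critical exponent enters, through [n <= ga]. *)
Lemma integral_box K : 1 <= K ->
  L1 (fun z => \1_(box q s K) z) /\ rho q s K `^ s * \int[mu]_z \1_(box q s K) z <= 4 ^+ n.+1.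
Proof.
move=> K1; have K0 : 0 < K := lt_le_trans ltr01 K1.
have L0 : forall c : option 'I_n, 0 < L K c := Lk_gt0 q s K1.
pose A (c : option 'I_n) : set R := `[- (2 * L K c), 2 * L K c]%classic.
have BE : box q s K = [set z : E | forall c, A c (co c z)].
  by apply/seteqP; split => z H c; have := H c; rewrite /A /= in_itv/= ler_norml.
have mA c : measurable (A c) by exact: measurable_itv.
have mB : measurable (box q s K : set mE) by rewrite BE; exact: measurable_box.
have lA c : lebesgue_measure (A c) = (4 * L K c)%:E.
  rewrite /A lebesgue_measure_itv/= lte_fin ifT; last by have := L0 c; lra.
  by rewrite -EFinD; congr EFin; ring.
have muB : mu (box q s K) = (4 ^+ n.+1 * K `^ (n%:R + be q s))%:E.
  rewrite BE lebesgue_st_box// lA; under eq_bigr do rewrite lA /=.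
  rewrite prodEFin -EFinM prodr_const card_ord exprMn exprS powRDp// powR_mulrn ?(ltW K0)//.
  by congr EFin; rewrite /=; ring.
have iB : L1 (fun z => \1_(box q s K) z).
  apply/integrableP; split; first by apply/measurable_EFinP; exact: measurable_indic mB.
  under eq_integral do rewrite /= ger0_norm//.
  rewrite integral_indic// setIT.
  have H : (mu (box q s K) < +oo)%E by rewrite muB ltry.
  exact: H.
split => //.
have -> : \int[mu]_z \1_(box q s K) z = 4 ^+ n.+1 * K `^ (n%:R + be q s).
  by rewrite /Rintegral integral_indic// setIT; exact: (congr1 fine muB).
rewrite mulrCA ler_piMr ?exprn_ge0//.
rewrite /rho -powRrM -powRDp// -[leRHS](powRr0 K) ler_powR//.
rewrite /be; have := n_le_ga; lra.
Qed.

Lemma cutoff_estimate (N K ka om : R) (U : E -> R) (g : option 'I_n -> E -> R) :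
  local_solution p q s N U g -> 1 <= K -> (forall c : option 'I_n, 2 * L K c <= N - 1) ->
  0 < ka -> 0 < om ->
  \int[mu]_z (U z `^ s * phi K z) <= total_cst (n := n) p q al m M * 4 ^+ n.+1 * ka
    + total_cst (n := n) p q al m M * 2 `^ s * 4 ^+ n.+1 * absorb_cst p q s al ka *
      (\int[mu]_z (U z `^ s * phi K z * \1_(~` core (L K)) z) + om `^ s).
Proof.
move=> sol K1 HN ka0 om0; have [_ iUs _ _ _ U0 _ _ _ _] := sol.
have K0 : 0 < K := lt_le_trans ltr01 K1.
have L0 : forall c : option 'I_n, 0 < L K c := Lk_gt0 q s K1.
have adm := admissible_cutoff m L0 K0 HN.
have rho0 : 0 < rho q s K by exact: powR_gt0.
have [iN IN] := nonlinear_inequality q_gt1 le_qp sol al_gt0 al_lt1 (mulr_gt0 om0 rho0) (powR_ge0 (rho q s K) al) adm.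
have [iB IB] := integral_box K1.
have sphi : smooth (phi K) by case: adm.
have mphi := continuous_measurable_st (smooth_cont sphi).
have phi1 z : `|phi K z| <= 1 by rewrite ger0_norm ?cutoff_ge0 ?cutoff_le1.
have i1 : L1 (fun z => U z `^ s * phi K z).
  by under eq_fun do rewrite mulrC; exact: integrableMbR iUs mphi phi1.
have mI : measurable_fun setT ((fun z => \1_(~` core (L K)) z) : mE -> R).
  by apply: measurable_indic; apply: measurableC; exact: measurable_core.
have i2 : L1 (fun z => U z `^ s * phi K z * \1_(~` core (L K)) z).
  under eq_fun do rewrite mulrC; apply: (@integrableMbR _ _ _ mu _ _ 1 i1 mI) => z.
  by rewrite indicE normr_nat lern1 leq_b1.
set T := total_cst p q al m M; set Kk := absorb_cst p q s al ka.
have T0 : 0 <= T by exact: total_cst_ge0.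
have Kk0 : 0 <= Kk by exact: absorb_cst_ge0.
set rs := rho q s K `^ s in IB *.
pose a1 := T * ka * rs + T * 2 `^ s * Kk * om `^ s * rs.
pose a2 := T * 2 `^ s * Kk.
have iR : L1 (fun z => nonlinear_integrand p q s U g al (om * rho q s K) (rho q s K `^ al) (phi K) z
   + (a1 * \1_(box q s K) z + a2 * (U z `^ s * phi K z * \1_(~` core (L K)) z))).
  by apply: integrableDR => //; apply: integrableDR; exact: integrableZR.
have H : \int[mu]_z (U z `^ s * phi K z) <= \int[mu]_z (nonlinear_integrand p q s U g al (om * rho q s K) (rho q s K `^ al) (phi K) z
   + (a1 * \1_(box q s K) z + a2 * (U z `^ s * phi K z * \1_(~` core (L K)) z))).
  apply: ae_le_Rintegral => //; apply: filterS U0 => z Uz.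
  have := pointwise_inequality q_gt1 le_qp p_lts s_gt1 al_gt0 al_lt1 al_ltq al_s m_gt0 m_large M_ge0 HM K1 ka0 g Uz om0.
  congr (_ <= _ + _); rewrite /a1 /a2 /T /Kk /rs; ring.
apply: le_trans H _.
rewrite RintegralD//; last by apply: integrableDR; exact: integrableZR.
rewrite [X in _ + X]RintegralD//; [|exact: integrableZR|exact: integrableZR].
rewrite !RintegralZl//.
set J := \int[mu]_z (_ * _ * _); set b := \int[mu]_z \1_(box q s K) z in IB *.
have a20 : 0 <= a2 := mulr_ge0 (mulr_ge0 T0 (powR_ge0 _ _)) Kk0.
have H1 : a1 * b <= T * 4 ^+ n.+1 * ka + a2 * 4 ^+ n.+1 * om `^ s.
  have -> : a1 * b = (T * ka + a2 * om `^ s) * (rs * b) by rewrite /a1 /a2; ring.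
  have -> : T * 4 ^+ n.+1 * ka + a2 * 4 ^+ n.+1 * om `^ s = (T * ka + a2 * om `^ s) * 4 ^+ n.+1 by ring.
  exact: (ler_wpM2l (addr_ge0 (mulr_ge0 T0 (ltW ka0)) (mulr_ge0 a20 (powR_ge0 _ _)))).
have J0 : 0 <= J.
  by apply: Rintegral_ge0 => z _; exact: mulr_ge0 (mulr_ge0 (powR_ge0 _ _) (cutoff_ge0 _ _ _ _)) _.
(* Gives both error terms the common factor [4^(n+1)]. *)
have H2 : a2 * J <= a2 * 4 ^+ n.+1 * J.
  by rewrite ler_wpM2r// ler_peMr ?exprn_ege1// ?ler1n.
have -> : T * 2 `^ s * 4 ^+ n.+1 * Kk * (J + om `^ s) = a2 * 4 ^+ n.+1 * J + a2 * 4 ^+ n.+1 * om `^ s by rewrite /a2; ring.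
move: IN H1 H2; clear; lra.
Qed.

End integration.

(** * Vanishing of the solution *)

Section vanishing.
Context {R : realType} {n : nat}.
Local Notation E := ('rV[R]_n * R)%type.
Local Notation mE := ('rV[R]_n * measurableTypeR R)%type.
Local Notation mu := (@lebesgue_st R n).
Local Notation L1 f := (mu.-integrable setT (EFin \o f)).
Implicit Types (f g psi phi : E -> R) (M e tau : R) (z w v : E) (k : nat).

Lemma powR_sum_small (s e : R) (r : seq R) : (forall a, a \in r -> 0 < a < s) -> 0 < e ->
  exists2 k0, 0 < k0 & forall ka, k0 <= ka -> \sum_(a <- r) ka `^ (1 - s / a) <= e.
Proof.
elim: r e => [|a r IH] e ra e0.
  by exists 1 => // ka _; rewrite big_nil ltW.
have e20 : 0 < e / 2 by exact: divr_gt0.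
have [k0 k00 Hk0] : exists2 k0, 0 < k0 & forall ka, k0 <= ka -> \sum_(a <- r) ka `^ (1 - s / a) <= e / 2.
  by apply: IH => // b br; apply: ra; rewrite inE br orbT.
have /andP[a0 as_] := ra _ (mem_head _ _).
pose b := s / a - 1; have b0 : 0 < b by rewrite subr_gt0 ltr_pdivlMr// mul1r.
(* Solves [k1^(1 - s/a) = e / 2]; larger values only decrease the power. *)
pose k1 := (e / 2) `^ (- b^-1); have k10 : 0 < k1 by exact: powR_gt0.
exists (Num.max k0 k1); first by rewrite lt_max k00.
move=> ka; rewrite ge_max => /andP[ka0 ka1]; rewrite big_cons (splitr e) lerD//; last exact: Hk0.
have kap : 0 < ka := lt_le_trans k00 ka0.
have -> : e / 2 = k1 `^ (1 - s / a).
  rewrite /k1 -powRrM (_ : - b^-1 * (1 - s / a) = 1) ?powRr1 ?ltW//.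
  by rewrite -[1 - _]opprB -/b mulrNN mulVf// gt_eqF.
rewrite -(opprB _ 1) -/b !powRN lef_pV2 ?posrE ?powR_gt0//.
by apply: ge0_ler_powR; rewrite ?nnegrE ?(ltW b0) ?(ltW k10) ?(ltW kap).
Qed.

Variables (p q s al : R) (m : nat) (M : R).
Hypotheses (q_gt1 : 1 < q) (le_qp : q <= p) (p_lts : p - 1 < s) (s_gt1 : 1 < s).
Hypotheses (al_gt0 : 0 < al) (al_lt1 : al < 1) (al_ltq : al < q - 1) (al_s : (1 + al) * (p - 1) < s).
Hypotheses (m_gt0 : (0 < m)%N) (m_large : forall a, a \in exponents p q al -> p * s <= m.+1%:R * (s - a)).
Hypotheses (M_ge0 : 0 <= M) (HM : forall x : R, `|'D_1 plateau x| <= M).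
Hypothesis n_le_ga : n%:R <= ga q s.

Lemma absorb_cst_small e : 0 < e -> exists2 ka, 0 < ka & absorb_cst p q s al ka <= e.
Proof.
move=> e0; have H a := @exponents_bounds R p q s al q_gt1 le_qp p_lts s_gt1 al_gt0 al_lt1 al_ltq al_s a.
have [k0 k00 Hk] := powR_sum_small H e0.
by exists k0 => //; exact: Hk.
Qed.

Lemma be_gt0 : 0 < be q s.
Proof.
rewrite mulr_gt0 ?subr_gt0//; rewrite divr_gt0//; first exact: lt_trans q_gt1.
by move: le_qp p_lts => ? ?; lra.
Qed.

Let Kn k : R := k.+1%:R.
Let Kn_ge1 k : 1 <= Kn k. Proof. by rewrite /Kn ler1n. Qed.
Let Kn_gt0 k : 0 < Kn k. Proof. by rewrite /Kn. Qed.
Local Notation phi k := (@cutoff R n (Lk q s (Kn k)) (Kn k) m).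
Local Notation cor k := (@core R n (Lk q s (Kn k))).

Lemma near_core z : \forall k \near \oo, cor k z.
Proof.
pose B := `|z| + 1; have B0 : 0 < B by rewrite ltr_wpDl.
near=> k.
have K1 : B <= Kn k.
  by apply: le_trans (_ : k%:R <= _); [near: k; exact: nbhs_infty_ger|rewrite ler_nat].
(* Equivalent to [B <= K^be], since [be] is positive. *)
have K2 : B `^ (be q s)^-1 <= Kn k.
  by apply: le_trans (_ : k%:R <= _); [near: k; exact: nbhs_infty_ger|rewrite ler_nat].
move=> c; apply: (@lt_le_trans _ _ B).
  by rewrite (le_lt_trans (norm_co_le _ _))// ltrDl.
case: c => [i|] //=.
have -> : B = (B `^ (be q s)^-1) `^ be q s.
  by rewrite -powRrM mulVf ?powRr1 ?(ltW B0)// gt_eqF// be_gt0.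
by apply: ge0_ler_powR; rewrite ?nnegrE ?powR_ge0 ?(ltW be_gt0)// ltW.
Unshelve. all: by end_near. Qed.

Lemma near_phi z : 0 < z.2 -> \forall k \near \oo, phi k z = 1.
Proof.
move=> z0; near=> k; apply: cutoff_in => //.
- exact: Lk_gt0.
- by move=> c; apply: ltW; move: c; near: k; exact: near_core.
- by apply: ltW; near: k; exact: near_invS_lt.
Unshelve. all: by end_near. Qed.

Variable u : E -> R.
Hypothesis u_loc : forall N, exists (U : E -> R) (g : option 'I_n -> E -> R), local_solution p q s N U g /\
  (forall z, cube N z -> 0 <= z.2 -> U z = u z).

(** Cut to positive times, outside of which the cutoffs vanish, so that [F k] converges to [f]
    everywhere. *)
Let f z : R := if 0 < z.2 then u z `^ s else 0.
Let F k z : R := f z * phi k z.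
Let f_ge0 z : 0 <= f z.
Proof. by rewrite /f; case: ifP => // _; exact: powR_ge0. Qed.

(** The truncation depends on [k], but [C1] and [C2] do not: on the support of the cutoff the
    truncated function is [u], so the estimates for all scales concern one function. *)
Lemma F_estimate : exists C1 C2 : R, [/\ 0 <= C1, 0 <= C2 & forall k, L1 (F k) /\
  forall ka om, 0 < ka -> 0 < om ->
   \int[mu]_z F k z <= C1 * ka + C2 * absorb_cst p q s al ka * (\int[mu]_z (F k z * \1_(~` cor k) z) + om `^ s)].
Proof.
have T0 : 0 <= total_cst (n := n) p q al m M by exact: total_cst_ge0.
exists (total_cst (n := n) p q al m M * 4 ^+ n.+1), (total_cst (n := n) p q al m M * 2 `^ s * 4 ^+ n.+1); split.
- by apply: mulr_ge0 => //; exact: exprn_ge0.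
- by apply: mulr_ge0; [apply: mulr_ge0 => //; exact: powR_ge0|exact: exprn_ge0].
(* Large enough for both length scales, with the margin [1] required by mollification. *)
move=> k; pose N := 2 * (Kn k + Kn k `^ be q s) + 1.
have L0 : forall c : option 'I_n, 0 < Lk q s (Kn k) c := Lk_gt0 q s (Kn_ge1 k).
have NL (c : option 'I_n) : 2 * Lk q s (Kn k) c <= N - 1.
  have := Kn_gt0 k; have := powR_gt0 (be q s) (Kn_gt0 k).
  by rewrite /N addrK; case: c => [i|] /= ? ?; rewrite ler_pM2l// ?lerDl ?lerDr ltW.
have [U [g [sol Uu]]] := u_loc N.
have adm := admissible_cutoff m L0 (Kn_gt0 k) NL.
have [sphi _ _ phiN phit] := adm.
have FE : F k = fun z => U z `^ s * phi k z.
  apply/funext => z; rewrite /F /f; have [z0|z0] := ltP 0 z.2; last first.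
    by rewrite phit ?mulr0// (le_trans z0)// invr_ge0 mulr_ge0// ltW.
  have [Nz|Nz] := pselect (cube N z); first by rewrite Uu// ltW.
  by rewrite phiN ?mulr0// => H; apply: Nz => c; have := H c; lra.
rewrite FE; split.
  have phi1 z : `|phi k z| <= 1 by rewrite ger0_norm ?cutoff_ge0 ?cutoff_le1.
  under eq_fun do rewrite mulrC.
  exact: integrableMbR (ls_Us sol) (continuous_measurable_st (smooth_cont sphi)) phi1.
move=> ka om ka0 om0.
have H := cutoff_estimate q_gt1 le_qp p_lts s_gt1 al_gt0 al_lt1 al_ltq al_s m_gt0 m_large M_ge0 HM n_le_ga sol (Kn_ge1 k) NL.
exact: (H _ _ ka0 om0).
Qed.

Lemma vanishing : {ae mu, forall z, 0 < z.2 -> u z = 0}.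
Proof.
(* The absorption: [a] is the integral of [F k], [b] its part in the transition region, and the
   factor [d] is at most [1/2]. *)
have arith (a b c d : R) : b <= a -> d * (b + 1) <= 1 / 2 * (b + 1) -> a <= c + d * (b + 1) ->
    a <= 2 * c + 1 by move=> *; lra.
have [C1 [C2 [C10 C20 HF]]] := F_estimate.
have iF k : L1 (F k) := (HF k).1.
have est k := (HF k).2.
have F0 k z : 0 <= F k z by apply: mulr_ge0 (f_ge0 z) (cutoff_ge0 _ _ _ _).
have cF z : F k z @[k --> \oo] --> f z.
  apply: cvg_near_cst; have [z0|z0] := ltP 0 z.2; last first.
    by apply: nearW => k; rewrite /F /f ltNge z0 mul0r.
  by apply: filterS (near_phi z0) => k pk; rewrite /F pk mulr1.
have I01 k z : (0 : R) <= \1_(~` cor k) z <= (1 : R) by rewrite indicE ler0n lern1 leq_b1.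
have mI k : measurable_fun setT ((fun z => \1_(~` cor k) z) : mE -> R).
  by apply: measurable_indic; apply: measurableC; exact: measurable_core.
have iFI k : L1 (fun z => F k z * \1_(~` cor k) z).
  under eq_fun do rewrite mulrC; apply: (@integrableMbR _ _ _ mu _ _ 1 (iF k) (mI k)) => z.
  by have /andP[? ?] := I01 k z; rewrite ger0_norm.
have FIF k : \int[mu]_z (F k z * \1_(~` cor k) z) <= \int[mu]_z F k z.
  apply: le_Rintegral => // z _; have /andP[? ?] := I01 k z.
  by rewrite ler_piMr.
(* Makes [C2 * absorb_cst] at most [1/2]; the added [1] covers [C2 = 0]. *)
have eC0 : 0 < (2 * (C2 + 1))^-1 by rewrite invr_gt0 mulr_gt0// ltr_wpDl.
have [ka0 ka00 Hka0] := absorb_cst_small eC0.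
have CK : C2 * absorb_cst p q s al ka0 <= 1 / 2.
  apply: (@le_trans _ _ ((C2 + 1) * (2 * (C2 + 1))^-1)).
    by apply: ler_pM => //; [exact: absorb_cst_ge0|rewrite lerDl].
  by rewrite le_eqVlt; apply/orP; left; apply/eqP; field; rewrite gt_eqF// ltr_wpDl.
have HB k : \int[mu]_z F k z <= 2 * (C1 * ka0) + 1.
  have IF0 : 0 <= \int[mu]_z F k z by apply: Rintegral_ge0.
  have FI0 : 0 <= \int[mu]_z (F k z * \1_(~` cor k) z).
    by apply: Rintegral_ge0 => z _; have /andP[? ?] := I01 k z; rewrite mulr_ge0.
  have := est k ka0 1 ka00 ltr01; rewrite powR1.
  have := ler_wpM2r (addr_ge0 FI0 ler01) CK; have := FIF k.
  exact: arith.
have i_f : L1 f := nonneg_integrable iF F0 cF HB.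
have mF k := measurable_of_integrable (iF k).
have mf := measurable_of_integrable i_f.
have Ff k z : `|F k z| <= f z.
  by rewrite ger0_norm// ler_piMr ?cutoff_le1 ?f_ge0.
have [_ lim1] := @Rdominated_cvg _ _ _ mu F f f mF mf (aeW mu cF) i_f (aeW mu (fun z k => Ff k z)).
have c0 z : F k z * \1_(~` cor k) z @[k --> \oo] --> (0 : R).
  apply: cvg_near_cst; apply: filterS (near_core z) => k ck.
  by rewrite indicE memNset ?mulr0.
have FIf k z : `|F k z * \1_(~` cor k) z| <= f z.
  have /andP[? ?] := I01 k z; rewrite normrM (ger0_norm (x := \1_(~` cor k) z))//.
  by rewrite (le_trans _ (Ff k z))// ler_piMr.
have m0 : measurable_fun setT ((fun=> 0) : mE -> R) by exact: measurable_cst.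
have [_ lim2] := @Rdominated_cvg _ _ _ mu (fun k z => F k z * \1_(~` cor k) z) (fun=> 0) f
  (fun k => measurable_of_integrable (iFI k)) m0 (aeW mu c0) i_f (aeW mu (fun z k => FIf k z)).
have I0 : \int[mu]_z (0 : R) = 0 by rewrite /Rintegral integral0.
rewrite I0 in lim2.
pose J := \int[mu]_z f z.
(* Now [f] is known to be integrable and every point eventually lies in the core, so the transition
   integral tends to [0] along [k], for any fixed [ka] and [om]. *)
have HJ ka om : 0 < ka -> 0 < om -> J <= C1 * ka + C2 * absorb_cst p q s al ka * om `^ s.
  move=> ka1 om1; rewrite -[om `^ s]add0r.
  pose g k := C1 * ka + C2 * absorb_cst p q s al ka * (\int[mu]_z (F k z * \1_(~` cor k) z) + om `^ s).
  have gl : g k @[k --> \oo] --> C1 * ka + C2 * absorb_cst p q s al ka * (0 + om `^ s).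
    apply: cvgD; first exact: cvg_cst.
    by apply: cvgM; [exact: cvg_cst|apply: cvgD => //; exact: cvg_cst].
  apply: (ler_cvg_to lim1 gl); apply: nearW => k.
  exact: (est k ka om ka1 om1).
have J0 : J <= 0.
  apply/ler_addgt0Pr => e e0; rewrite add0r.
  have D1 : 0 < 2 * (C1 + 1) by rewrite mulr_gt0// ltr_wpDl.
  (* Each remaining term is made at most [e / 2]. The value [om = d^(1/s)] comes after [ka], because
     [c] depends on [ka] and may be large when [ka] is small. *)
  pose ka := e / (2 * (C1 + 1)); have ka1 : 0 < ka by exact: divr_gt0.
  pose c := C2 * absorb_cst p q s al ka; have c00 : 0 <= c by rewrite mulr_ge0// absorb_cst_ge0.
  have D2 : 0 < 2 * (c + 1) by rewrite mulr_gt0// ltr_wpDl.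
  pose d := e / (2 * (c + 1)); have d1 : 0 < d by exact: divr_gt0.
  have s0 : 0 < s := lt_trans ltr01 s_gt1.
  apply: le_trans (HJ ka (d `^ s^-1) ka1 (powR_gt0 _ d1)) _.
  rewrite -powRrM mulVf ?gt_eqF// powRr1 ?(ltW d1)// -/c (splitr e) lerD//.
    have -> : e / 2 = (C1 + 1) * ka by rewrite /ka; field; rewrite gt_eqF// ltr_wpDl.
    by rewrite ler_wpM2r ?(ltW ka1)// lerDl.
  have -> : e / 2 = (c + 1) * d by rewrite /d; field; rewrite gt_eqF// ltr_wpDl.
  by rewrite ler_wpM2r ?(ltW d1)// lerDl.
have JE : (\int[mu]_z `|(f z)%:E| = 0)%E.
  under eq_integral do rewrite /= ger0_norm//.
  have Ffin : (\int[mu]_z (f z)%:E)%E \is a fin_num by exact: integrable_fin_num i_f.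
  rewrite -(fineK Ffin); congr EFin; apply/eqP; rewrite eq_le J0/=.
  by apply: Rintegral_ge0.
have mfE : measurable_fun setT (EFin \o f : mE -> \bar R) by exact/measurable_EFinP.
have := (ae_eq_integral_abs mu measurableT mfE).1 JE.
apply: filterS => z /(_ I) [] fz z0; move: fz; rewrite /f z0 => /eqP.
by rewrite powR_eq0 => /andP[/eqP].
Qed.

End vanishing.

(** * Choice of the parameters and conclusion *)

Lemma weak_solution_local (R : realType) (n : nat) (p q s N : R) (u0 : 'rV[R]_n -> R)
    (u : 'rV[R]_n * R -> R) (Du : 'rV[R]_n * R -> 'rV[R]_n) (ut : 'rV[R]_n * R -> R) :
  1 < q -> q <= p -> 1 < s -> Lp_loc s%:E u -> nonneg_ae u -> W1p_loc p u Du ut ->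
  (forall psi Dpsi psit (psi0 : 'rV[R]_n -> R),
    W1p p psi Dpsi psit -> Lp +oo%E (half_space (n := n)) psi ->
    nonneg_ae psi -> compact_support psi -> trace0 p psi Dpsi psit psi0 ->
    weak_inequality p q s u0 u Du psi Dpsi psit psi0) ->
  local_solution p q s N (u \_ (half_cube N)) (fun c => (DU Du ut c) \_ (half_cube N)).
Proof.
move=> q1 qp s1 uLs u0' uW uw; split.
- exact: integrable_uW s1 uLs N.
- exact: integrable_uWs s1 uLs N.
- exact: (integrable_gW q1 qp uW N).
- exact: (integrable_gWp q1 qp uW N).
- exact: (integrable_enormp q1 qp uW N).
- exact: uW_ge0 u0' N.
- exact: uW_out.
- by move=> c z; exact: gW_out.
- by move=> k c z tau; exact: (derive_mollify_uW s1 uLs uW).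
- by move=> tau psi adm; have [_ H] := truncated_inequality q1 qp s1 uLs uW uw adm; exact: H.
Qed.

(** There are finitely many exponents, so the ratios [C / (s - a)] have a common bound and the
    archimedean property supplies [m]. *)
Lemma exponent_large (R : realType) (C s : R) (r : seq R) : (forall a, a \in r -> a < s) ->
  exists m : nat, (0 < m)%N /\ forall a, a \in r -> C <= m.+1%:R * (s - a).
Proof.
move=> ra; have [B HB] : exists B : R, forall a, a \in r -> C / (s - a) <= B.
  elim: r {ra} => [|b r [B HB]]; first by exists 0.
  exists (Num.max (C / (s - b)) B) => a; rewrite inE => /orP[/eqP ->|ar]; rewrite le_max ?lexx//.
  by rewrite HB ?orbT.
exists (Num.bound `|B|).+1; split => // a ar.
have sa : 0 < s - a by rewrite subr_gt0 ra.
rewrite -ler_pdivrMr//; apply: le_trans (HB a ar) _; apply: le_trans (ler_norm _) _.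
by rewrite ltW// (lt_le_trans (archi_boundP (normr_ge0 B)))// ler_nat (leq_trans (leqnSn _)) .
Qed.

Theorem corollary1p7 (R : realType) (n : nat) (p q s : R)
    (u0 : 'rV[R]_n -> R) (u : 'rV[R]_n * R -> R)
    (n_gt0 : (0 < n)%N) (q_gt1 : 1 < q) (le_qp : q <= p)
    (lt_s : Num.max (p - 1) 1 < s)
    (s_le : s <= (n%:R + 1) / n%:R * q - 1)
    (u0_L1 : (lebesgue_rV n).-integrable setT (EFin \o u0))
    (u0_ge0 : {ae lebesgue_rV n, forall x, 0 <= u0 x})
    (u_sol : weak_solution p q s u0 u) :
  {ae @lebesgue_st R n, forall z, half_space z -> u z = 0}.
Proof.
have [uLs [u_ge0 [Du [ut [uW uw]]]]] := u_sol.
move: lt_s; rewrite gt_max => /andP[p_lts s_gt1].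
have n0 : 0 < n%:R :> R by rewrite ltr0n.
have D0 : 0 < s - q + 1 by lra.
(* After clearing denominators the hypothesis on [s] is [n * (s - q + 1) <= q]. *)
have n_le_ga : n%:R <= ga q s.
  rewrite /ga ler_pdivlMr// -ler_pdivlMl//.
  suff -> : n%:R^-1 * q = (n%:R + 1) / n%:R * q - 1 - q + 1 by lra.
  by field; rewrite gt_eqF.
have p0 : 0 < p by lra.
(* The three bounds give [al < 1], [al < q - 1], and [al * (p - 1) < s - (p - 1)], the latter
   because [al * p] is at most half of [s - (p - 1)]. *)
pose al := Num.min 2^-1 (Num.min ((q - 1) / 2) ((s - (p - 1)) / (2 * p))).
have al_gt0 : 0 < al by rewrite !lt_min; apply/and3P; split; rewrite ?divr_gt0//; lra.
have al_le : [/\ al <= 2^-1, al <= (q - 1) / 2 & al <= (s - (p - 1)) / (2 * p)].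
  by split; rewrite /al !ge_min lexx ?orbT.
have [al1 al2 al3] := al_le.
have al_lt1 : al < 1 by lra.
have al_ltq : al < q - 1 by lra.
have al_s : (1 + al) * (p - 1) < s.
  by move: al3; rewrite ler_pdivlMr ?mulr_gt0//; nra.
have [m [m_gt0 m_large]] := exponent_large (p * s) (fun a ar =>
  proj2 (andP (exponents_bounds q_gt1 le_qp p_lts s_gt1 al_gt0 al_lt1 al_ltq al_s ar))).
have [M M_ge0 HM] := @derive_plateau_bounded R.
have u_loc N : exists (U : 'rV[R]_n * R -> R) (g : option 'I_n -> 'rV[R]_n * R -> R),
    local_solution p q s N U g /\ (forall z, cube N z -> 0 <= z.2 -> U z = u z).
  exists (u \_ (half_cube N)), (fun c => (DU Du ut c) \_ (half_cube N)); split.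
    exact: weak_solution_local uw.
  by move=> z Nz z0; rewrite patchE mem_set.
have V := vanishing q_gt1 le_qp p_lts s_gt1 al_gt0 al_lt1 al_ltq al_s m_gt0 m_large M_ge0 HM n_le_ga u_loc.
(* The slice at time [0] is negligible, which extends the conclusion from positive times to the
   closed half-space. *)
apply: filterS2 V (@ae_time_neq0 R n) => z uz z0 hz; apply: uz.
by rewrite lt_neqAle eq_sym z0.
Qed.
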